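(* Fix $\rho\in(-\infty,-2)$. Let $\eta$ denote an arc-length parametrization of the whole-plane $\mathrm{SLE}_0(\rho)$ starting at $\infty$ in the direction $1$, of any conformal radius, positive orientation, and with reference point $0$ and force point $\infty$. Then $\eta$ has a lift $\tilde\eta$ to $M_0$ such that $\arg(\tilde\eta(t))\to0$ as $t\to-\infty$. The curve $\tilde\eta$ is a flow-line of $h(z)=\frac{6+\rho}{4}\arg(z)+\pi$. This further implies that $\eta$ is (as a set) the image of $\{x+iy_0:x\in(x_0,\infty)\}$, for some $y_0>0$ and $x_0\in[-\infty,\infty)$, under $z\mapsto z^{-\frac4{2+\rho}}$, where the branch is chosen so that $\arg\big((x+iy_0)^{-\frac{4}{\rho+2}}\big)\to0$ as $x\to+\infty$.
   Context: Whole-plane Loewner chain (from $\infty$, with interior point $0$). For a continuous $w:(-\infty,T)\to\mathbb R$, the whole-plane Loewner chain with driving function $e^{iw_t}$ is the family of growing closed sets $(\gamma_t)_{t<T}$ (containing a neighborhood of $\infty$'s prime end, i.e. growing from $\infty$) with conformal maps $g_t:\mathbb C\setminus\gamma_t\to\mathbb D$, $g_t(0)=0$, $g_t'(0)=e^t$, satisfying $\partial_tg_t(z)=g_t(z)\frac{e^{iw_t}+g_t(z)}{e^{iw_t}-g_t(z)}$ for $t\in(-\infty,T)$ and $g_t(z)e^{-t}\to z$ as $t\to-\infty$ uniformly on compacts. The chain considered here is generated by a curve $\gamma:(-\infty,T)\to\mathbb C$, with $\gamma_t=\gamma((-\infty,t])$. Whole-plane $\mathrm{SLE}_0(\rho)$.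 For $\rho<-2$, $T\in\mathbb R$ (the conformal radius parameter, ''conformal radius $e^T$'') and $\theta\in\mathbb R$, the whole-plane $\mathrm{SLE}_0(\rho)$ started at $\infty$ in the direction $e^{i\theta}$, of positive orientation, with reference point $0$ and force point $\infty$, is the whole-plane Loewner chain with driving function $e^{iw_t}$, $$w_t=\frac{2\rho}{\rho+2}\arcsin\big(e^{\frac{\rho+2}4(T-t)}\big)+\theta,\qquad t\in(-\infty,T).$$ Direction $1$ means $\theta=0$. $M_0=\{(r,\vartheta):r>0,\vartheta\in\mathbb R\}$ is the logarithmic Riemann surface over $\mathbb C\setminus\{0\}$ with projection $(r,\vartheta)\mapsto re^{i\vartheta}$, so that $\arg:M_0\to\mathbb R$, $(r,\vartheta)\mapsto\vartheta$, is single-valued. A $C^1$ curve $\tilde\eta$ parametrized by arc-length is a flow-line of a field $h$ if $\tilde\eta'(t)=e^{ih(\tilde\eta(t))}$ (using the local identification of $M_0$ with $\mathbb C$). The arc-length parametrization runs in the direction of growth, $t\to-\infty$ corresponding to the start at $\infty$. *)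

(* Defs.v *)
From Stdlib Require Import Reals List.
From Coquelicot Require Import Coquelicot.

Open Scope R_scope.

Definition cis (x : R) : C := (cos x, sin x).

Definition compact_C (A : C -> Prop) : Prop :=
  forall (I : Type) (U : I -> C -> Prop),
    (forall i, open (U i)) ->
    (forall z, A z -> exists i, U i z) ->
    exists l : list I, forall z, A z -> exists i, In i l /\ U i z.

Definition is_holomorphic_derive (f : C -> C) (z l : C) : Prop :=
  @is_derive C_AbsRing C_NormedModule f z l.

(** [f] is only meaningful on [D]; its values elsewhere are junk. *)
Definition conformal_onto_disc (D : C -> Prop) (f : C -> C) : Prop :=
  (forall z, D z -> exists l, is_holomorphic_derive f z l) /\
  (forall z, D z -> Cmod (f z) < 1) /\
  (forall z1 z2, D z1 -> D z2 -> f z1 = f z2 -> z1 = z2) /\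
  (forall u, Cmod u < 1 -> exists z, D z /\ f z = u).

(** The whole-plane Loewner chain from infinity with interior point 0 and
    driving function [exp (i w)] on [(-oo, T)].  The last clause contains the
    fact that the hulls grow from infinity: each compact set is disjoint from
    [K t] when [t] is close to [-oo]. *)
Record whole_plane_Loewner_chain
    (T : R) (w : R -> R) (K : R -> C -> Prop) (g : R -> C -> C) : Prop := {
  chain_driving_continuous : forall t, t < T -> continuous w t;
  chain_growing : forall s t z, s <= t -> t < T -> K s z -> K t z;
  chain_closed : forall t, t < T -> closed (K t);
  chain_conformal :
    forall t, t < T -> conformal_onto_disc (fun z => ~ K t z) (g t);
  chain_interior_point : forall t, t < T -> ~ K t (RtoC 0);
  chain_fix0 : forall t, t < T -> g t (RtoC 0) = RtoC 0;
  chain_derive0 : forall t, t < T ->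
    is_holomorphic_derive (g t) (RtoC 0) (RtoC (exp t));
  chain_equation : forall t z, t < T -> ~ K t z ->
    @is_derive R_AbsRing C_R_NormedModule (fun s => g s z) t
      (g t z * ((cis (w t) + g t z) / (cis (w t) - g t z)))%C;
  chain_normalization : forall A : C -> Prop, compact_C A ->
    forall eps, 0 < eps ->
    exists t0, forall t, t < t0 -> t < T -> forall z, A z ->
      ~ K t z /\ Cmod (g t z * RtoC (exp (- t)) - z)%C < eps
}.

Definition generated_by_curve
    (T : R) (K : R -> C -> Prop) (gamma : R -> C) : Prop :=
  (forall t, t < T -> continuous gamma t) /\
  (forall t z, t < T -> (K t z <-> exists s, s <= t /\ gamma s = z)).

Definition SLE0_driving (rho T theta t : R) : R :=
  2 * rho / (rho + 2) * asin (exp ((rho + 2) / 4 * (T - t))) + theta.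

(** [gamma], on [(-oo, T)], is the curve generating the positively oriented
    whole-plane SLE_0(rho) from infinity in the direction [exp (i theta)], with
    reference point 0, force point infinity and conformal radius [exp T]. *)
Definition whole_plane_SLE0 (rho T theta : R) (gamma : R -> C) : Prop :=
  exists (K : R -> C -> Prop) (g : R -> C -> C),
    whole_plane_Loewner_chain T (SLE0_driving rho T theta) K g /\
    generated_by_curve T K gamma.

Definition polygonal_length (c : R -> C) (s t l : R) : Prop :=
  exists (n : nat) (p : nat -> R),
    p 0%nat = s /\ p (S n) = t /\
    (forall i, (i <= n)%nat -> p i <= p (S i)) /\
    l = sum_f_R0 (fun i => Cmod (c (p (S i)) - c (p i))%C) n.

Definition is_curve_length (c : R -> C) (s t L : R) : Prop :=
  is_lub (polygonal_length c s t) L.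

(** [eta], on [(-oo, b)], is an arc-length parametrization, in the direction of
    growth, of the curve [gamma] on [(-oo, T)].  The increasing bijection [sigma]
    from [(-oo, T)] onto [(-oo, b)] is the change of time.  The bound [b] may be
    [+oo], as the curve may return to infinity. *)
Definition arc_length_parametrization
    (T : R) (gamma : R -> C) (b : Rbar) (eta : R -> C) : Prop :=
  (exists sigma : R -> R,
     (forall t, t < T -> Rbar_lt (sigma t) b) /\
     (forall s t, s < t -> t < T -> sigma s < sigma t) /\
     (forall s : R, Rbar_lt s b -> exists t, t < T /\ sigma t = s) /\
     (forall t, t < T -> eta (sigma t) = gamma t)) /\
  (forall s t : R, s <= t -> Rbar_lt t b -> is_curve_length eta s t (t - s)).

(** The logarithmic Riemann surface over [C \ {0}]. *)
Record M0 : Type := mkM0 {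
  modulus : R;
  arg : R;
  modulus_pos : 0 < modulus
}.

Definition M0_proj (z : M0) : C := (RtoC (modulus z) * cis (arg z))%C.

Definition continuous_M0 (c : R -> M0) (t : R) : Prop :=
  continuous (fun s => modulus (c s)) t /\ continuous (fun s => arg (c s)) t.

Definition is_lift (D : R -> Prop) (c : R -> C) (c' : R -> M0) : Prop :=
  forall t, D t -> continuous_M0 c' t /\ M0_proj (c' t) = c t.

(** As [M0_proj] is the local identification of [M0] with [C], the derivative of
    a curve in [M0] is that of its projection. *)
Definition is_flow_line (h : M0 -> R) (D : R -> Prop) (c : R -> M0) : Prop :=
  forall t, D t ->
    continuous_M0 c t /\
    @is_derive R_AbsRing C_R_NormedModule
      (fun s => M0_proj (c s)) t (cis (h (c t))) /\
    continuous (fun s => cis (h (c s))) t.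

(** Real powers are single-valued on [M0]. *)
Definition M0_pow (z : M0) (p : R) : M0 :=
  mkM0 (Rpower (modulus z) p) (p * arg z) (exp_pos (p * ln (modulus z))).

(* Main.v *)
Require Import Defs.
From Stdlib Require Import Reals Lra Lia Psatz List ClassicalEpsilon.
From Coquelicot Require Import Coquelicot.

(** Put [k = - (rho + 2) / 4 > 0].  The driving function is [w = (2 + 1/k) a] with
    [sin a = exp (k (t - T))]; the time is recorded by [x = tan a], which increases from 0 to
    infinity and satisfies [x' = k x (1 + x^2)].  With [N = exp (i a / k)], which is minus
    the image of the force point, a trajectory [G_t = g_t(z)] is followed in the half-plane
    coordinate [Y = G / (G + N)], in which the unit disc is [Re Y < 1/2] and the Loewner
    equation reads [Y' = Y (1 - Y) (1 + x^2) / (1 - 2 Y + i x)].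

    The argument rests on an explicit constant of motion.  Let
    [J(Y) = int_0^1 (1 - u^(1/k) Y)^(k-1) du], so that [J + (Y/k) J' = (1 - Y)^(k-1)]
    (this is an incomplete Beta function: [Y^k J] is a primitive of
    [k Y^(k-1) (1 - Y)^(k-1)]).  With [D = 1/x + i (1 - Y)^(-k) J(Y)],
    [Y (1 - Y) D^(1/k)] is constant along trajectories, and its value is [z e^T] by the
    normalization at [- infinity] ([traj_conserved]).  The branch of [D^(1/k)] causes no
    trouble: the modulus is conserved without any choice of a branch, so [D] has no zero
    for any [x > 0] ([traj_D_neq_0]); since the maps [g_t] are onto, this holds for all [Y]
    and [x], and as [x] only enters through the summand [1/x], which takes all positive
    values, [D] never meets the negative half-line ([chain_slit]).

    Hence [z = F(x, Y)] for an explicit [F] ([chain_formula]).  On the boundary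
    [Y = (1 + i y) / 2] the number [(Y (1 - Y))^k D] has constant positive imaginary part, so
    [F(x, Y)] is the [1/k]-th power of a point of a fixed horizontal line ([Ffun_bd]).  The
    driving point corresponds to [y = x], where the abscissa on that line is minimal for
    the given [x] and decreases from infinity when [x] increases ([Xbd_min],
    [Xtip_decr]).

    The curve is identified with this predicted tip as follows.  The tip at time [t] is a
    limit of points whose images under [g_t] tend to the unit circle, so it lies in [K_t]
    ([tip_in_hull]).  If [z = gamma(t)] was not visited before [t], a limit point of [Y] as
    [s] increases to [t] cannot be inside the half-plane, since [z] would then be outside
    [K_t]; on the boundary, [z] is the predicted tip at some time [t' <= t], and [t' = t] by
    [tip_in_hull] ([first_visit_tip]).  First visits are dense, because otherwise the
    predicted tip would run along its own past during a time interval, while the double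
    points of a power of a line are isolated ([first_visits_dense]).  By continuity
    [gamma] is the predicted tip at all times ([curve_eq]).

    Finally, if the polygonal lengths of a regular curve have the elapsed time as supremum,
    the curve is run at unit speed ([CDer_arc_length]).  The derivative of
    [v |-> (v + i y0)^(1/k)] has direction [(1/k - 1) arg (v + i y0)]
    ([dpcurve_direction]), which is [(1 - k)] times the argument of the point reached; the
    field [h] adds [PI] to it because the abscissa [v] decreases along the curve. *)

Local Open Scope R_scope.


(** * Curves in the complex plane *)

(** Derivative of a complex-valued function of a real variable, by real and imaginary
    parts. *)
Definition CDer (f : R -> C) (t : R) (l : C) : Prop :=
  is_derive (fun s => fst (f s)) t (fst l) /\
  is_derive (fun s => snd (f s)) t (snd l).

Lemma Ceq (z w : C) : fst z = fst w -> snd z = snd w -> z = w.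
Proof. destruct z, w; simpl; intros; subst; reflexivity. Qed.

Lemma CDer_is_derive (f : R -> C) t l :
  CDer f t l <-> @is_derive R_AbsRing C_R_NormedModule f t l.
Proof.
split.
- intros [h1 h2].
  split.
  { apply is_linear_scal_l. }
  intros x Hx. apply (is_filter_lim_locally_unique (V:=R_NormedModule)) in Hx. rewrite <- Hx. clear x Hx.
  intros eps.
  assert (Hs : 0 < eps / 2) by (destruct eps; simpl; lra).
  destruct h1 as [_ h1]; destruct h2 as [_ h2].
  specialize (h1 t (fun P H => H) (mkposreal _ Hs)).
  specialize (h2 t (fun P H => H) (mkposreal _ Hs)).
  generalize (filter_and _ _ h1 h2). apply filter_imp.
  intros y [H1 H2]. simpl in H1, H2.
  eapply Rle_trans. apply (norm_prod (K:=R_AbsRing) (U:=R_NormedModule) (V:=R_NormedModule)).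
  simpl.
  set (u := norm (minus y t)) in *.
  match goal with |- sqrt 2 * Rmax ?a ?b <= _ => assert (Rmax a b <= eps / 2 * u) end.
  { apply Rmax_lub; assumption. }
  assert (sqrt 2 <= 2).
  { replace 2 with (sqrt (2*2)) at 2 by (apply sqrt_square; lra). apply sqrt_le_1; lra. }
  assert (0 <= u) by apply norm_ge_0.
  assert (0 <= eps / 2 * u) by (apply Rmult_le_pos; lra).
  apply Rle_trans with (sqrt 2 * (eps / 2 * u)).
  { apply Rmult_le_compat_l. apply sqrt_pos. assumption. }
  change (sqrt 2 * (eps / 2 * u) <= eps * u). nra.
- intros HH. split.
  + apply (filterdiff_ext_lin _ (fun x => fst (scal (V:=C_R_NormedModule) x l))); [|reflexivity].
    apply (filterdiff_comp (V:=C_R_NormedModule) (W:=R_NormedModule) f (fun z => fst z) (fun x => scal x l) fst).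
    exact HH.
    apply filterdiff_linear. apply is_linear_fst.
  + apply (filterdiff_ext_lin _ (fun x => snd (scal (V:=C_R_NormedModule) x l))); [|reflexivity].
    apply (filterdiff_comp (V:=C_R_NormedModule) (W:=R_NormedModule) f (fun z => snd z) (fun x => scal x l) snd).
    exact HH.
    apply filterdiff_linear. apply is_linear_snd.
Qed.

Lemma is_derive_eq (f : R -> R) (t l l' : R) : is_derive f t l -> l = l' -> is_derive f t l'.
Proof. intros; subst; assumption. Qed.

Lemma CDer_eq f t l l' : CDer f t l -> l = l' -> CDer f t l'.
Proof. intros; subst; assumption. Qed.

Lemma CDer_ext_loc f g t l :
  locally t (fun s => f s = g s) -> CDer f t l -> CDer g t l.
Proof.
intros H [h1 h2]; split; [eapply is_derive_ext_loc in h1 | eapply is_derive_ext_loc in h2];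
 try eassumption; revert H; apply filter_imp; intros x ->; reflexivity.
Qed.

Lemma CDer_ext f g t l : (forall s, f s = g s) -> CDer f t l -> CDer g t l.
Proof. intros H; apply CDer_ext_loc; apply filter_forall; exact H. Qed.

Lemma CDer_const (z : C) t : CDer (fun _ => z) t 0.
Proof. split; apply @is_derive_const. Qed.

Lemma CDer_RtoC (f : R -> R) t l : is_derive f t l -> CDer (fun s => RtoC (f s)) t (RtoC l).
Proof. intros; split; simpl; [assumption | apply @is_derive_const]. Qed.

Lemma CDer_plus f g t l m : CDer f t l -> CDer g t m -> CDer (fun s => f s + g s)%C t (l + m)%C.
Proof. intros [] []; split; simpl; apply @is_derive_plus; assumption. Qed.

Lemma CDer_opp f t l : CDer f t l -> CDer (fun s => - f s)%C t (- l)%C.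
Proof. intros []; split; simpl; apply @is_derive_opp; assumption. Qed.

Lemma CDer_minus f g t l m : CDer f t l -> CDer g t m -> CDer (fun s => f s - g s)%C t (l - m)%C.
Proof. intros; apply CDer_plus; [|apply CDer_opp]; assumption. Qed.

(** Differentiates an expression in abstract real functions, whose derivatives are given
    by hypotheses [is_derive _ _ _]. *)
Ltac der_solve :=
  auto_derive; [ repeat split; try (eexists; eassumption); auto
  | repeat (match goal with H : is_derive ?f ?t ?l |- _ =>
     try replace (Derive (fun x => f x) t) with l by (symmetry; apply is_derive_unique; exact H);
     clear H end)].

Lemma CDer_mult f g t l m : CDer f t l -> CDer g t m ->
  CDer (fun s => f s * g s)%C t (l * g t + f t * m)%C.
Proof.
intros [a b] [c d].
assert (E : forall f1 f2 g1 g2 : R -> R, forall l1 l2 m1 m2,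
  is_derive f1 t l1 -> is_derive f2 t l2 -> is_derive g1 t m1 -> is_derive g2 t m2 ->
  is_derive (fun s => f1 s * g1 s - f2 s * g2 s) t
    (l1 * g1 t - l2 * g2 t + (f1 t * m1 - f2 t * m2)) /\
  is_derive (fun s => f1 s * g2 s + f2 s * g1 s) t
    (l1 * g2 t + l2 * g1 t + (f1 t * m2 + f2 t * m1))).
{ intros; split; der_solve; ring. }
destruct (E _ _ _ _ _ _ _ _ a b c d). split; assumption.
Qed.

Lemma Cmod_sqr (z : C) : Cmod z * Cmod z = fst z * fst z + snd z * snd z.
Proof. unfold Cmod. rewrite sqrt_sqrt; [ring | nra]. Qed.

Lemma Cnorm2_pos (z : C) : z <> 0%C -> 0 < fst z * fst z + snd z * snd z.
Proof.
intros H. destruct (Req_dec (fst z) 0) as [h|h]; [|nra].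
destruct (Req_dec (snd z) 0) as [h'|h']; [|nra].
exfalso; apply H, Ceq; assumption.
Qed.

Lemma CDer_inv (f : R -> C) t l : f t <> 0%C -> CDer f t l ->
  CDer (fun s => / f s)%C t (- l / (f t * f t))%C.
Proof.
intros Hn0 [a b]. assert (Hn := Cnorm2_pos (f t) Hn0). clear Hn0.
assert (E : forall f1 f2 : R -> R, forall l1 l2 : R,
  is_derive f1 t l1 -> is_derive f2 t l2 -> 0 < f1 t * f1 t + f2 t * f2 t ->
  is_derive (fun s => f1 s / (f1 s ^ 2 + f2 s ^ 2)) t
    (fst (- (l1, l2) / ((f1 t, f2 t) * (f1 t, f2 t)))%C) /\
  is_derive (fun s => - f2 s / (f1 s ^ 2 + f2 s ^ 2)) t
    (snd (- (l1, l2) / ((f1 t, f2 t) * (f1 t, f2 t)))%C)).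
{ clear. intros f1 f2 l1 l2 H1 H2 H3.
  assert (K : forall x y : R, 0 < x * x + y * y ->
    (x * x - y * y) ^ 2 + (x * y + y * x) ^ 2 <> 0).
  { intros x y Hx. replace (_ + _) with ((x * x + y * y) ^ 2) by ring. nra. }
  specialize (K _ _ H3).
  split; simpl; simpl in K; der_solve; try (simpl; lra); field; split; try (simpl; lra);
   intro K'; apply K; rewrite <- K'; ring. }
destruct (E _ _ _ _ a b Hn). split; [revert H | revert H0]; destruct l, (f t) eqn:Hf; simpl;
 rewrite ?Hf; simpl; trivial.
Qed.

Lemma CDer_div (f g : R -> C) t l m : g t <> 0%C -> CDer f t l -> CDer g t m ->
  CDer (fun s => f s / g s)%C t ((l * g t - f t * m) / (g t * g t))%C.
Proof.
intros Hn Hf Hg.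
eapply CDer_eq. apply CDer_mult; [eassumption | apply CDer_inv; eassumption].
cbv beta. field. assumption.
Qed.

(** * The complex exponential and the principal logarithm *)

(** The complex exponential. *)
Definition Cexp (z : C) : C := (RtoC (exp (fst z)) * cis (snd z))%C.

(** The plane slit along the negative half-line, 0 included: [|w| + Re w] vanishes exactly
    there. *)
Definition slit (w : C) : Prop := 0 < Cmod w + fst w.

(** The principal logarithm on the slit plane; the half-angle formula gives its argument,
    in the open interval from [- PI] to [PI], by a single arc tangent. *)
Definition Clog (w : C) : C := (ln (Cmod w), 2 * atan (snd w / (Cmod w + fst w))).

(** The principal power with a real exponent. *)
Definition Crpow (w : C) (p : R) : C := Cexp (RtoC p * Clog w)%C.

Lemma cis_plus x y : cis (x + y) = (cis x * cis y)%C.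
Proof. unfold cis. rewrite cos_plus, sin_plus. apply Ceq; simpl; ring. Qed.

Lemma Cmod_cis x : Cmod (cis x) = 1.
Proof.
unfold Cmod, cis; simpl. replace (_ + _) with (Rsqr (sin x) + Rsqr (cos x)) by (unfold Rsqr; ring).
rewrite sin2_cos2. apply sqrt_1.
Qed.

Lemma Cexp_plus z w : Cexp (z + w)%C = (Cexp z * Cexp w)%C.
Proof.
unfold Cexp. simpl. rewrite exp_plus, cis_plus, RtoC_mult. ring.
Qed.

Lemma Cexp_RtoC x : Cexp (RtoC x) = RtoC (exp x).
Proof. unfold Cexp, cis; simpl. rewrite sin_0, cos_0. apply Ceq; simpl; ring. Qed.

Lemma Cmod_Cexp z : Cmod (Cexp z) = exp (fst z).
Proof.
unfold Cexp. rewrite Cmod_mult, Cmod_cis, Cmod_R, Rabs_pos_eq. ring. left; apply exp_pos.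
Qed.

Lemma Cexp_neq_0 z : Cexp z <> 0%C.
Proof. intros H. apply (f_equal Cmod) in H. rewrite Cmod_Cexp, Cmod_0 in H.
generalize (exp_pos (fst z)); lra. Qed.

Lemma CDer_Cexp f t l : CDer f t l -> CDer (fun s => Cexp (f s)) t (l * Cexp (f t))%C.
Proof.
intros [a b].
assert (E : forall f1 f2 : R -> R, forall l1 l2 : R,
  is_derive f1 t l1 -> is_derive f2 t l2 ->
  is_derive (fun s => exp (f1 s) * cos (f2 s) - 0 * sin (f2 s)) t
    (exp (f1 t) * (l1 * cos (f2 t) - l2 * sin (f2 t))) /\
  is_derive (fun s => exp (f1 s) * sin (f2 s) + 0 * cos (f2 s)) t
    (exp (f1 t) * (l1 * sin (f2 t) + l2 * cos (f2 t)))).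
{ intros; split; der_solve; ring. }
destruct (E _ _ _ _ a b) as [h1 h2]; split; simpl;
 [eapply is_derive_eq; [exact h1|] | eapply is_derive_eq; [exact h2|]]; unfold cis; simpl; ring.
Qed.

Lemma slit_pos w : 0 < fst w -> slit w.
Proof. intros; unfold slit. generalize (Cmod_ge_0 w); lra. Qed.

Lemma slit_im w : snd w <> 0 -> slit w.
Proof.
intros H; unfold slit. generalize (Cmod_ge_0 w) (Cmod_sqr w); intros h1 h2.
assert (0 < snd w * snd w) by nra.
destruct (Rle_lt_dec (fst w) 0); [|lra]. 
assert (- fst w < Cmod w); [|lra]. apply Rsqr_incrst_0; unfold Rsqr; nra.
Qed.

Lemma not_slit w : ~ slit w -> fst w <= 0 /\ snd w = 0.
Proof.
intros H; split.
- apply Rnot_lt_le; intro; apply H, slit_pos; assumption.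
- destruct (Req_dec (snd w) 0) as [h|h]; trivial. destruct H; apply slit_im; assumption.
Qed.

Lemma slit_Cmod w : slit w -> 0 < Cmod w.
Proof.
unfold slit. intros H. generalize (Cmod_ge_0 w) (Cmod_sqr w); intros h1 h2.
destruct h1 as [h1|h1]; trivial. rewrite <- h1 in *. nra.
Qed.

Lemma slit_neq_0 w : slit w -> w <> 0%C.
Proof. intros H; apply slit_Cmod in H; intros ->; rewrite Cmod_0 in H; lra. Qed.

Lemma cis_2atan x : cis (2 * atan x) = ((1 - x * x) / (1 + x * x), 2 * x / (1 + x * x)).
Proof.
unfold cis. rewrite cos_2a, sin_2a, cos_atan, sin_atan.
assert (h : 0 < 1 + x * x) by nra.
assert (hs : sqrt (1 + x²) * sqrt (1 + x²) = 1 + x * x) by (rewrite sqrt_sqrt; unfold Rsqr; nra).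
assert (0 < sqrt (1 + x²)) by (apply sqrt_lt_R0; unfold Rsqr; nra).
apply Ceq; simpl; rewrite <- hs; field_simplify; try lra; rewrite <- ?hs;
  replace (sqrt (1 + x²) ^ 2) with (1 + x * x) by (rewrite <- hs; ring); field; lra.
Qed.

Lemma Cexp_Clog w : slit w -> Cexp (Clog w) = w.
Proof.
intros H. generalize (slit_Cmod w H) (Cmod_sqr w); intros h h2. unfold slit in H.
unfold Cexp, Clog. simpl. rewrite exp_ln by assumption. rewrite cis_2atan.
set (n := Cmod w) in *. set (a := fst w) in *. set (b := snd w) in *.
replace (1 + b / (n + a) * (b / (n + a))) with (2 * n / (n + a)) by
  (field_simplify_eq; [nra|lra]).
apply Ceq; simpl; fold a b; field_simplify_eq; try nra.
Qed.

Lemma CDer_Clog f t l : slit (f t) -> CDer f t l -> CDer (fun s => Clog (f s)) t (l / f t)%C.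
Proof.
intros H [Ha Hb]. generalize (slit_Cmod _ H) (Cmod_sqr (f t)); intros h h2. unfold slit in H.
set (n := Cmod (f t)) in *.
assert (E : forall f1 f2 : R -> R, forall l1 l2 : R,
  is_derive f1 t l1 -> is_derive f2 t l2 -> sqrt (f1 t ^ 2 + f2 t ^ 2) = n ->
  0 < n + f1 t -> n * n = f1 t * f1 t + f2 t * f2 t ->
  is_derive (fun s => ln (sqrt (f1 s ^ 2 + f2 s ^ 2))) t ((l1 * f1 t + l2 * f2 t) / (n * n)) /\
  is_derive (fun s => 2 * atan (f2 s / (sqrt (f1 s ^ 2 + f2 s ^ 2) + f1 s))) t
    ((l2 * f1 t - l1 * f2 t) / (n * n))).
{ clear -h. intros f1 f2 l1 l2 H1 H2 H3 H4 H5.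
  set (m := fun s => sqrt (f1 s ^ 2 + f2 s ^ 2)).
  assert (Hm : is_derive m t ((f1 t * l1 + f2 t * l2) / n)).
  { unfold m. der_solve. simpl. nra. simpl in H3 |- *. rewrite H3. field. lra. }
  change (sqrt (f1 t ^ 2 + f2 t ^ 2)) with (m t) in H3.
  change (is_derive (fun s => ln (m s)) t ((l1 * f1 t + l2 * f2 t) / (n * n)) /\
  is_derive (fun s => 2 * atan (f2 s / (m s + f1 s))) t ((l2 * f1 t - l1 * f2 t) / (n * n))).
  clearbody m.
  split; der_solve; try lra; rewrite H3; [field; lra|].
  set (a := f1 t) in *. set (b := f2 t) in *.
  replace (1 + b / (n + a) * (b / (n + a) * 1)) with (2 * n / (n + a)) by
  (field_simplify_eq; [nra|lra]).
  assert (hb : b * b = n * n - a * a) by nra.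
  field_simplify_eq; [|repeat split; nra].
  replace (b ^ 3) with (b * (n * n - a * a)) by (rewrite <- hb; ring).
  replace (b ^ 2) with (n * n - a * a) by (rewrite <- hb; ring). ring. }
destruct (E _ _ _ _ Ha Hb) as [h3 h4]; try assumption; [reflexivity|].
assert (hnz : fst (f t) * fst (f t) + snd (f t) * snd (f t) <> 0) by nra.
assert (hnz' : fst (f t) ^ 2 + snd (f t) ^ 2 <> 0) by (simpl; nra).
split; [eapply is_derive_eq; [exact h3|] | eapply is_derive_eq; [exact h4|]]; simpl;
 rewrite h2; field; repeat split; trivial; simpl in *; lra.
Qed.

Lemma CDer_Crpow f t l p : slit (f t) -> CDer f t l ->
  CDer (fun s => Crpow (f s) p) t (RtoC p * (l / f t) * Crpow (f t) p)%C.
Proof.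
intros H1 H2. unfold Crpow. eapply CDer_eq. apply (CDer_Cexp (fun s => RtoC p * Clog (f s))%C).
apply CDer_mult. apply CDer_const. apply CDer_Clog; eassumption.
simpl. ring.
Qed.

Lemma Cmod_Crpow w p : Cmod (Crpow w p) = exp (p * ln (Cmod w)).
Proof. unfold Crpow. rewrite Cmod_Cexp. f_equal. simpl. ring. Qed.

Lemma Crpow_neq_0 w p : Crpow w p <> 0%C.
Proof. apply Cexp_neq_0. Qed.

Lemma Crpow_plus w p q : Crpow w (p + q) = (Crpow w p * Crpow w q)%C.
Proof. unfold Crpow. rewrite <- Cexp_plus. f_equal. rewrite RtoC_plus. ring. Qed.

Lemma Crpow_1 w : slit w -> Crpow w 1 = w.
Proof. intros. unfold Crpow. rewrite Cmult_1_l. apply Cexp_Clog; assumption. Qed.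

Lemma Crpow_pred w p : slit w -> Crpow w p = (w * Crpow w (p - 1))%C.
Proof.
intros H. replace p with (1 + (p - 1)) at 1 by ring. rewrite Crpow_plus, Crpow_1; trivial.
Qed.

Lemma Clog_RtoC x : 0 < x -> Clog (RtoC x) = RtoC (ln x).
Proof.
intros H. unfold Clog. rewrite Cmod_R, Rabs_pos_eq by lra. simpl.
replace (0 / (x + x)) with 0 by (field; lra). rewrite atan_0. apply Ceq; simpl; ring.
Qed.

Lemma Crpow_RtoC x p : 0 < x -> Crpow (RtoC x) p = RtoC (Rpower x p).
Proof.
intros H. unfold Crpow. rewrite Clog_RtoC, <- RtoC_mult, Cexp_RtoC; trivial.
Qed.

Lemma Clog_scal c w : 0 < c -> slit w -> Clog (RtoC c * w)%C = (RtoC (ln c) + Clog w)%C.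
Proof.
intros H Hw. generalize (slit_Cmod _ Hw); intro. unfold Clog. rewrite Cmod_mult, Cmod_R, Rabs_pos_eq by lra.
apply Ceq; simpl. rewrite ln_mult; lra. rewrite Rplus_0_l. do 2 f_equal. unfold slit in Hw. field. split; try lra.
replace (_ + _) with (c * (Cmod w + fst w)) by ring. nra.
Qed.

Lemma slit_scal c w : 0 < c -> slit w -> slit (RtoC c * w)%C.
Proof.
unfold slit; intros H Hw. rewrite Cmod_mult, Cmod_R, Rabs_pos_eq by lra. simpl.
replace (_ + _) with (c * (Cmod w + fst w)) by ring. nra.
Qed.

Lemma Clog_conj w : Clog (Cconj w) = Cconj (Clog w).
Proof.
unfold Clog. rewrite Cmod_conj. apply Ceq; simpl; trivial.
replace (- snd w / (Cmod w + fst w)) with (- (snd w / (Cmod w + fst w))) by (unfold Rdiv; ring).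
rewrite atan_opp. ring.
Qed.

(** A curve whose speed is at most [M] is [M]-Lipschitz. *)
Lemma CDer_bounded (f df : R -> C) (M a b : R) :
  (forall t, Rmin a b <= t <= Rmax a b -> CDer f t (df t)) ->
  (forall t, Rmin a b <= t <= Rmax a b -> Cmod (df t) <= M) ->
  Cmod (f b - f a)%C <= M * Rabs (b - a).
Proof.
intros Hd Hb. set (d := (f b - f a)%C).
assert (HM : 0 <= M).
{ eapply Rle_trans; [apply Cmod_ge_0 | apply (Hb a)].
  split; [apply Rmin_l | apply Rmax_l]. }
assert (Hdot : forall z w : C, fst z * fst w + snd z * snd w <= Cmod z * Cmod w).
{ intros z w. generalize (Cmod_ge_0 z) (Cmod_ge_0 w) (Cmod_sqr z) (Cmod_sqr w); intros.
  apply Rsqr_incr_0_var; [|nra]. unfold Rsqr.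
  replace (Cmod z * Cmod w * (Cmod z * Cmod w)) with ((Cmod z * Cmod z) * (Cmod w * Cmod w)) by ring.
  rewrite H1, H2. assert (0 <= (fst z * snd w - snd z * fst w)^2) by apply pow2_ge_0. nra. }
assert (Hder : forall x, Rmin a b <= x <= Rmax a b ->
  is_derive (fun t => fst d * fst (f t) + snd d * snd (f t)) x
    (fst d * fst (df x) + snd d * snd (df x))).
{ intros x Hx. destruct (Hd x Hx) as [h1 h2].
  apply @is_derive_plus; apply is_derive_scal; assumption. }
destruct (MVT_gen (fun t => fst d * fst (f t) + snd d * snd (f t)) a b
   (fun t => fst d * fst (df t) + snd d * snd (df t))) as [c [Hc Heq]].
- intros x Hx. apply Hder; lra.
- intros x Hx. apply continuity_pt_filterlim.
  refine (ex_derive_continuous (V:=R_NormedModule) _ x _). eexists. apply (Hder x); assumption.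
- assert (H1 : Cmod d * Cmod d <= Cmod d * (M * Rabs (b - a))).
  { replace (Cmod d * Cmod d) with ((fst d * fst (df c) + snd d * snd (df c)) * (b - a)).
    2:{ rewrite <- Heq, Cmod_sqr. unfold d; simpl. ring. }
    eapply Rle_trans; [apply Rle_abs|]. rewrite Rabs_mult, <- Rmult_assoc.
    apply Rmult_le_compat_r; [apply Rabs_pos|].
    apply Rabs_le. split.
    - generalize (Hdot d (- df c)%C). rewrite Cmod_opp. simpl. specialize (Hb c Hc). 
      generalize (Cmod_ge_0 d); nra.
    - generalize (Hdot d (df c)). specialize (Hb c Hc). generalize (Cmod_ge_0 d); nra. }
  generalize (Cmod_ge_0 d) (Rabs_pos (b - a)); intros.
  destruct (Req_dec (Cmod d) 0) as [h|h]; [rewrite h; apply Rmult_le_pos; assumption|].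
  apply Rmult_le_reg_l with (Cmod d); lra.
Qed.

Lemma Rabs_fst_le_Cmod z : Rabs (fst z) <= Cmod z.
Proof. eapply Rle_trans; [apply Rmax_l | apply Rmax_Cmod]. Qed.

Lemma Rabs_snd_le_Cmod z : Rabs (snd z) <= Cmod z.
Proof. eapply Rle_trans; [apply Rmax_r | apply Rmax_Cmod]. Qed.

Lemma Cmod_le_abs z : Cmod z <= Rabs (fst z) + Rabs (snd z).
Proof.
apply Rsqr_incr_0_var; [|generalize (Rabs_pos (fst z)) (Rabs_pos (snd z)); lra].
unfold Rsqr. rewrite Cmod_sqr.
generalize (Rabs_pos (fst z)) (Rabs_pos (snd z)) (Rsqr_abs (fst z)) (Rsqr_abs (snd z)).
unfold Rsqr; nra.
Qed.

Lemma is_derive_eps (f : R -> R) t l : is_derive f t l <->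
  forall eps, 0 < eps -> locally t (fun s => Rabs (f s - f t - (s - t) * l) <= eps * Rabs (s - t)).
Proof.
split.
- intros [_ H] eps Heps. specialize (H t (fun P H => H) (mkposreal _ Heps)).
  exact H.
- intros H. split; [apply is_linear_scal_l|].
  intros x Hx. apply (is_filter_lim_locally_unique (V:=R_NormedModule)) in Hx. rewrite <- Hx.
  intros eps. apply (H eps), cond_pos.
Qed.

Lemma CDer_eps (f : R -> C) t l : CDer f t l <->
  forall eps, 0 < eps ->
  locally t (fun s => Cmod (f s - f t - RtoC (s - t) * l)%C <= eps * Rabs (s - t)).
Proof.
split.
- intros [h1 h2] eps Heps. assert (He : 0 < eps / 2) by lra.
  apply is_derive_eps with (eps := eps / 2) in h1; trivial.
  apply is_derive_eps with (eps := eps / 2) in h2; trivial.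
  generalize (filter_and _ _ h1 h2); apply filter_imp. intros s [H1 H2].
  eapply Rle_trans; [apply Cmod_le_abs|].
  match goal with |- Rabs ?a + Rabs ?b <= _ =>
    replace a with (fst (f s) - fst (f t) - (s - t) * fst l) by (simpl; ring);
    replace b with (snd (f s) - snd (f t) - (s - t) * snd l) by (simpl; ring) end.
  simpl in H1, H2. lra.
- intros H; split; apply is_derive_eps; intros eps Heps; generalize (H eps Heps);
  apply filter_imp; intros s Hs; (eapply Rle_trans; [|exact Hs]).
  + eapply Rle_trans; [|apply Rabs_fst_le_Cmod]. right; f_equal; simpl; ring.
  + eapply Rle_trans; [|apply Rabs_snd_le_Cmod]. right; f_equal; simpl; ring.
Qed.

(** * Limits *)

(** Limit of a complex-valued function along a filter, by real and imaginary parts. *)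
Definition Clim {T : Type} (F : (T -> Prop) -> Prop) (f : T -> C) (l : C) : Prop :=
  filterlim (fun x => fst (f x)) F (locally (fst l)) /\
  filterlim (fun x => snd (f x)) F (locally (snd l)).

Section Limits.

Context {T : Type} {F : (T -> Prop) -> Prop} {FF : Filter F}.

Lemma Clim_const (z : C) : Clim F (fun _ => z) z.
Proof. split; apply filterlim_const. Qed.

Lemma Clim_RtoC (f : T -> R) (l : R) : filterlim f F (locally l) -> Clim F (fun x => RtoC (f x)) (RtoC l).
Proof. intros; split; simpl; [assumption | apply filterlim_const]. Qed.

Lemma Rlim_plus (f g : T -> R) (l m : R) : filterlim f F (locally l) -> filterlim g F (locally m) ->
  filterlim (fun x => f x + g x) F (locally (l + m)).
Proof. intros. apply (filterlim_comp_2 f g Rplus H H0). apply (filterlim_plus (V:=R_NormedModule)). Qed.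

Lemma Rlim_mult (f g : T -> R) (l m : R) : filterlim f F (locally l) -> filterlim g F (locally m) ->
  filterlim (fun x => f x * g x) F (locally (l * m)).
Proof. intros. apply (filterlim_comp_2 f g Rmult H H0). apply (filterlim_mult (K:=R_AbsRing)). Qed.

Lemma Rlim_comp (h : R -> R) (f : T -> R) (l : R) : filterlim f F (locally l) ->
  continuous h l -> filterlim (fun x => h (f x)) F (locally (h l)).
Proof. intros. eapply filterlim_comp; eassumption. Qed.

Lemma Rlim_opp (f : T -> R) (l : R) : filterlim f F (locally l) ->
  filterlim (fun x => - f x) F (locally (- l)).
Proof. intros. apply (Rlim_comp Ropp); trivial. apply (filterlim_opp (V:=R_NormedModule)). Qed.

Lemma Clim_plus f g l m : Clim F f l -> Clim F g m -> Clim F (fun x => f x + g x)%C (l + m)%C.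
Proof. intros [] []; split; apply Rlim_plus; assumption. Qed.

Lemma Clim_opp f l : Clim F f l -> Clim F (fun x => - f x)%C (- l)%C.
Proof. intros []; split; apply Rlim_opp; assumption. Qed.

Lemma Clim_minus f g l m : Clim F f l -> Clim F g m -> Clim F (fun x => f x - g x)%C (l - m)%C.
Proof. intros; apply Clim_plus; [|apply Clim_opp]; assumption. Qed.

Lemma Clim_mult f g l m : Clim F f l -> Clim F g m -> Clim F (fun x => f x * g x)%C (l * m)%C.
Proof.
intros [] []; split; simpl.
- apply Rlim_plus; [|apply Rlim_opp]; apply Rlim_mult; assumption.
- apply Rlim_plus; apply Rlim_mult; assumption.
Qed.

Lemma Rlim_Cmod f l : Clim F f l -> filterlim (fun x => Cmod (f x)) F (locally (Cmod l)).
Proof.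
intros [H1 H2]. unfold Cmod.
apply (Rlim_comp sqrt); [|apply continuous_sqrt].
simpl. apply Rlim_plus; repeat apply Rlim_mult; trivial; apply filterlim_const.
Qed.

Lemma Rlim_eq (f : T -> R) (l l' : R) : filterlim f F (locally l) -> l = l' ->
  filterlim f F (locally l').
Proof. intros; subst; trivial. Qed.

Lemma Rlim_inv (f : T -> R) (l : R) : l <> 0 -> filterlim f F (locally l) ->
  filterlim (fun x => / f x) F (locally (/ l)).
Proof. intros. apply (Rlim_comp Rinv); trivial. apply continuous_Rinv; trivial. Qed.

Lemma Clim_inv (f : T -> C) (l : C) : l <> 0%C -> Clim F f l -> Clim F (fun x => / f x)%C (/ l)%C.
Proof.
intros Hl [H1 H2]. apply Cnorm2_pos in Hl.
assert (H : filterlim (fun x => / (fst (f x) ^ 2 + snd (f x) ^ 2)) F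
  (locally (/ (fst l ^ 2 + snd l ^ 2)))).
{ apply Rlim_inv. simpl; lra. simpl.
  apply Rlim_plus; repeat apply Rlim_mult; trivial; apply filterlim_const. }
split; simpl; apply Rlim_mult; trivial. apply Rlim_opp; trivial.
Qed.

Lemma Clim_div (f g : T -> C) (l m : C) : m <> 0%C -> Clim F f l -> Clim F g m ->
  Clim F (fun x => f x / g x)%C (l / m)%C.
Proof. intros; apply Clim_mult; [|apply Clim_inv]; assumption. Qed.

Lemma Clim_cis (f : T -> R) l : filterlim f F (locally l) -> Clim F (fun x => cis (f x)) (cis l).
Proof.
intros; split; simpl; apply Rlim_comp; trivial.
apply continuous_cos. apply continuous_sin.
Qed.

Lemma Clim_Cexp f l : Clim F f l -> Clim F (fun x => Cexp (f x)) (Cexp l).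
Proof.
intros []; unfold Cexp. apply Clim_mult.
- apply Clim_RtoC. apply (Rlim_comp exp); trivial. apply continuous_exp.
- apply Clim_cis; trivial.
Qed.

Lemma Clim_Clog f l : slit l -> Clim F f l -> Clim F (fun x => Clog (f x)) (Clog l).
Proof.
intros Hs H. generalize (Rlim_Cmod _ _ H) (slit_Cmod _ Hs); intros Hm Hm0. destruct H.
unfold slit in Hs. split; simpl.
- apply (Rlim_comp ln); trivial. apply continuous_ln; trivial.
- apply Rlim_mult; [apply filterlim_const|].
  apply (Rlim_comp atan). 2: apply continuous_atan.
  apply Rlim_mult; trivial. apply Rlim_inv. lra. apply Rlim_plus; trivial.
Qed.

Lemma Clim_Crpow f l p : slit l -> Clim F f l -> Clim F (fun x => Crpow (f x) p) (Crpow l p).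
Proof.
intros; unfold Crpow. apply Clim_Cexp, Clim_mult; [apply Clim_const | apply Clim_Clog]; trivial.
Qed.

Lemma Clim_Cmod_0 (f : T -> C) l :
  filterlim (fun x => Cmod (f x - l)%C) F (locally 0) -> Clim F f l.
Proof.
intros H. split; apply filterlim_locally; intros eps;
 generalize (proj1 (filterlim_locally _ _) H eps); apply filter_imp; intros x Hx.
- eapply Rle_lt_trans; [|exact Hx]. unfold abs, minus, plus, opp; simpl.
  eapply Rle_trans; [apply (Rabs_fst_le_Cmod (f x - l)%C)|].
  replace (Cmod (f x - l) + - 0) with (Cmod (f x - l)) by ring. apply Rle_abs.
- eapply Rle_lt_trans; [|exact Hx]. unfold abs, minus, plus, opp; simpl.
  eapply Rle_trans; [apply (Rabs_snd_le_Cmod (f x - l)%C)|].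
  replace (Cmod (f x - l) + - 0) with (Cmod (f x - l)) by ring. apply Rle_abs.
Qed.

Lemma Clim_eps (f : T -> C) l :
  Clim F f l <-> forall eps, 0 < eps -> F (fun x => Cmod (f x - l)%C < eps).
Proof.
split.
- intros H eps Heps.
  assert (K : Clim F (fun x => f x - l)%C (l - l)%C) by (apply Clim_minus; trivial; apply Clim_const).
  apply Rlim_Cmod in K. generalize (proj1 (filterlim_locally _ _) K (mkposreal _ Heps)).
  apply filter_imp. intros x Hx. unfold ball in Hx; simpl in Hx; unfold AbsRing_ball, abs, minus, plus, opp in Hx; simpl in Hx.
  replace (l - l)%C with (RtoC 0) in Hx by ring. rewrite Cmod_0 in Hx.
  apply Rabs_def2 in Hx; lra.
- intros H. apply Clim_Cmod_0. apply filterlim_locally. intros eps.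
  generalize (H eps (cond_pos eps)). apply filter_imp; intros x Hx.
  unfold ball; simpl; unfold AbsRing_ball, abs, minus, plus, opp; simpl.
  generalize (Cmod_ge_0 (f x - l)%C); intros. rewrite Rabs_pos_eq; lra.
Qed.

Lemma Clim_ext f g l : (forall x, f x = g x) -> Clim F f l -> Clim F g l.
Proof.
intros H []; split; [eapply filterlim_ext; [|exact H0] | eapply filterlim_ext; [|exact H1]];
 intros; simpl; rewrite H; trivial.
Qed.

Lemma Clim_ext_loc f g l : F (fun x => f x = g x) -> Clim F f l -> Clim F g l.
Proof.
intros H []; split; [eapply filterlim_ext_loc; [|exact H0] | eapply filterlim_ext_loc; [|exact H1]];
 revert H; apply filter_imp; intros x ->; trivial.
Qed.

Lemma Clim_eq f l l' : Clim F f l -> l = l' -> Clim F f l'.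
Proof. intros; subst; trivial. Qed.

End Limits.

Lemma Clim_unique {T} (F : (T -> Prop) -> Prop) {FF : ProperFilter F} f l l' :
  Clim F f l -> Clim F f l' -> l = l'.
Proof.
intros [a b] [c d]. apply Ceq.
- exact (filterlim_locally_unique (V:=R_NormedModule) _ _ _ a c).
- exact (filterlim_locally_unique (V:=R_NormedModule) _ _ _ b d).
Qed.

Lemma CDer_Clim f t l : CDer f t l -> Clim (locally t) f (f t).
Proof.
intros [a b]; split.
- refine (ex_derive_continuous (V:=R_NormedModule) (fun s => fst (f s)) t _). eexists; exact a.
- refine (ex_derive_continuous (V:=R_NormedModule) (fun s => snd (f s)) t _). eexists; exact b.
Qed.

(** * Complex-valued integrals over the unit interval *)

(** The integral of a complex-valued function over the unit interval. *)
Definition CI (f : R -> C) : C :=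
  (RInt (fun u => fst (f u)) 0 1, RInt (fun u => snd (f u)) 0 1).

(** Continuity on the unit interval, as a function on the whole line. *)
Definition Ccont (f : R -> C) : Prop := forall u, 0 <= u <= 1 -> Clim (locally u) f (f u).

Lemma Ccont_ex_fst f : Ccont f -> ex_RInt (fun u => fst (f u)) 0 1.
Proof.
intros H. apply (ex_RInt_continuous (V:=R_CompleteNormedModule)).
intros z Hz. rewrite Rmin_left, Rmax_right in Hz by lra. exact (proj1 (H z Hz)).
Qed.

Lemma Ccont_ex_snd f : Ccont f -> ex_RInt (fun u => snd (f u)) 0 1.
Proof.
intros H. apply (ex_RInt_continuous (V:=R_CompleteNormedModule)).
intros z Hz. rewrite Rmin_left, Rmax_right in Hz by lra. exact (proj2 (H z Hz)).
Qed.

Lemma CI_plus f g : Ccont f -> Ccont g -> CI (fun u => f u + g u)%C = (CI f + CI g)%C.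
Proof.
intros Hf Hg. apply Ceq; simpl.
- apply (RInt_plus (V:=R_CompleteNormedModule)); apply Ccont_ex_fst; trivial.
- apply (RInt_plus (V:=R_CompleteNormedModule)); apply Ccont_ex_snd; trivial.
Qed.

Lemma CI_mult c f : Ccont f -> CI (fun u => c * f u)%C = (c * CI f)%C.
Proof.
intros Hf. generalize (Ccont_ex_fst f Hf) (Ccont_ex_snd f Hf); intros h1 h2.
apply Ceq; simpl; apply is_RInt_unique.
- apply (is_RInt_minus (V:=R_NormedModule));
   apply (is_RInt_scal (V:=R_NormedModule)); apply (RInt_correct (V:=R_CompleteNormedModule)); trivial.
- apply (is_RInt_plus (V:=R_NormedModule));
   apply (is_RInt_scal (V:=R_NormedModule)); apply (RInt_correct (V:=R_CompleteNormedModule)); trivial.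
Qed.

Lemma CI_ext f g : (forall u, 0 <= u <= 1 -> f u = g u) -> CI f = CI g.
Proof.
intros H. unfold CI. f_equal; apply RInt_ext; intros x Hx;
 rewrite Rmin_left, Rmax_right in Hx by lra; rewrite H by lra; trivial.
Qed.

(** The factor 2 comes from bounding the real and imaginary parts separately. *)
Lemma CI_bound f M : Ccont f -> (forall u, 0 <= u <= 1 -> Cmod (f u) <= M) -> Cmod (CI f) <= 2 * M.
Proof.
intros Hf HM.
assert (E : forall g, ex_RInt g 0 1 -> (forall u, 0 <= u <= 1 -> Rabs (g u) <= M) ->
  Rabs (RInt g 0 1) <= M).
{ intros g Hg HgM.
  replace M with ((1 - 0) * M) by ring.
  apply (norm_RInt_le_const (V:=R_NormedModule) g 0 1 (RInt g 0 1) M). lra.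
  exact HgM. apply (RInt_correct (V:=R_CompleteNormedModule)); trivial. }
eapply Rle_trans; [apply Cmod_le_abs|]. simpl.
assert (Rabs (RInt (fun u => fst (f u)) 0 1) <= M).
{ apply E. apply Ccont_ex_fst; trivial. intros; eapply Rle_trans; [apply Rabs_fst_le_Cmod|]; auto. }
assert (Rabs (RInt (fun u => snd (f u)) 0 1) <= M).
{ apply E. apply Ccont_ex_snd; trivial. intros; eapply Rle_trans; [apply Rabs_snd_le_Cmod|]; auto. }
lra.
Qed.

Lemma CI_derive f df : (forall u, 0 <= u <= 1 -> CDer f u (df u)) -> Ccont df ->
  CI df = (f 1 - f 0)%C.
Proof.
intros H Hc. apply Ceq; simpl; apply is_RInt_unique.
- apply (is_RInt_derive (V:=R_CompleteNormedModule) (fun u => fst (f u)) (fun u => fst (df u)));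
  intros x Hx; rewrite Rmin_left, Rmax_right in Hx by lra; [apply (H x Hx) | apply (Hc x Hx)].
- apply (is_RInt_derive (V:=R_CompleteNormedModule) (fun u => snd (f u)) (fun u => snd (df u)));
  intros x Hx; rewrite Rmin_left, Rmax_right in Hx by lra; [apply (H x Hx) | apply (Hc x Hx)].
Qed.

(** * The incomplete Beta integral *)

(** [u^(1/k)], extended by 0 to [u <= 0] in order to be continuous at 0. *)
Definition rootk (k u : R) : R := if Rlt_dec 0 u then Rpower u (/ k) else 0.

Lemma rootk_pos k u : 0 < u -> rootk k u = Rpower u (/ k).
Proof. intros; unfold rootk; destruct (Rlt_dec 0 u); [trivial | lra]. Qed.

Lemma rootk_neg k u : u <= 0 -> rootk k u = 0.
Proof. intros; unfold rootk; destruct (Rlt_dec 0 u); [lra | trivial]. Qed.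

Lemma rootk_1 k : rootk k 1 = 1.
Proof. rewrite rootk_pos by lra. unfold Rpower. rewrite ln_1, Rmult_0_r. apply exp_0. Qed.

Lemma rootk_bound k u : 0 < k -> u <= 1 -> 0 <= rootk k u <= 1.
Proof.
intros Hk Hu. unfold rootk; destruct (Rlt_dec 0 u); [|lra].
split; [left; apply exp_pos|]. unfold Rpower. rewrite <- exp_0.
assert (ln u <= 0) by (rewrite <- ln_1; apply ln_le; lra).
assert (0 < / k) by (apply Rinv_0_lt_compat; trivial).
assert (/ k * ln u <= 0) by nra.
destruct H1 as [H1|H1]; [left; apply exp_increasing; trivial | rewrite H1; lra].
Qed.

Lemma is_derive_rootk k u : 0 < k -> 0 < u -> is_derive (rootk k) u (rootk k u / (k * u)).
Proof.
intros Hk Hu.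
apply (is_derive_ext_loc (fun u => exp (/ k * ln u))).
- exists (mkposreal _ Hu). intros y Hy. apply Rabs_def2 in Hy. simpl in Hy.
  unfold minus, plus, opp in Hy; simpl in Hy. rewrite rootk_pos; [reflexivity|lra].
- rewrite rootk_pos by trivial. auto_derive; trivial. unfold Rpower. field. lra.
Qed.

Lemma continuous_rootk k u : 0 < k -> continuous (rootk k) u.
Proof.
intros Hk. destruct (Rtotal_order u 0) as [Hu|[Hu|Hu]].
- apply (continuous_ext_loc _ (fun _ => 0)); [|apply continuous_const].
  assert (H : 0 < - u) by lra. exists (mkposreal _ H). intros y Hy. apply Rabs_def2 in Hy. simpl in Hy.
  unfold minus, plus, opp in Hy; simpl in Hy. rewrite rootk_neg; lra.
- subst u. apply filterlim_locally. intros eps. rewrite rootk_neg by lra.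
  assert (H : 0 < Rpower eps k) by apply exp_pos.
  exists (mkposreal _ H). intros y Hy. apply Rabs_def2 in Hy. simpl in Hy.
  unfold minus, plus, opp in Hy; simpl in Hy.
  unfold ball; simpl; unfold AbsRing_ball, abs, minus, plus, opp; simpl. 
  unfold rootk. destruct (Rlt_dec 0 y) as [h|h].
  + assert (Rpower y (/ k) < eps); [|generalize (exp_pos (/ k * ln y)); unfold Rpower in *; intros; rewrite Rabs_pos_eq; lra].
    replace (pos eps) with (Rpower (Rpower eps k) (/ k)).
    * apply Rlt_Rpower_l; [apply Rinv_0_lt_compat; trivial | lra].
    * rewrite Rpower_mult, Rinv_r, Rpower_1; [trivial | apply cond_pos | lra].
  + rewrite Ropp_0, Rplus_0_r, Rabs_R0. apply cond_pos.
- refine (ex_derive_continuous (V:=R_NormedModule) (rootk k) u _). eexists. apply is_derive_rootk; trivial.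
Qed.

Lemma Cmod_Crpow_le w q L : 0 < Cmod w -> Rabs (ln (Cmod w)) <= L ->
  Cmod (Crpow w q) <= exp (Rabs q * L).
Proof.
intros Hw HL. rewrite Cmod_Crpow.
assert (q * ln (Cmod w) <= Rabs q * L).
{ eapply Rle_trans; [apply Rle_abs|]. rewrite Rabs_mult. apply Rmult_le_compat_l; [apply Rabs_pos|trivial]. }
destruct H as [H|H]; [left; apply exp_increasing; trivial | rewrite H; lra].
Qed.

(** The mean value inequality for a power along a segment; [L] bounds the logarithm of the
    modulus on the segment. *)
Lemma Crpow_Lipschitz w h p L :
  (forall s, 0 <= s <= 1 -> 0 < fst (w + RtoC s * h)%C /\ Rabs (ln (Cmod (w + RtoC s * h)%C)) <= L) ->
  Cmod (Crpow (w + h)%C p - Crpow w p)%C <= Rabs p * exp (Rabs (p - 1) * L) * Cmod h.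
Proof.
intros H.
assert (Hd : forall t, CDer (fun s => w + RtoC s * h)%C t h).
{ intros t. eapply CDer_eq. apply CDer_plus. apply CDer_const. apply CDer_mult.
  apply CDer_RtoC. apply @is_derive_id. apply CDer_const. unfold one; simpl. ring. }
replace (w + h)%C with (w + RtoC 1 * h)%C by ring.
replace w with (w + RtoC 0 * h)%C at 2 by ring.
replace (_ * Cmod h) with (Rabs p * exp (Rabs (p - 1) * L) * Cmod h * Rabs (1 - 0))
  by (rewrite Rminus_0_r, Rabs_R1; ring).
apply (CDer_bounded (fun s => Crpow (w + RtoC s * h)%C p)
  (fun s => RtoC p * h * Crpow (w + RtoC s * h)%C (p - 1))%C); intros t Ht;
  rewrite Rmin_left, Rmax_right in Ht by lra; destruct (H t Ht) as [H1 H2]; apply slit_pos in H1.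
- eapply CDer_eq. apply (CDer_Crpow (fun s => w + RtoC s * h)%C); [exact H1|apply Hd].
  cbv beta. rewrite (Crpow_pred _ p); trivial. field. apply slit_neq_0; trivial.
- rewrite !Cmod_mult, Cmod_R. rewrite Rmult_assoc, Rmult_assoc. apply Rmult_le_compat_l; [apply Rabs_pos|].
  rewrite Rmult_comm. apply Rmult_le_compat_r; [apply Cmod_ge_0|].
  apply Cmod_Crpow_le; trivial. apply slit_Cmod; trivial.
Qed.

Lemma Crpow_Taylor w h p L :
  (forall s, 0 <= s <= 1 -> 0 < fst (w + RtoC s * h)%C /\ Rabs (ln (Cmod (w + RtoC s * h)%C)) <= L) ->
  Cmod (Crpow (w + h)%C p - Crpow w p - RtoC p * h * Crpow w (p - 1))%C <=
  Rabs p * Rabs (p - 1) * exp (Rabs (p - 2) * L) * Cmod h * Cmod h.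
Proof.
intros H.
assert (Hd : forall t, CDer (fun s => w + RtoC s * h)%C t h).
{ intros t. eapply CDer_eq. apply CDer_plus. apply CDer_const. apply CDer_mult.
  apply CDer_RtoC. apply @is_derive_id. apply CDer_const. unfold one; simpl. ring. }
set (g := fun s : R => (Crpow (w + RtoC s * h)%C p - RtoC s * (RtoC p * h * Crpow w (p - 1)))%C).
replace (_ - _ - _)%C with (g 1 - g 0)%C.
2:{ unfold g. replace (w + RtoC 1 * h)%C with (w + h)%C by ring.
    replace (w + RtoC 0 * h)%C with w by ring. ring. }
replace (_ * Cmod h * Cmod h) with
  (Rabs p * Cmod h * (Rabs (p - 1) * exp (Rabs (p - 2) * L) * Cmod h) * Rabs (1 - 0))
  by (rewrite Rminus_0_r, Rabs_R1; ring).
apply (CDer_bounded g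
  (fun s => RtoC p * h * (Crpow (w + RtoC s * h) (p - 1) - Crpow w (p - 1)))%C); intros t Ht;
  rewrite Rmin_left, Rmax_right in Ht by lra.
- destruct (H t Ht) as [H1 H2]; apply slit_pos in H1.
  eapply CDer_eq. unfold g. apply CDer_minus.
  apply (CDer_Crpow (fun s => w + RtoC s * h)%C); [exact H1|apply Hd].
  apply CDer_mult. apply CDer_RtoC. apply @is_derive_id. apply CDer_const.
  cbv beta. rewrite (Crpow_pred _ p); trivial. unfold one; simpl. field. apply slit_neq_0; trivial.
- rewrite !Cmod_mult, Cmod_R. apply Rmult_le_compat_l; [apply Rmult_le_pos; [apply Rabs_pos | apply Cmod_ge_0]|].
  eapply Rle_trans.
  + apply (Crpow_Lipschitz w (RtoC t * h)%C (p - 1) L).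
    intros s Hs. replace (RtoC s * (RtoC t * h))%C with (RtoC (s * t) * h)%C by (rewrite RtoC_mult; ring).
    apply H. nra.
  + replace (p - 1 - 1) with (p - 2) by ring. rewrite Cmod_mult, Cmod_R, (Rabs_pos_eq t) by lra.
    apply Rmult_le_compat_l. apply Rmult_le_pos; [apply Rabs_pos | left; apply exp_pos].
    generalize (Cmod_ge_0 h); nra.
Qed.

(** The substitution [r = u^k] turns [k int_0^1 r^(k-1) (1 - r Y)^(k-1) dr] into this
    integral, whose integrand is bounded for every [k > 0]. *)
Definition Jint (k : R) (Y : C) : C := CI (fun u => Crpow (1 - RtoC (rootk k u) * Y)%C (k - 1)).

(** The complex derivative of [Jint]. *)
Definition Jder (k : R) (Y : C) : C :=
  CI (fun u => RtoC (k - 1) * (- RtoC (rootk k u)) * Crpow (1 - RtoC (rootk k u) * Y)%C (k - 1 - 1))%C.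

Lemma Jbase_re k u (Y : C) : 0 < k -> u <= 1 -> fst Y < 1 -> 0 < fst (1 - RtoC (rootk k u) * Y)%C.
Proof.
intros Hk Hu HY. simpl. destruct (rootk_bound k u Hk Hu) as [h1 h2]. 
rewrite Rmult_0_l.
destruct h1 as [h1|h1]; [assert (0 < rootk k u * (1 - fst Y)) by (apply Rmult_lt_0_compat; lra); lra | rewrite <- h1; lra].
Qed.

Lemma Jbase_lim k u (Y : C) : 0 < k -> Clim (locally u) (fun u => 1 - RtoC (rootk k u) * Y)%C
  (1 - RtoC (rootk k u) * Y)%C.
Proof.
intros Hk. apply Clim_minus. apply Clim_const. apply Clim_mult; [|apply Clim_const].
apply Clim_RtoC. apply continuous_rootk; trivial.
Qed.

Lemma Jcont k p (Y : C) : 0 < k -> fst Y < 1 -> Ccont (fun u => Crpow (1 - RtoC (rootk k u) * Y)%C p).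
Proof.
intros Hk HY u Hu. apply Clim_Crpow.
- apply slit_pos, Jbase_re; trivial; lra.
- apply Jbase_lim; trivial.
Qed.

Lemma Jder_cont k (Y : C) : 0 < k -> fst Y < 1 -> Ccont (fun u =>
  RtoC (k - 1) * (- RtoC (rootk k u)) * Crpow (1 - RtoC (rootk k u) * Y)%C (k - 1 - 1))%C.
Proof.
intros Hk HY u Hu. apply Clim_mult.
- apply Clim_mult; [apply Clim_const|]. apply Clim_opp, Clim_RtoC, continuous_rootk; trivial.
- apply Jcont; trivial.
Qed.

(** Differentiability of [Jint], with a quadratic remainder: the second-order estimate for
    the integrand is uniform in [u]. *)
Lemma Jint_Taylor k (Y : C) : 0 < k -> fst Y < 1 -> exists M d, 0 <= M /\ 0 < d /\
  forall h, Cmod h <= d -> fst (Y + h)%C < 1 /\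
    Cmod (Jint k (Y + h) - Jint k Y - h * Jder k Y)%C <= M * Cmod h * Cmod h.
Proof.
intros Hk HY. set (d := (1 - fst Y) / 2). assert (Hd : 0 < d) by (unfold d; lra).
set (lo := Rmin 1 d). set (hi := 1 + Cmod Y + d).
assert (Hlo : 0 < lo) by (apply Rmin_pos; lra).
assert (Hlo1 : lo <= 1) by apply Rmin_l. assert (Hlod : lo <= d) by apply Rmin_r.
assert (Hhi : 0 < hi) by (unfold hi; generalize (Cmod_ge_0 Y); lra).
set (L := Rabs (ln lo) + Rabs (ln hi)).
set (M := Rabs (k - 1) * Rabs (k - 1 - 1) * exp (Rabs (k - 1 - 2) * L)).
assert (HM : 0 <= M).
{ repeat apply Rmult_le_pos; try apply Rabs_pos. left; apply exp_pos. }
exists (2 * M), d. split; [lra|split; [exact Hd|]].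
intros h Hh. assert (Hf := Rabs_fst_le_Cmod h). assert (Hr := Rle_abs (fst h)).
assert (HYh : fst (Y + h)%C < 1) by (simpl; unfold d in *; lra).
split; [exact HYh|].
replace (Jint k (Y + h) - Jint k Y - h * Jder k Y)%C with
  (CI (fun u => Crpow (1 - RtoC (rootk k u) * (Y + h)) (k - 1) +
     (RtoC (-1) * Crpow (1 - RtoC (rootk k u) * Y) (k - 1) +
      (- h) * (RtoC (k - 1) * (- RtoC (rootk k u)) * Crpow (1 - RtoC (rootk k u) * Y) (k - 1 - 1))))%C).
2:{ assert (C1 := Jcont k (k - 1) (Y + h)%C Hk HYh). assert (C2 := Jcont k (k - 1) Y Hk HY).
    assert (C3 := Jder_cont k Y Hk HY).
    assert (Cs : forall c f, Ccont f -> Ccont (fun u => c * f u)%C).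
    { intros c f Hc u Hu. apply Clim_mult; [apply Clim_const|]. auto. }
    rewrite CI_plus; trivial.
    2:{ intros u Hu. apply Clim_plus. exact (Cs _ _ C2 u Hu). exact (Cs _ _ C3 u Hu). }
    rewrite CI_plus by (apply Cs; trivial). rewrite !CI_mult by trivial.
    unfold Jint, Jder. ring. }
replace (2 * M * Cmod h * Cmod h) with (2 * (M * Cmod h * Cmod h)) by ring.
apply CI_bound.
{ intros u Hu. apply Clim_plus; [exact (Jcont k (k - 1) (Y + h)%C Hk HYh u Hu)|].
  apply Clim_plus; apply Clim_mult; try apply Clim_const.
  - exact (Jcont k (k - 1) Y Hk HY u Hu).
  - exact (Jder_cont k Y Hk HY u Hu). }
intros u Hu. destruct (rootk_bound k u Hk) as [r1 r2]; [lra|]. set (r := rootk k u) in *.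
assert (T := Crpow_Taylor (1 - RtoC r * Y)%C (RtoC (- r) * h)%C (k - 1) L).
fold M in T.
match type of T with _ -> Cmod ?a <= _ => match goal with |- Cmod ?b <= _ => replace b with a end end.
2:{ replace (1 - RtoC r * Y + RtoC (- r) * h)%C with (1 - RtoC r * (Y + h))%C by (rewrite RtoC_opp; ring).
    rewrite !RtoC_opp. ring. }
eapply Rle_trans; [apply T|].
- intros s Hs.
  replace (1 - RtoC r * Y + RtoC s * (RtoC (- r) * h))%C with (1 - RtoC r * (Y + RtoC s * h))%C
    by (rewrite RtoC_opp; ring).
  set (Z := (Y + RtoC s * h)%C).
  assert (HZ : fst Z <= 1 - d). 
  { unfold Z; simpl. rewrite Rmult_0_l. unfold d in *. nra. }
  assert (HZm : Cmod Z <= Cmod Y + d).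
  { unfold Z. eapply Rle_trans; [apply Cmod_triangle|]. rewrite Cmod_mult, Cmod_R, Rabs_pos_eq by lra.
    generalize (Cmod_ge_0 h); nra. }
  clearbody Z.
  assert (HZl : lo <= fst (1 - RtoC r * Z)%C).
  { simpl. rewrite Rmult_0_l. assert (0 <= r * (1 - d - fst Z)) by (apply Rmult_le_pos; lra).
    assert (0 <= (1 - r) * (1 - lo)) by (apply Rmult_le_pos; lra).
    assert (0 <= r * (d - lo)) by (apply Rmult_le_pos; lra). lra. }
  assert (HZlm : lo <= Cmod (1 - RtoC r * Z)%C).
  { eapply Rle_trans; [exact HZl|]. eapply Rle_trans; [apply Rle_abs|apply Rabs_fst_le_Cmod]. }
  assert (HZhm : Cmod (1 - RtoC r * Z)%C <= hi).
  { unfold Cminus. eapply Rle_trans; [apply Cmod_triangle|]. rewrite Cmod_opp, Cmod_mult, !Cmod_R, Rabs_R1, (Rabs_pos_eq r) by lra.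
    unfold hi. generalize (Cmod_ge_0 Z); nra. }
  split; [lra|].
  assert (ln lo <= ln (Cmod (1 - RtoC r * Z)%C)) by (apply ln_le; trivial).
  assert (ln (Cmod (1 - RtoC r * Z)%C) <= ln hi) by (apply ln_le; lra).
  unfold L. generalize (Rle_abs (ln hi)) (Rle_abs (- ln lo)) (Rabs_pos (ln hi)) (Rabs_pos (ln lo)).
  rewrite Rabs_Ropp. intros. apply Rabs_le; lra.
- rewrite Cmod_mult, Cmod_R, Rabs_Ropp, Rabs_pos_eq by lra.
  generalize (Cmod_ge_0 h); intros.
  replace (M * (r * Cmod h) * (r * Cmod h)) with ((r * r) * (M * Cmod h * Cmod h)) by ring.
  rewrite <- (Rmult_1_l (M * Cmod h * Cmod h)) at 2.
  apply Rmult_le_compat_r; [apply Rmult_le_pos; [apply Rmult_le_pos|]; trivial | nra].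
Qed.

Lemma Clim_Jint {T} (F : (T -> Prop) -> Prop) {FF : Filter F} k f (Y : C) :
  0 < k -> fst Y < 1 -> Clim F f Y -> Clim F (fun x => Jint k (f x)) (Jint k Y).
Proof.
intros Hk HY Hf. destruct (Jint_Taylor k Y Hk HY) as (M & d & HM & Hd & HT).
apply Clim_eps. intros eps Heps.
set (A := M * d + Cmod (Jder k Y) + 1).
assert (HA : 0 < A) by (unfold A; generalize (Cmod_ge_0 (Jder k Y)); nra).
assert (He : 0 < Rmin d (eps / A)) by (apply Rmin_pos; trivial; apply Rdiv_lt_0_compat; trivial).
generalize (proj1 (Clim_eps _ _) Hf _ He). apply filter_imp. intros x Hx.
assert (Hx1 := Rlt_le_trans _ _ _ Hx (Rmin_l _ _)). assert (Hx2 := Rlt_le_trans _ _ _ Hx (Rmin_r _ _)).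
destruct (HT (f x - Y)%C) as [_ H]; [lra|].
replace (Y + (f x - Y))%C with (f x) in H by ring. set (h := (f x - Y)%C) in *.
assert (Hh := Cmod_ge_0 h).
apply Rle_lt_trans with (A * Cmod h).
- replace (Jint k (f x) - Jint k Y)%C with ((Jint k (f x) - Jint k Y - h * Jder k Y) + h * Jder k Y)%C by ring.
  eapply Rle_trans; [apply Cmod_triangle|]. rewrite Cmod_mult. unfold A.
  assert (M * Cmod h * Cmod h <= M * d * Cmod h); [|nra].
  rewrite !Rmult_assoc. apply Rmult_le_compat_l; trivial. nra.
- apply Rmult_lt_reg_l with (/ A); [apply Rinv_0_lt_compat; trivial|].
  rewrite <- Rmult_assoc, Rinv_l, Rmult_1_l by lra. unfold Rdiv in Hx2. lra.
Qed.

Lemma CDer_Jint k (f : R -> C) t l : 0 < k -> fst (f t) < 1 -> CDer f t l ->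
  CDer (fun s => Jint k (f s)) t (l * Jder k (f t))%C.
Proof.
intros Hk HY Hf. destruct (Jint_Taylor k (f t) Hk HY) as (M & d & HM & Hd & HT).
apply CDer_eps. intros eps Heps.
set (D := Cmod (Jder k (f t))). assert (HD : 0 <= D) by apply Cmod_ge_0.
set (B := Cmod l + 1). assert (HB : 0 < B) by (unfold B; generalize (Cmod_ge_0 l); lra).
set (e1 := Rmin 1 (eps / (2 * (D + 1)))).
assert (He1 : 0 < e1).
{ apply Rmin_pos; [lra|]. apply Rdiv_lt_0_compat; lra. }
set (e2 := Rmin d (eps / (2 * (M * B + 1)))).
assert (HMB : 0 <= M * B) by nra.
assert (He2 : 0 < e2).
{ apply Rmin_pos; [lra|]. apply Rdiv_lt_0_compat; lra. }
generalize (filter_and _ _ (proj1 (CDer_eps f t l) Hf e1 He1)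
  (proj1 (Clim_eps _ _) (CDer_Clim _ _ _ Hf) e2 He2)).
apply filter_imp. intros s [H1 H2].
assert (E1 : e1 <= 1) by apply Rmin_l. assert (E2 : e1 <= eps / (2 * (D + 1))) by apply Rmin_r.
assert (E3 : e2 <= d) by apply Rmin_l. assert (E4 : e2 <= eps / (2 * (M * B + 1))) by apply Rmin_r.
destruct (HT (f s - f t)%C) as [_ H]; [lra|].
replace (f t + (f s - f t))%C with (f s) in H by ring. set (h := (f s - f t)%C) in *.
assert (Hh := Cmod_ge_0 h). assert (Ha := Rabs_pos (s - t)). set (a := Rabs (s - t)) in *.
assert (Hha : Cmod h <= B * a).
{ replace h with ((h - RtoC (s - t) * l) + RtoC (s - t) * l)%C by ring.
  eapply Rle_trans; [apply Cmod_triangle|]. rewrite Cmod_mult, Cmod_R. fold a. unfold B. nra. }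
replace (Jint k (f s) - Jint k (f t) - RtoC (s - t) * (l * Jder k (f t)))%C with
  ((Jint k (f s) - Jint k (f t) - h * Jder k (f t)) + (h - RtoC (s - t) * l) * Jder k (f t))%C by ring.
eapply Rle_trans; [apply Cmod_triangle|]. rewrite Cmod_mult. fold D.
assert (G1 : e1 * (2 * (D + 1)) <= eps).
{ apply Rmult_le_compat_r with (r := 2 * (D + 1)) in E2; [|lra].
  unfold Rdiv in E2. rewrite Rmult_assoc, Rinv_l, Rmult_1_r in E2; lra. }
assert (G2 : e2 * (2 * (M * B + 1)) <= eps).
{ apply Rmult_le_compat_r with (r := 2 * (M * B + 1)) in E4; [|lra].
  unfold Rdiv in E4. rewrite Rmult_assoc, Rinv_l, Rmult_1_r in E4; lra. }
assert (M * Cmod h * Cmod h <= eps / 2 * a).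
{ apply Rle_trans with (M * e2 * (B * a)).
  - apply Rmult_le_compat; trivial; [nra|]. apply Rmult_le_compat_l; trivial; lra.
  - replace (M * e2 * (B * a)) with ((M * B * e2) * a) by ring. apply Rmult_le_compat_r; trivial. nra. }
assert (Cmod (h - RtoC (s - t) * l) * D <= eps / 2 * a).
{ apply Rle_trans with (e1 * a * D).
  - apply Rmult_le_compat_r; trivial.
  - replace (e1 * a * D) with ((e1 * D) * a) by ring. apply Rmult_le_compat_r; trivial. nra. }
lra.
Qed.

(** Integration by parts in the integral of [u (1 - u^(1/k) Y)^(k-1)]. *)
Lemma Jint_ode k (Y : C) : 0 < k -> fst Y < 1 ->
  (Jint k Y + Y / RtoC k * Jder k Y)%C = Crpow (1 - Y)%C (k - 1).
Proof.
intros Hk HY. assert (Hk' : RtoC k <> 0%C) by (intros K; apply RtoC_inj in K; lra).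
assert (Cs : forall c f, Ccont f -> Ccont (fun u => c * f u)%C).
{ intros c f Hc u Hu. apply Clim_mult; [apply Clim_const|]. auto. }
unfold Jint, Jder. rewrite <- CI_mult, <- CI_plus by (try apply Cs; try apply Jcont; try apply Jder_cont; trivial).
rewrite (CI_derive (fun u => RtoC u * Crpow (1 - RtoC (rootk k u) * Y)%C (k - 1))%C).
- rewrite rootk_1. replace (1 - 1 * Y)%C with (1 - Y)%C by ring. ring.
- intros u Hu. destruct (Rle_lt_or_eq_dec 0 u) as [H|H]; [lra| |].
  + eapply CDer_eq. apply CDer_mult. apply CDer_RtoC, @is_derive_id.
    apply CDer_Crpow with (f := fun u => (1 - RtoC (rootk k u) * Y)%C).
    { apply slit_pos, Jbase_re; trivial; lra. }
    apply CDer_minus. apply CDer_const. apply CDer_mult. apply CDer_RtoC, is_derive_rootk; trivial.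
    apply CDer_const. cbv beta. unfold one; simpl.
    assert (Hs : slit (1 - RtoC (rootk k u) * Y)%C) by (apply slit_pos, Jbase_re; trivial; lra).
    rewrite (Crpow_pred _ (k - 1)) by trivial.
    rewrite RtoC_div by nra. rewrite RtoC_mult. field.
    repeat split; trivial. intros K; apply RtoC_inj in K; lra. apply slit_neq_0; trivial.
  (* At [u = 0] only continuity of the integrand is available, but the factor [u] suffices. *)
  + subst u. rewrite rootk_neg by lra. apply CDer_eps. intros eps Heps.
    assert (Hc := Jcont k (k - 1) Y Hk HY 0 ltac:(lra)).
    generalize (proj1 (Clim_eps _ _) Hc eps Heps). apply filter_imp. intros s Hs. cbv beta in Hs. rewrite (rootk_neg k 0) in Hs by lra.
    match goal with |- Cmod ?a <= _ => match type of Hs with Cmod ?b < _ => replace a with (RtoC s * b)%C end end.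
    2:{ rewrite RtoC_minus. ring. }
    rewrite Cmod_mult, Cmod_R, Rminus_0_r, Rmult_comm. apply Rmult_le_compat_r; [apply Rabs_pos|lra].
- intros u Hu. apply Clim_plus; [apply Jcont; trivial|]. apply (Cs _ _ (Jder_cont k Y Hk HY)); trivial.
Qed.

Lemma Jint_0 k : 0 < k -> Jint k 0 = 1%C.
Proof.
intros Hk. assert (H := Jint_ode k (RtoC 0) Hk). simpl fst in H. specialize (H ltac:(lra)).
replace (RtoC 0 / RtoC k * Jder k (RtoC 0))%C with (RtoC 0) in H by (unfold Cdiv; ring).
rewrite Cplus_0_r in H. rewrite H.
replace (1 - 0)%C with (RtoC 1) by ring.
rewrite Crpow_RtoC by lra. unfold Rpower. rewrite ln_1, Rmult_0_r, exp_0. trivial.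
Qed.

Lemma Jint_half k : 0 < k -> exists x, 0 < x /\ Jint k (RtoC (/ 2)) = RtoC x.
Proof.
intros Hk.
assert (Hp : forall u, 0 <= u <= 1 -> / 2 <= 1 - rootk k u * / 2 <= 1).
{ intros u Hu. destruct (rootk_bound k u Hk); lra. }
assert (E : forall u, 0 <= u <= 1 ->
  Crpow (1 - RtoC (rootk k u) * RtoC (/ 2))%C (k - 1) = RtoC (Rpower (1 - rootk k u * / 2) (k - 1))).
{ intros u Hu. specialize (Hp u Hu). rewrite <- RtoC_mult, <- RtoC_minus. apply Crpow_RtoC. lra. }
set (g := fun u => Rpower (1 - rootk k u * / 2) (k - 1)).
assert (Hg : Ccont (fun u => RtoC (g u))).
{ intros u Hu. specialize (Hp u Hu). apply Clim_RtoC. unfold g, Rpower.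
  apply (Rlim_comp exp); [|apply continuous_exp].
  apply Rlim_mult; [apply filterlim_const|].
  apply (Rlim_comp ln); [|apply continuous_ln; lra].
  apply Rlim_plus; [apply filterlim_const|]. apply Rlim_opp, Rlim_mult; [|apply filterlim_const].
  apply continuous_rootk; trivial. }
exists (RInt g 0 1). split.
- apply RInt_gt_0; [lra| intros; apply exp_pos |].
  intros u Hu. exact (proj1 (Hg u Hu)).
- unfold Jint. rewrite (CI_ext _ (fun u => RtoC (g u))) by exact E.
  unfold CI. apply Ceq; simpl; trivial. rewrite RInt_const. unfold scal; simpl; unfold mult; simpl; ring.
Qed.

Lemma RtoC_neq_0 x : x <> 0 -> RtoC x <> RtoC 0.
Proof. intros H K; apply H, RtoC_inj, K. Qed.

(** * Time *)

(** [tau = tan a], where [sin a = exp (k (t - T))]. *)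
Definition tau (k T t : R) : R := exp (k * (t - T)) / sqrt (1 - exp (k * (t - T)) * exp (k * (t - T))).

Section Time.

Context (k T : R) (Hk : 0 < k).

Lemma ee_lt_1 t : t < T -> 0 < exp (k * (t - T)) < 1.
Proof. intros; split; [apply exp_pos|]. rewrite <- exp_0. apply exp_increasing. nra. Qed.

Lemma tau_pos t : t < T -> 0 < tau k T t.
Proof.
intros H. destruct (ee_lt_1 t H). apply Rdiv_lt_0_compat; trivial. apply sqrt_lt_R0. nra.
Qed.

Lemma is_derive_tau t : t < T -> is_derive (tau k T) t (k * tau k T t * (1 + tau k T t * tau k T t)).
Proof.
intros H. destruct (ee_lt_1 t H). unfold tau.
assert (H2 : 0 < 1 - exp (k * (t - T)) * exp (k * (t - T))) by nra.
auto_derive.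
- repeat split. unfold Rminus in H2; lra. apply Rgt_not_eq, sqrt_lt_R0. unfold Rminus in H2; lra.
- set (e := exp _) in *. replace (1 + - (e * e)) with (1 - e * e) by ring.
  set (s := sqrt (1 - e * e)).
  assert (Hs : s * s = 1 - e * e) by (apply sqrt_sqrt; lra).
  assert (0 < s) by (apply sqrt_lt_R0; trivial).
  replace (1 + e / s * (e / s)) with (/ (s * s)) by (field_simplify_eq; [rewrite Rplus_comm; lra | lra]).
  assert (He : e * e = 1 - s * s) by lra.
  field_simplify_eq; [|lra]. 
  replace (e ^ 3) with (e * (1 - s * s)) by (rewrite <- He; ring). ring.
Qed.

Lemma asin_ee t : t < T -> asin (exp (k * (t - T))) = atan (tau k T t).
Proof.
intros H. destruct (ee_lt_1 t H). rewrite asin_atan by lra. reflexivity.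
Qed.

Lemma tau_increasing s t : s < t -> t < T -> tau k T s < tau k T t.
Proof.
intros H1 H2. apply (incr_function_le _ s t (fun t => k * tau k T t * (1 + tau k T t * tau k T t))); simpl; try lra.
- intros x Hx1 Hx2. apply is_derive_tau. lra.
- intros x Hx1 Hx2. assert (Hx : x < T) by lra. generalize (tau_pos x Hx); intros.
  apply Rmult_lt_0_compat; [|nra]. apply Rmult_lt_0_compat; trivial.
Qed.

Lemma tau_surj x : 0 < x -> exists t, t < T /\ tau k T t = x.
Proof.
intros Hx. set (s := sqrt (1 + x * x)).
assert (Hs : s * s = 1 + x * x) by (apply sqrt_sqrt; nra).
assert (H1 : 1 < s).
{ unfold s. rewrite <- sqrt_1 at 1. apply sqrt_lt_1; nra. }
assert (Hxs : 0 < x / s) by (apply Rdiv_lt_0_compat; lra).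
assert (Hxs1 : x / s < 1).
{ apply Rmult_lt_reg_r with s; [lra|]. unfold Rdiv. rewrite Rmult_assoc, Rinv_l; nra. }
exists (T + ln (x / s) / k).
assert (E : exp (k * (T + ln (x / s) / k - T)) = x / s).
{ replace (k * _) with (ln (x / s)) by (field; lra). apply exp_ln; trivial. }
split.
- assert (ln (x / s) < 0) by (rewrite <- ln_1; apply ln_increasing; trivial).
  assert (ln (x / s) / k < 0); [|lra]. unfold Rdiv. assert (0 < / k) by (apply Rinv_0_lt_compat; trivial). nra.
- unfold tau. rewrite E.
  replace (1 - x / s * (x / s)) with ((/ s) * (/ s)).
  + rewrite sqrt_square. field; lra. left; apply Rinv_0_lt_compat; lra.
  + field_simplify; try lra. replace (s ^ 2) with (1 + x * x) by (rewrite <- Hs; ring). f_equal; ring.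
Qed.

Lemma lim_ee : filterlim (fun s => exp (k * (s - T))) (Rbar_locally' m_infty) (locally 0).
Proof.
apply filterlim_locally. intros eps. exists (T + ln eps / k). intros s Hs.
unfold ball; simpl; unfold AbsRing_ball, abs, minus, plus, opp; simpl.
rewrite Ropp_0, Rplus_0_r, Rabs_pos_eq by (left; apply exp_pos).
rewrite <- (exp_ln eps) by apply cond_pos. apply exp_increasing.
apply Rmult_lt_reg_r with (/ k); [apply Rinv_0_lt_compat; trivial|].
replace (k * (s - T) * / k) with (s - T) by (field; lra). unfold Rdiv in Hs. lra.
Qed.

Lemma lim_exp_m : filterlim exp (Rbar_locally' m_infty) (locally 0).
Proof. exact is_lim_exp_m. Qed.

Lemma lim_sqrt_ee : filterlim (fun s => sqrt (1 - exp (k * (s - T)) * exp (k * (s - T))))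
  (Rbar_locally' m_infty) (locally 1).
Proof.
apply (Rlim_eq _ (sqrt (1 + - (0 * 0)))).
- apply (Rlim_comp sqrt); [|apply continuous_sqrt].
  apply Rlim_plus; [apply filterlim_const|]. apply Rlim_opp, Rlim_mult; apply lim_ee.
- rewrite Rmult_0_l, Ropp_0, Rplus_0_r. apply sqrt_1.
Qed.

Lemma lim_tau : filterlim (tau k T) (Rbar_locally' m_infty) (locally 0).
Proof.
apply (Rlim_eq _ (0 * / 1)); [|ring]. unfold tau, Rdiv. apply Rlim_mult. apply lim_ee.
apply Rlim_inv. lra. apply lim_sqrt_ee.
Qed.

Lemma lim_exp_div_tau : filterlim (fun s => exp (k * s) * / tau k T s) (Rbar_locally' m_infty)
  (locally (exp (k * T))).
Proof.
apply filterlim_ext_loc with (fun s => exp (k * T) * sqrt (1 - exp (k * (s - T)) * exp (k * (s - T)))).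
- exists T. intros s Hs. destruct (ee_lt_1 s Hs). unfold tau.
  replace (exp (k * s)) with (exp (k * T) * exp (k * (s - T))) by (rewrite <- exp_plus; f_equal; ring).
  field. split; [apply Rgt_not_eq, sqrt_lt_R0; nra | lra].
- apply (Rlim_eq _ (exp (k * T) * 1)); [|ring].
  apply Rlim_mult; [apply filterlim_const | apply lim_sqrt_ee].
Qed.

End Time.

(** * The half-plane coordinate *)

(** The boundary point opposite to the image of the force point. *)
Definition Nroot (k T t : R) : C := cis (atan (tau k T t) / k).
(** The driving point [exp (i w)]. *)
Definition Udrive (k T t : R) : C := cis ((2 + / k) * atan (tau k T t)).
(** The coordinate that maps the unit disc to [Re Y < 1/2], with 0 at 0. *)
Definition Ycoord (k T t : R) (G : C) : C := (G / (G + Nroot k T t))%C.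

(** The function [D] of the constant of motion [Y (1 - Y) D^(1/k)] is [1 / x + i H], where
    [x = tau] is the time parameter and [H] depends on the position [Y] only. *)
Definition Hfun (k : R) (Y : C) : C := (Jint k Y / Crpow (1 - Y) k)%C.
Definition Dfun (k x : R) (Y : C) : C := (RtoC (/ x) + Ci * Hfun k Y)%C.
(** The position, in the original domain, of the point with coordinate [Y] at time [x]. *)
Definition Ffun (k T x : R) (Y : C) : C :=
  (RtoC (exp (- T)) * (Y * (1 - Y)) * Crpow (Dfun k x Y) (/ k))%C.

(** [1 + i x].  With [p = px x], one has [i x = p - 1] and [1 + x^2 = p (2 - p)], so that
    the identities below become rational in [p], without using [i^2 = -1]. *)
Definition px (x : R) : C := (1, x).

Lemma px_eq x : px x = (1 + Ci * RtoC x)%C.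
Proof. apply Ceq; simpl; ring. Qed.

Lemma px_mul x : (px x * (2 - px x))%C = RtoC (1 + x * x).
Proof. apply Ceq; simpl; ring. Qed.

Lemma disc_add_neq_0 (N G : C) : Cmod N = 1 -> Cmod G < 1 -> (G + N)%C <> 0%C.
Proof.
intros HN HG K. assert (E : N = (- G)%C) by (replace N with ((G + N) - G)%C by ring; rewrite K; ring).
rewrite E, Cmod_opp in HN. lra.
Qed.

Lemma disc_to_half (N G : C) : Cmod N = 1 -> Cmod G < 1 -> fst (G / (G + N))%C < / 2.
Proof.
intros HN HG. generalize (Cnorm2_pos _ (disc_add_neq_0 N G HN HG)) (Cmod_sqr N) (Cmod_sqr G) (Cmod_ge_0 G).
rewrite HN. destruct N as [a b], G as [c d]. simpl. set (m := Cmod _) in *. intros H1 H2 H3 H4.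
replace (_ - _) with ((c * (c + a) + d * (d + b)) / ((c + a) * (c + a) + (d + b) * (d + b))) by (field; simpl; lra).
apply Rmult_lt_reg_r with ((c + a) * (c + a) + (d + b) * (d + b)); trivial.
unfold Rdiv. rewrite Rmult_assoc, Rinv_l by lra. nra.
Qed.

Lemma half_neq (Y : C) : fst Y < / 2 -> (1 - Y)%C <> 0%C.
Proof. intros H K. apply (f_equal fst) in K. simpl in K. lra. Qed.

Lemma half_to_disc (N Y : C) : Cmod N = 1 -> fst Y < / 2 -> Cmod (N * Y / (1 - Y))%C < 1.
Proof.
intros HN HY. assert (H0 := half_neq Y HY). rewrite Cmod_div, Cmod_mult, HN, Rmult_1_l by trivial.
assert (H1 := proj1 (Cmod_gt_0 _) H0).
apply Rmult_lt_reg_r with (Cmod (1 - Y)); trivial.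
unfold Rdiv. rewrite Rmult_assoc, Rinv_l, Rmult_1_l, Rmult_1_r by lra.
apply Rsqr_incrst_0; try apply Cmod_ge_0. unfold Rsqr. rewrite !Cmod_sqr. simpl. nra.
Qed.

Lemma half_to_disc_inv (N Y : C) : Cmod N = 1 -> fst Y < / 2 ->
  ((N * Y / (1 - Y)) / (N * Y / (1 - Y) + N))%C = Y.
Proof.
intros HN HY. assert (H0 := half_neq Y HY).
assert (HN0 : N <> 0%C) by (intros ->; rewrite Cmod_0 in HN; lra).
assert ((N * Y / (1 - Y) + N)%C = (N / (1 - Y))%C) by (field; trivial).
rewrite H. field. split; trivial.
Qed.

Lemma Cmod_Nroot k T t : Cmod (Nroot k T t) = 1.
Proof. apply Cmod_cis. Qed.

(** [exp (2 i a) = (1 + i x) / (1 - i x)]. *)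
Lemma Udrive_eq k T t : 0 < k ->
  (Udrive k T t * (2 - px (tau k T t)))%C = (Nroot k T t * px (tau k T t))%C.
Proof.
intros Hk. unfold Udrive, Nroot.
replace ((2 + / k) * atan (tau k T t)) with (atan (tau k T t) / k + 2 * atan (tau k T t)) by (field; lra).
rewrite cis_plus, cis_2atan. set (x := tau k T t). rewrite <- Cmult_assoc. f_equal.
apply Ceq; simpl; field; nra.
Qed.

Lemma px_neq_0 x : px x <> 0%C.
Proof. intros K; apply (f_equal fst) in K; simpl in K; lra. Qed.

Lemma px2_neq_0 x : (2 - px x)%C <> 0%C.
Proof. intros K; apply (f_equal fst) in K; simpl in K; lra. Qed.

Lemma pxY_neq_0 x Y : fst Y < / 2 -> (px x - 2 * Y)%C <> 0%C.
Proof. intros H K; apply (f_equal fst) in K; simpl in K; lra. Qed.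

Lemma CDer_cis (f : R -> R) (t l : R) : is_derive f t l -> CDer (fun s => cis (f s)) t (Ci * RtoC l * cis (f t))%C.
Proof.
intros H. apply CDer_ext with (fun s => Cexp (Ci * RtoC (f s))%C).
{ intros s. unfold Cexp. simpl. replace (0 * f s - 1 * 0) with 0 by ring. rewrite exp_0.
  replace (0 * 0 + 1 * f s) with (f s) by ring. ring. }
eapply CDer_eq. apply CDer_Cexp. apply CDer_mult. apply CDer_const. apply CDer_RtoC; eassumption.
cbv beta. replace (Cexp (Ci * f t)) with (cis (f t)). ring.
unfold Cexp. simpl. replace (0 * f t - 1 * 0) with 0 by ring. rewrite exp_0.
replace (0 * 0 + 1 * f t) with (f t) by ring. ring.
Qed.

Section Trajectory.

Context (k T : R) (Hk : 0 < k).

Lemma CDer_Nroot t : t < T -> CDer (Nroot k T) t ((px (tau k T t) - 1) * Nroot k T t)%C.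
Proof.
intros Ht. unfold Nroot. eapply CDer_eq. apply (CDer_cis (fun t => atan (tau k T t) / k) t (tau k T t)).
- generalize (is_derive_tau k T Hk t Ht); intros H. set (x := tau k T t) in *.
  auto_derive. repeat split. eexists; exact H.
  replace (Derive (fun x0 => tau k T x0) t) with (k * x * (1 + x * x)) by (symmetry; apply is_derive_unique; exact H).
  fold x. field. split; nra.
- rewrite px_eq. ring.
Qed.

(** The Loewner equation in the half-plane coordinate. *)
Lemma CDer_Ycoord G t : t < T -> Cmod (G t) < 1 ->
  CDer G t (G t * ((Udrive k T t + G t) / (Udrive k T t - G t)))%C ->
  let Y := Ycoord k T t (G t) in
  CDer (fun s => Ycoord k T s (G s)) t
    (Y * (1 - Y) * (px (tau k T t) * (2 - px (tau k T t))) / (px (tau k T t) - 2 * Y))%C.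
Proof.
intros Ht HG HD. cbv zeta. unfold Ycoord.
assert (HN := disc_add_neq_0 _ _ (Cmod_Nroot k T t) HG).
assert (HY := disc_to_half _ _ (Cmod_Nroot k T t) HG).
assert (H1 := pxY_neq_0 (tau k T t) _ HY). assert (H2 := px2_neq_0 (tau k T t)).
assert (HU : (Udrive k T t - G t)%C <> 0%C).
{ intros K. assert (E : G t = Udrive k T t) by (replace (G t) with (Udrive k T t - (Udrive k T t - G t))%C by ring; rewrite K; ring).
  rewrite E in HG. unfold Udrive in HG. rewrite Cmod_cis in HG. lra. }
assert (EU := Udrive_eq k T t Hk).
assert (EU' : Udrive k T t = (Nroot k T t * px (tau k T t) / (2 - px (tau k T t)))%C).
{ rewrite <- EU. field. trivial. }
eapply CDer_eq. apply CDer_div; [exact HN | exact HD |]. apply CDer_plus. exact HD. apply CDer_Nroot; trivial.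
cbv beta. rewrite EU' in *. set (p := px _) in *. set (N := Nroot _ _ _) in *. set (g := G t) in *.
assert (HU2 : (N * p - g * (2 - p))%C <> 0%C).
{ intros K. apply HU. replace (N * p / (2 - p) - g)%C with ((N * p - g * (2 - p)) / (2 - p))%C by (field; trivial).
  rewrite K. field. trivial. }
assert (H3 : (p * (g + N) - 2 * g)%C <> 0%C).
{ intros K. apply HU2. rewrite <- K. ring. }
field. repeat split; trivial.
Qed.

Lemma Jder_eq (Y : C) : fst Y < / 2 -> Y <> 0%C ->
  Jder k Y = (RtoC k / Y * (Crpow (1 - Y) (k - 1) - Jint k Y))%C.
Proof.
intros HY HY0. rewrite <- Jint_ode by (trivial; lra). field. split; trivial. apply RtoC_neq_0; lra.
Qed.

Lemma slit_1mY (Y : C) : fst Y < 1 -> slit (1 - Y)%C.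
Proof. intros; apply slit_pos; simpl; lra. Qed.

Lemma CDer_Hfun (f : R -> C) t l : fst (f t) < / 2 -> f t <> 0%C -> CDer f t l ->
  CDer (fun s => Hfun k (f s)) t
   (l * (RtoC k * Hfun k (f t) / (1 - f t) + RtoC k / (f t * (1 - f t)) - RtoC k * Hfun k (f t) / f t))%C.
Proof.
intros HY HY0 Hf. assert (H1 := half_neq _ HY). assert (Hs : slit (1 - f t)%C) by (apply slit_1mY; lra).
unfold Hfun. eapply CDer_eq. apply CDer_div.
- apply Crpow_neq_0.
- apply CDer_Jint; trivial. lra. exact Hf.
- apply (CDer_Crpow (fun s => 1 - f s)%C); trivial. apply CDer_minus. apply CDer_const. exact Hf.
- cbv beta. rewrite Jder_eq by trivial. rewrite (Crpow_pred _ k) by trivial.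
  set (c := Crpow _ (k - 1)). assert (c <> 0%C) by apply Crpow_neq_0.
  field. repeat split; trivial.
Qed.

(** [D] satisfies a linear equation, the one of [(Y (1 - Y))^(-k)]. *)
Lemma CDer_Dfun (f : R -> C) t : t < T -> fst (f t) < / 2 -> f t <> 0%C ->
  let p := px (tau k T t) in
  CDer f t (f t * (1 - f t) * (p * (2 - p)) / (p - 2 * f t))%C ->
  CDer (fun s => Dfun k (tau k T s) (f s)) t
   (- RtoC k * ((p * (2 - p)) / (p - 2 * f t)) * (1 - 2 * f t) * Dfun k (tau k T t) (f t))%C.
Proof.
intros Ht HY HY0. cbv zeta. intros Hf.
assert (Hx := tau_pos k T Hk t Ht). assert (Hdx := is_derive_tau k T Hk t Ht).
assert (H1 := half_neq _ HY). assert (H2 := pxY_neq_0 (tau k T t) _ HY).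
unfold Dfun. eapply CDer_eq. apply CDer_plus.
- apply CDer_RtoC. apply is_derive_inv. exact Hdx. lra.
- apply CDer_mult. apply CDer_const. apply CDer_Hfun; eassumption.
- cbv beta. set (x := tau k T t) in *. set (h := Hfun k (f t)).
  assert (Hx0 : RtoC x <> 0%C) by (apply RtoC_neq_0; lra).
  replace Ci with ((px x - 1) / RtoC x)%C by (rewrite px_eq; field; trivial).
  replace (RtoC (- (k * x * (1 + x * x)) / x ^ 2)) with (- RtoC k * (px x * (2 - px x)) / RtoC x)%C.
  2:{ rewrite px_mul. rewrite RtoC_div by (apply pow_nonzero; lra).
      rewrite RtoC_opp, !RtoC_mult, RtoC_pow. field. trivial. }
  rewrite RtoC_inv by lra. field. repeat split; trivial.
Qed.

End Trajectory.

(** * The conserved quantity along a trajectory *)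

Lemma is_derive_Cmod2 (P : R -> C) t b : CDer P t (b * P t)%C ->
  is_derive (fun s => Cmod (P s) * Cmod (P s)) t (2 * fst b * (Cmod (P t) * Cmod (P t))).
Proof.
intros [H1 H2]. apply is_derive_ext with (fun s => fst (P s) * fst (P s) + snd (P s) * snd (P s)).
{ intros; symmetry; apply Cmod_sqr. }
rewrite Cmod_sqr.
assert (E : forall f1 f2 : R -> R, forall l1 l2, is_derive f1 t l1 -> is_derive f2 t l2 ->
  is_derive (fun s => f1 s * f1 s + f2 s * f2 s) t (2 * (f1 t * l1 + f2 t * l2))).
{ intros. der_solve. ring. }
eapply is_derive_eq. apply (E _ _ _ _ H1 H2). simpl. ring.
Qed.

Lemma CDer_zero_const f a b : a <= b -> (forall t, a <= t <= b -> CDer f t 0) -> f a = f b.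
Proof.
intros [Hab|Hab] H; [|subst; trivial]. apply Ceq.
- apply (eq_is_derive (V:=R_NormedModule) (fun s => fst (f s))); trivial. intros t Ht; apply (H t Ht).
- apply (eq_is_derive (V:=R_NormedModule) (fun s => snd (f s))); trivial. intros t Ht; apply (H t Ht).
Qed.

Section Conservation.

Context (k T : R) (Hk : 0 < k) (t0 : R) (Ht0 : t0 < T) (G : R -> C) (z : C).
Hypothesis HG : forall s, s <= t0 -> 
  CDer G s (G s * ((Udrive k T s + G s) / (Udrive k T s - G s)))%C.
Hypothesis HG1 : forall s, s <= t0 -> Cmod (G s) < 1.
Hypothesis HG0 : forall s, s <= t0 -> G s <> 0%C.
Hypothesis Hz : Clim (Rbar_locally' m_infty) (fun s => G s * RtoC (exp (- s)))%C z.

Let Y s := Ycoord k T s (G s).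
Let D s := Dfun k (tau k T s) (Y s).

Lemma traj_half s : s <= t0 -> fst (Y s) < / 2.
Proof. intros Hs. apply disc_to_half. apply Cmod_Nroot. auto. Qed.

Lemma traj_neq_0 s : s <= t0 -> Y s <> 0%C.
Proof.
intros Hs K. unfold Y, Ycoord in K. apply (HG0 s Hs).
assert (HN := disc_add_neq_0 _ _ (Cmod_Nroot k T s) (HG1 s Hs)).
replace (G s) with (G s / (G s + Nroot k T s) * (G s + Nroot k T s))%C by (field; trivial).
rewrite K. ring.
Qed.

Lemma traj_lim_G : Clim (Rbar_locally' m_infty) G 0.
Proof.
eapply Clim_eq; [eapply Clim_ext|].
2:{ apply Clim_mult. exact Hz. apply Clim_RtoC. exact lim_exp_m. }
- intros s. cbv beta. rewrite <- Cmult_assoc, <- RtoC_mult, <- exp_plus.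
  replace (- s + s) with 0 by ring. rewrite exp_0. ring.
- ring.
Qed.

Lemma traj_lim_N : Clim (Rbar_locally' m_infty) (Nroot k T) 1.
Proof.
replace (RtoC 1) with (cis (atan 0 / k)).
2:{ rewrite atan_0. unfold Rdiv. rewrite Rmult_0_l. unfold cis. rewrite cos_0, sin_0. trivial. }
apply Clim_cis. unfold Rdiv. apply Rlim_mult; [|apply filterlim_const].
apply (Rlim_comp atan); [apply lim_tau; trivial | apply continuous_atan].
Qed.

Lemma traj_lim_Y : Clim (Rbar_locally' m_infty) Y 0.
Proof.
eapply Clim_eq. apply Clim_div. 2: apply traj_lim_G. 2: apply Clim_plus; [apply traj_lim_G | apply traj_lim_N].
- intros K; apply (f_equal fst) in K; simpl in K; lra.
- unfold Cdiv; ring.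
Qed.

Lemma traj_lim_Yexp : Clim (Rbar_locally' m_infty) (fun s => Y s * RtoC (exp (- s)))%C z.
Proof.
eapply Clim_eq; [eapply Clim_ext|].
2:{ apply Clim_div. 2: exact Hz. 2: apply Clim_plus; [apply traj_lim_G | apply traj_lim_N].
 intros K; apply (f_equal fst) in K; simpl in K; lra. }
- intros s. cbv beta. unfold Y, Ycoord, Cdiv. ring.
- replace (0 + 1)%C with (RtoC 1) by ring. field.
Qed.

Lemma traj_lim_D : Clim (Rbar_locally' m_infty) (fun s => RtoC (exp (k * s)) * D s)%C (RtoC (exp (k * T))).
Proof.
assert (H1 : Clim (Rbar_locally' m_infty) (fun s => Hfun k (Y s)) (Hfun k 0)).
{ unfold Hfun. apply Clim_div. apply Crpow_neq_0.
  apply Clim_Jint; trivial; [apply Rbar_locally'_filter | simpl; lra | apply traj_lim_Y].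
  apply Clim_Crpow. apply slit_1mY; simpl; lra. apply Clim_minus. apply Clim_const. apply traj_lim_Y. }
assert (H2 : Clim (Rbar_locally' m_infty) (fun s => RtoC (exp (k * s))) 0).
{ apply Clim_RtoC. eapply filterlim_ext. 2: apply (lim_ee k 0 Hk). intros; cbv beta; f_equal; ring. }
eapply Clim_eq; [eapply Clim_ext|].
2:{ apply Clim_plus. apply Clim_RtoC. apply (lim_exp_div_tau k T Hk).
    apply Clim_mult. exact H2. apply Clim_mult. apply (Clim_const Ci). exact H1. }
- intros s. cbv beta. unfold D, Dfun. rewrite RtoC_mult. ring.
- ring.
Qed.

(** [Y (1 - Y)] and [D] have logarithmic derivatives [b] and [- k b]. *)
Lemma traj_deriv s : s <= t0 -> exists b : C,
  CDer (fun s => Y s * (1 - Y s))%C s (b * (Y s * (1 - Y s)))%C /\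
  CDer D s (- RtoC k * b * D s)%C.
Proof.
intros Hs.
exists ((px (tau k T s) * (2 - px (tau k T s))) / (px (tau k T s) - 2 * Y s) * (1 - 2 * Y s))%C.
assert (HD := CDer_Ycoord k T Hk G s (Rle_lt_trans _ _ _ Hs Ht0) (HG1 s Hs) (HG s Hs)).
cbv zeta in HD. fold (Y s) in HD. change (CDer Y s (Y s * (1 - Y s) * (px (tau k T s) * (2 - px (tau k T s))) / (px (tau k T s) - 2 * Y s))%C) in HD.
assert (H2 := pxY_neq_0 (tau k T s) _ (traj_half s Hs)).
split.
- eapply CDer_eq. apply CDer_mult. exact HD. apply CDer_minus. apply CDer_const. exact HD.
  cbv beta. field. trivial.
- eapply CDer_eq. apply (CDer_Dfun k T Hk Y s); trivial. lra. apply traj_half; trivial. apply traj_neq_0; trivial.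
  fold (D s). field. trivial.
Qed.

(** [|Y (1 - Y)|^(2k) |D|^2] is constant, so a zero of [D] would propagate to all earlier
    times, where [D] is close to [exp (k (T - s))]. *)
Lemma traj_D_neq_0 : D t0 <> 0%C.
Proof.
intros K.
set (P s := (Y s * (1 - Y s))%C).
assert (HP : forall s, s <= t0 -> 0 < Cmod (P s) * Cmod (P s)).
{ intros s Hs. assert (0 < Cmod (P s)); [|nra]. apply Cmod_gt_0. unfold P. apply Cmult_neq_0.
  apply traj_neq_0; trivial. apply half_neq, traj_half; trivial. }
set (W s := Rpower (Cmod (P s) * Cmod (P s)) k * (Cmod (D s) * Cmod (D s))).
assert (HW : forall s, s <= t0 -> is_derive W s 0).
{ intros s Hs. destruct (traj_deriv s Hs) as (b & h1 & h2).
  apply (is_derive_Cmod2 P) in h1. apply (is_derive_Cmod2 D) in h2.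
  specialize (HP s Hs).
  unfold W, Rpower. set (m := fun s => Cmod (P s) * Cmod (P s)) in *. set (d := fun s => Cmod (D s) * Cmod (D s)) in *.
  change (0 < m s) in HP. change (is_derive m s (2 * fst b * m s)) in h1.
  change (is_derive d s (2 * fst (- RtoC k * b)%C * d s)) in h2.
  change (is_derive (fun s => exp (k * ln (m s)) * d s) s 0). clearbody m d.
  der_solve. simpl. field. lra. }
assert (HW0 : forall s, s <= t0 -> D s = 0%C).
{ intros s Hs. destruct Hs as [Hs|Hs]; [|subst; exact K].
  assert (E : W s = W t0) by (apply (eq_is_derive (V:=R_NormedModule) W); trivial; intros; apply HW; lra).
  unfold W in E. rewrite K, Cmod_0 in E.
  apply Cmod_eq_0. assert (0 < Rpower (Cmod (P s) * Cmod (P s)) k) by apply exp_pos.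
  generalize (Cmod_ge_0 (D s)); intros. rewrite Rmult_0_l, Rmult_0_r in E.
  apply Rmult_integral in E. destruct E as [E|E]; [lra|]. nra. }
assert (E : RtoC (exp (k * T)) = 0%C).
{ eapply (Clim_unique (Rbar_locally' m_infty)). apply traj_lim_D.
  eapply Clim_ext_loc. 2: apply Clim_const. exists t0. intros s Hs. rewrite HW0 by lra. ring. }
apply RtoC_inj in E. generalize (exp_pos (k * T)); lra.
Qed.

Lemma traj_conserved : (forall s, s <= t0 -> slit (D s)) -> z = Ffun k T (tau k T t0) (Y t0).
Proof.
intros Hs. set (Q s := (Y s * (1 - Y s) * Crpow (D s) (/ k))%C).
assert (HQ : forall s, s <= t0 -> CDer Q s 0).
{ intros s H. destruct (traj_deriv s H) as (b & h1 & h2). specialize (Hs s H).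
  eapply CDer_eq. apply CDer_mult. exact h1. apply (CDer_Crpow D); eassumption.
  cbv beta. rewrite RtoC_inv by lra. 
  assert (H2 := pxY_neq_0 (tau k T s) _ (traj_half s H)). field. repeat split; trivial.
  apply slit_neq_0; trivial. apply RtoC_neq_0; lra. }
assert (HQ1 : Clim (Rbar_locally' m_infty) Q (Q t0)).
{ eapply Clim_ext_loc. 2: apply (Clim_const (Q t0)). exists t0. intros s H. symmetry.
  apply CDer_zero_const. lra. intros; apply HQ; lra. }
assert (HQ2 : Clim (Rbar_locally' m_infty) Q (z * RtoC (exp T))%C).
{ eapply Clim_eq; [eapply Clim_ext_loc|].
  2:{ apply Clim_mult. apply Clim_mult. exact traj_lim_Yexp. apply Clim_minus. apply (Clim_const 1%C). apply traj_lim_Y.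
      apply (Clim_Crpow (fun s => RtoC (exp (k * s)) * D s)%C (RtoC (exp (k * T))) (/ k)). 2: apply traj_lim_D. apply slit_pos. simpl. apply exp_pos. }
  - exists t0. intros s H. cbv beta. unfold Q.
    unfold Crpow. rewrite Clog_scal; [|apply exp_pos | apply Hs; lra].
    rewrite ln_exp. replace (RtoC (/ k) * (RtoC (k * s) + Clog (D s)))%C with (RtoC s + RtoC (/ k) * Clog (D s))%C.
    2:{ rewrite RtoC_mult, RtoC_inv by lra. field. apply RtoC_neq_0; lra. }
    rewrite Cexp_plus, Cexp_RtoC. replace (RtoC (exp (- s))) with (/ RtoC (exp s))%C.
    2:{ rewrite <- RtoC_inv by apply Rgt_not_eq, exp_pos. rewrite exp_Ropp. trivial. }
    field. apply RtoC_neq_0, Rgt_not_eq, exp_pos.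
  - rewrite Crpow_RtoC by apply exp_pos. unfold Rpower. rewrite ln_exp.
    replace (/ k * (k * T)) with T by (field; lra). ring. }
assert (E := Clim_unique _ _ _ _ HQ1 HQ2). 
unfold Ffun. fold (D t0). unfold Q in E. rewrite <- Cmult_assoc, E.
replace (RtoC (exp (- T))) with (/ RtoC (exp T))%C.
2:{ rewrite <- RtoC_inv by apply Rgt_not_eq, exp_pos. rewrite exp_Ropp. trivial. }
field. apply RtoC_neq_0, Rgt_not_eq, exp_pos.
Qed.

End Conservation.

(** * Boundary values and the predicted tip *)

(** The boundary point [(1 + i y) / 2] of the half-plane, and the value [Y (1 - Y)] there. *)
Definition Ybd (y : R) : C := (/ 2, y / 2).
Definition mbd (y : R) : R := (1 + y * y) / 4.
(** [Y^k J(Y)] on the boundary; it moves vertically when [y] varies. *)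
Definition psi (k y : R) : C := (Crpow (Ybd y) k * Jint k (Ybd y))%C.
(** The real part of [(Y (1 - Y))^k D] on the boundary, at time [x]. *)
Definition Xbd (k x y : R) : R := Rpower (mbd y) k / x - snd (psi k y).

Lemma mbd_pos y : 0 < mbd y.
Proof. unfold mbd. nra. Qed.

Lemma Ybd_conj y : (1 - Ybd y)%C = Cconj (Ybd y).
Proof. apply Ceq; simpl; lra. Qed.

Lemma Ybd_mult y : (Ybd y * (1 - Ybd y))%C = RtoC (mbd y).
Proof. unfold mbd. apply Ceq; simpl; lra. Qed.

Lemma Cmod_Ybd y : Cmod (Ybd y) * Cmod (Ybd y) = mbd y.
Proof. rewrite Cmod_sqr. unfold mbd; simpl; lra. Qed.

Lemma slit_Ybd y : slit (Ybd y).
Proof. apply slit_pos; simpl; lra. Qed.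

(** [Y] and [1 - Y] are conjugate on the boundary. *)
Lemma Crpow_Ybd y p : (Crpow (Ybd y) p * Crpow (1 - Ybd y) p)%C = RtoC (Rpower (mbd y) p).
Proof.
rewrite Ybd_conj. unfold Crpow. rewrite Clog_conj, <- Cexp_plus, <- Cmult_plus_distr_l.
rewrite <- Cmod_Ybd. generalize (slit_Cmod _ (slit_Ybd y)); intros H.
unfold Rpower. rewrite ln_mult by trivial. rewrite <- Cexp_RtoC. f_equal.
unfold Clog. apply Ceq; simpl; ring.
Qed.

Section Boundary.

Context (k T : R) (Hk : 0 < k).

Lemma CDer_psi y : CDer (psi k) y (Ci * RtoC (k / 2 * Rpower (mbd y) (k - 1)))%C.
Proof.
assert (HY : CDer Ybd y (Ci / 2)%C).
{ split; simpl; auto_derive; trivial; lra. }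
unfold psi. eapply CDer_eq. apply CDer_mult. apply (CDer_Crpow Ybd). apply slit_Ybd. exact HY.
apply (CDer_Jint k Ybd); trivial. simpl; lra. exact HY.
cbv beta. 
assert (E := Jint_ode k (Ybd y) Hk). simpl fst in E. specialize (E ltac:(lra)).
assert (HY0 := slit_neq_0 _ (slit_Ybd y)).
assert (Hk0 : RtoC k <> 0%C) by (apply RtoC_neq_0; lra).
rewrite RtoC_mult, <- Crpow_Ybd, <- E, RtoC_div by lra.
rewrite (Crpow_pred (Ybd y) k) by apply slit_Ybd. field. split; trivial.
Qed.

Lemma is_derive_snd_psi y : is_derive (fun y => snd (psi k y)) y (k / 2 * Rpower (mbd y) (k - 1)).
Proof. eapply is_derive_eq. apply (proj2 (CDer_psi y)). simpl; ring. Qed.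

Lemma fst_psi y : fst (psi k y) = fst (psi k 0).
Proof.
assert (E : forall a b, a <= b -> fst (psi k a) = fst (psi k b)).
{ intros a b [H|H]; [|subst; trivial].
  apply (eq_is_derive (V:=R_NormedModule) (fun s => fst (psi k s))); trivial.
  intros t Ht. eapply is_derive_eq. apply (proj1 (CDer_psi t)). simpl; unfold zero; simpl; ring. }
destruct (Rle_lt_dec y 0); [|symmetry]; apply E; lra.
Qed.

Lemma fst_psi_pos y : 0 < fst (psi k y).
Proof.
rewrite fst_psi. unfold psi. replace (Ybd 0) with (RtoC (/ 2)) by (apply Ceq; simpl; lra).
destruct (Jint_half k Hk) as (x & Hx & ->). rewrite Crpow_RtoC by lra.
simpl. assert (0 < Rpower (/ 2) k) by apply exp_pos. nra.
Qed.

Lemma Dfun_bd x y : 0 < x ->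
  Dfun k x (Ybd y) = (RtoC (Rpower (mbd y) (- k)) * (Xbd k x y, fst (psi k 0)))%C.
Proof.
intros Hx.
assert (E : (Dfun k x (Ybd y) * RtoC (Rpower (mbd y) k))%C = (Xbd k x y, fst (psi k 0))).
{ unfold Dfun, Hfun. rewrite <- (fst_psi y). 
  replace (Xbd k x y, fst (psi k y)) with (RtoC (/ x * Rpower (mbd y) k) + Ci * psi k y)%C.
  2:{ unfold Xbd. generalize (psi k y) (Rpower (mbd y) k). intros q m. apply Ceq; simpl; field; lra. }
  rewrite RtoC_mult, <- Crpow_Ybd. unfold psi. field. apply Crpow_neq_0. }
rewrite <- E, Rpower_Ropp, RtoC_inv by apply Rgt_not_eq, exp_pos.
field. apply RtoC_neq_0, Rgt_not_eq, exp_pos.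
Qed.

Lemma slit_Dfun_bd x y : 0 < x -> slit (Dfun k x (Ybd y)).
Proof.
intros Hx. rewrite Dfun_bd by trivial. apply slit_scal. apply exp_pos.
apply slit_im. simpl. apply Rgt_not_eq, fst_psi_pos.
Qed.

(** The boundary of the half-plane goes to the image of a horizontal line under a power. *)
Lemma Ffun_bd x y : 0 < x -> Ffun k T x (Ybd y) =
  Crpow (exp (- (k * T)) * Xbd k x y, exp (- (k * T)) * fst (psi k 0)) (/ k).
Proof.
intros Hx. unfold Ffun. rewrite Ybd_mult, Dfun_bd by trivial.
assert (Hs : slit (Xbd k x y, fst (psi k 0))).
{ apply slit_im. simpl. apply Rgt_not_eq, fst_psi_pos. }
replace (exp (- (k * T)) * Xbd k x y, exp (- (k * T)) * fst (psi k 0)) with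
  (RtoC (exp (- (k * T))) * (Xbd k x y, fst (psi k 0)))%C by (apply Ceq; simpl; ring).
unfold Crpow. rewrite !Clog_scal by (trivial; apply exp_pos).
rewrite !Cmult_plus_distr_l, !Cexp_plus, <- !RtoC_mult, !Cexp_RtoC.
rewrite Cmult_assoc, <- RtoC_mult. f_equal. f_equal.
unfold Rpower. rewrite !ln_exp.
replace (/ k * - (k * T)) with (- T) by (field; lra).
replace (/ k * (- k * ln (mbd y))) with (- ln (mbd y)) by (field; lra).
rewrite (exp_Ropp (ln (mbd y))), exp_ln by apply mbd_pos. field. apply Rgt_not_eq, mbd_pos.
Qed.

Lemma is_derive_mbdk y : is_derive (fun y => Rpower (mbd y) k) y (k / 2 * y * Rpower (mbd y) (k - 1)).
Proof.
assert (H := mbd_pos y). unfold Rpower, mbd in *.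
auto_derive. lra.
set (m := (1 + y * y) / 4) in *.
replace (exp ((k - 1) * ln m)) with (exp (k * ln m) * / m).
2:{ replace ((k - 1) * ln m) with (k * ln m + - ln m) by ring.
    rewrite exp_plus, exp_Ropp, exp_ln; trivial. }
fold (Rdiv (1 + y * y) 4). fold m. field. lra.
Qed.

Lemma is_derive_frac_minus (g f : R -> R) (x t a b : R) : 0 < x ->
  is_derive g t a -> is_derive f t b -> is_derive (fun t => g t / x - f t) t (a / x - b).
Proof. intros Hx h1 h2. der_solve. simpl. field. lra. Qed.

(** The derivative in [y] has the sign of [y - x]. *)
Lemma Xbd_min x y : 0 < x -> Xbd k x x <= Xbd k x y.
Proof.
intros Hx.
assert (HD : forall y : R, is_derive (Xbd k x) y (k / 2 * Rpower (mbd y) (k - 1) * (y / x - 1))).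
{ intros t. unfold Xbd. generalize (is_derive_snd_psi t) (is_derive_mbdk t); intros h1 h2.
  eapply is_derive_eq. apply (is_derive_frac_minus _ _ x t _ _ Hx h2 h1). field. lra. }
assert (HP : forall y, 0 < k / 2 * Rpower (mbd y) (k - 1)).
{ intros t. apply Rmult_lt_0_compat; [lra | apply exp_pos]. }
destruct (MVT_gen (Xbd k x) x y (fun y => k / 2 * Rpower (mbd y) (k - 1) * (y / x - 1))) as (c & Hc & E).
- intros; apply HD.
- intros t Ht. apply continuity_pt_filterlim.
  refine (ex_derive_continuous (V:=R_NormedModule) (Xbd k x) t _). eexists; apply HD.
- specialize (HP c).
  assert (0 <= (c / x - 1) * (y - x)).
  { replace (c / x - 1) with ((c - x) * / x) by (field; lra).
    assert (0 < / x) by (apply Rinv_0_lt_compat; trivial).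
    assert (0 <= (c - x) * (y - x)); [|nra].
    destruct (Rle_lt_dec x y).
    - rewrite Rmin_left, Rmax_right in Hc by lra. nra.
    - rewrite Rmin_right, Rmax_left in Hc by lra. nra. }
  nra.
Qed.

(** The abscissa of the predicted tip, up to the factor [exp (- k T)]. *)
Definition Xtip (x : R) : R := Xbd k x x.

(** The two terms of the derivative with respect to the second argument of [Xbd] cancel. *)
Lemma is_derive_Xtip x : 0 < x -> is_derive Xtip x (- Rpower (mbd x) k / (x * x)).
Proof.
intros Hx. unfold Xtip, Xbd.
generalize (is_derive_snd_psi x) (is_derive_mbdk x); intros h1 h2.
assert (E : forall (g f : R -> R) (t a b : R), 0 < t ->
  is_derive g t a -> is_derive f t b ->
  is_derive (fun t => g t / t - f t) t ((a * t - g t) / (t * t) - b)).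
{ clear. intros g f t a b Ht h1 h2. der_solve. lra. simpl. field. lra. }
eapply is_derive_eq. apply (E _ _ x _ _ Hx h2 h1). field. lra.
Qed.

Lemma Xtip_decr x y : 0 < x -> x < y -> Xtip y < Xtip x.
Proof.
intros Hx Hxy. apply Ropp_lt_cancel.
apply (incr_function_le (fun x => - Xtip x) x y (fun x => Rpower (mbd x) k / (x * x))); simpl; try lra.
- intros t H1 H2. eapply is_derive_eq. apply (is_derive_opp (V:=R_NormedModule)). apply is_derive_Xtip. lra.
  unfold opp; simpl. field. lra.
- intros t H1 H2. assert (0 < Rpower (mbd t) k) by apply exp_pos. apply Rdiv_lt_0_compat; nra.
Qed.

Lemma Xtip_continuous x : 0 < x -> continuous Xtip x.
Proof.
intros Hx. refine (ex_derive_continuous (V:=R_NormedModule) Xtip x _). eexists; apply is_derive_Xtip; trivial.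
Qed.

Lemma Xtip_infty M : exists x, 0 < x /\ M < Xtip x.
Proof.
set (c := Rpower (/ 4) k). assert (Hc : 0 < c) by apply exp_pos.
set (B := Rabs M + Rabs (snd (psi k 1)) + 1).
assert (HB : 0 < B) by (unfold B; generalize (Rabs_pos M) (Rabs_pos (snd (psi k 1))); lra).
exists (Rmin 1 (c / B)). set (x := Rmin 1 (c / B)).
assert (Hx : 0 < x) by (apply Rmin_pos; [lra | apply Rdiv_lt_0_compat; trivial]).
split; trivial. unfold Xtip, Xbd.
assert (Hx1 : x <= 1) by apply Rmin_l. assert (Hx2 : x <= c / B) by apply Rmin_r.
assert (H1 : c <= Rpower (mbd x) k).
{ apply Rle_Rpower_l. lra. unfold mbd. nra. }
assert (H2 : snd (psi k x) <= snd (psi k 1)).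
{ destruct Hx1 as [h|h]; [|rewrite h; lra].
  left. apply (incr_function_le (fun y => snd (psi k y)) x 1 (fun y => k / 2 * Rpower (mbd y) (k - 1))); simpl; try lra.
  - intros; apply is_derive_snd_psi.
  - intros; apply Rmult_lt_0_compat; [lra | apply exp_pos]. }
assert (H3 : B <= Rpower (mbd x) k / x).
{ apply Rmult_le_reg_r with x; trivial. unfold Rdiv. rewrite Rmult_assoc, Rinv_l, Rmult_1_r by lra.
  apply Rle_trans with c; trivial. apply Rmult_le_compat_l with (r := B) in Hx2; [|lra].
  replace (B * (c / B)) with c in Hx2 by (field; lra). trivial. }
unfold B in H3. generalize (Rle_abs M) (Rle_abs (snd (psi k 1))). lra.
Qed.

Lemma Xtip_ivt x v : 0 < x -> Xtip x <= v -> exists x', 0 < x' <= x /\ Xtip x' = v.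
Proof.
intros Hx [Hv|Hv]; [|exists x; split; [lra | trivial]].
destruct (Xtip_infty v) as (x1 & Hx1 & Hv1).
assert (Hlt : x1 < x).
{ apply Rnot_le_lt. intros [H|H]. generalize (Xtip_decr x x1 Hx H); lra. subst; lra. }
destruct (Ranalysis5.IVT_interv (fun t => v - Xtip t) x1 x) as (c & Hc & Ec); try lra.
- intros t Ht. apply continuity_pt_minus. apply continuity_pt_const; intros ? ?; trivial.
  apply continuity_pt_filterlim, Xtip_continuous. lra.
- exists c. lra.
Qed.

End Boundary.

Lemma continuous_Clim (f : R -> C) t : continuous f t -> Clim (locally t) f (f t).
Proof.
intros H. split.
- eapply filterlim_comp. exact H. intros P HP. destruct HP as [e He]. exists e. intros y Hy. apply He, Hy.
- eapply filterlim_comp. exact H. intros P HP. destruct HP as [e He]. exists e. intros y Hy. apply He, Hy.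
Qed.

Lemma compact_C_singleton z : compact_C (fun z' => z' = z).
Proof.
intros I U HU Hc. destruct (Hc z eq_refl) as [i Hi]. exists (i :: nil). intros z' ->.
exists i. split; [left; trivial | trivial].
Qed.

(** * Auxiliary facts on continuity and sequences *)

(** Continuity of a holomorphic function, in terms of moduli. *)
Lemma holomorphic_bounded (f : C -> C) z l eps : is_holomorphic_derive f z l -> 0 < eps ->
  exists d, 0 < d /\ forall z', Cmod (z' - z)%C < d -> Cmod (f z' - f z)%C < eps.
Proof.
intros H Heps.
assert (Hc : @filterlim C C f (@locally (AbsRing_UniformSpace C_AbsRing) z) (@locally (NormedModule.UniformSpace C_AbsRing C_NormedModule) (f z))).
{ apply (ex_derive_continuous (K:=C_AbsRing) (V:=C_NormedModule) f z). exists l. exact H. }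
specialize (Hc (fun w => Cmod (w - f z)%C < eps)).
assert (Hl : @locally (NormedModule.UniformSpace C_AbsRing C_NormedModule) (f z) (fun w => Cmod (w - f z)%C < eps)).
{ apply (locally_le_locally_norm (V:=C_NormedModule)). exists (mkposreal _ Heps). intros y Hy. exact Hy. }
specialize (Hc Hl). destruct Hc as [d Hd]. exists d. split. apply cond_pos. intros z' Hz'. apply Hd. exact Hz'.
Qed.

Lemma bounded_subseq_R (u : nat -> R) M : (forall n, Rabs (u n) <= M) ->
  exists (phi : nat -> nat) (l : R), (forall n, (n <= phi n)%nat) /\
   filterlim (fun n => u (phi n)) eventually (locally l).
Proof.
intros HM.
destruct (Bolzano_Weierstrass u (fun x => - M <= x <= M)) as [l Hl].
- apply compact_P3.
- intros n. apply Rabs_le_between. apply HM.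
- assert (H : forall n : nat, exists p, (n <= p)%nat /\ Rabs (u p - l) < / (INR n + 1)).
  { intros n. assert (Hp : 0 < / (INR n + 1)) by (apply Rinv_0_lt_compat; generalize (pos_INR n); lra).
    destruct (Hl (disc l (mkposreal _ Hp)) n) as [p [Hp1 Hp2]].
    - exists (mkposreal _ Hp). intros x Hx; exact Hx.
    - exists p. split; trivial. }
  exists (fun n => proj1_sig (constructive_indefinite_description _ (H n))), l.
  split.
  + intros n. destruct (constructive_indefinite_description _ (H n)) as [p [h1 h2]]; trivial.
  + apply filterlim_locally. intros eps.
    destruct (archimed_cor1 eps (cond_pos eps)) as [N [HN1 HN2]]. exists N. intros n Hn.
    destruct (constructive_indefinite_description _ (H n)) as [p [h1 h2]]. simpl.
    eapply Rlt_trans; [exact h2|]. eapply Rlt_trans; [|exact HN1].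
    apply Rinv_lt_contravar.
    * apply Rmult_lt_0_compat; [apply lt_0_INR; trivial | generalize (pos_INR n); lra].
    * apply le_INR in Hn. lra.
Qed.

Lemma filterlim_phi (phi : nat -> nat) : (forall n, (n <= phi n)%nat) -> filterlim phi eventually eventually.
Proof. intros H P [N HN]. exists N. intros n Hn. apply HN. specialize (H n). lia. Qed.

Lemma bounded_subseq_C (u : nat -> C) M : (forall n, Cmod (u n) <= M) ->
  exists (phi : nat -> nat) (l : C), (forall n, (n <= phi n)%nat) /\
   Clim eventually (fun n => u (phi n)) l.
Proof.
intros HM.
destruct (bounded_subseq_R (fun n => fst (u n)) M) as (p1 & l1 & h1 & h2).
{ intros n. eapply Rle_trans; [apply Rabs_fst_le_Cmod | apply HM]. }
destruct (bounded_subseq_R (fun n => snd (u (p1 n))) M) as (p2 & l2 & h3 & h4).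
{ intros n. eapply Rle_trans; [apply Rabs_snd_le_Cmod | apply HM]. }
exists (fun n => p1 (p2 n)), (l1, l2). split.
- intros n. specialize (h3 n). specialize (h1 (p2 n)). lia.
- split; simpl; trivial. 
  exact (filterlim_comp _ _ _ p2 (fun n => fst (u (p1 n))) _ _ _ (filterlim_phi _ h3) h2).
Qed.

(** * Growth of the map at infinity *)

Section Growth.

Context (k T : R) (Hk : 0 < k).

Lemma Rpower_le_max p x y c : 0 < c -> c <= x -> x <= y -> Rpower x p <= Rpower c p + Rpower y p.
Proof.
intros Hc Hx Hy. assert (h1 : 0 < Rpower c p) by apply exp_pos. assert (h2 : 0 < Rpower y p) by apply exp_pos.
destruct (Rle_lt_dec 0 p) as [Hp|Hp].
- assert (Rpower x p <= Rpower y p) by (apply Rle_Rpower_l; lra). lra.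
- assert (Rpower x p <= Rpower c p); [|lra].
  replace p with (- - p) by ring. rewrite (Rpower_Ropp x), (Rpower_Ropp c).
  apply Rinv_le_contravar. apply exp_pos. apply Rle_Rpower_l; lra.
Qed.

Lemma Cmod_Hfun_le (Y : C) : fst Y < / 2 ->
  Cmod (Hfun k Y) <= 2 * (Rpower (/ 2) (k - 1) + Rpower (1 + Cmod (1 - Y)%C) (k - 1)) * Rpower (Cmod (1 - Y)%C) (- k).
Proof.
intros HY. unfold Hfun. rewrite Cmod_div by apply Crpow_neq_0.
rewrite Cmod_Crpow. fold (Rpower (Cmod (1 - Y)%C) k). rewrite Rpower_Ropp. unfold Rdiv.
apply Rmult_le_compat_r. left; apply Rinv_0_lt_compat, exp_pos.
unfold Jint. apply CI_bound.
- apply Jcont; trivial. lra.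
- intros u Hu. destruct (rootk_bound k u Hk) as [r1 r2]; [lra|]. set (r := rootk k u) in *.
  rewrite Cmod_Crpow. fold (Rpower (Cmod (1 - RtoC r * Y)%C) (k - 1)).
  apply Rpower_le_max. lra.
  + eapply Rle_trans; [|apply Rabs_fst_le_Cmod]. eapply Rle_trans; [|apply Rle_abs].
    simpl. rewrite Rmult_0_l. assert (r * fst Y <= / 2); [|lra].
    destruct (Rle_lt_dec (fst Y) 0); nra.
  + replace (1 - RtoC r * Y)%C with (RtoC (1 - r) + RtoC r * (1 - Y))%C by (rewrite RtoC_minus; ring).
    eapply Rle_trans; [apply Cmod_triangle|]. rewrite Cmod_mult, !Cmod_R, !Rabs_pos_eq by lra.
    generalize (Cmod_ge_0 (1 - Y)%C); nra.
Qed.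

Lemma Rpower_neg_small e eps : 0 < e -> 0 < eps -> exists A, 0 < A /\ forall a, A < a -> Rpower a (- e) < eps.
Proof.
intros He Heps. exists (Rpower eps (- / e)). split; [apply exp_pos|]. intros a Ha.
assert (Ha0 : 0 < a) by (eapply Rlt_trans; [|exact Ha]; apply exp_pos).
rewrite <- (exp_ln eps Heps) at 1. unfold Rpower in *. apply exp_increasing.
apply (ln_increasing _ _ (exp_pos _)) in Ha. rewrite ln_exp in Ha.
apply Rmult_lt_compat_l with (r := e) in Ha; trivial.
replace (e * (- / e * ln eps)) with (- ln eps) in Ha by (field; lra). lra.
Qed.

(** [H] tends to 0 at infinity: by [Cmod_Hfun_le] it is bounded by a multiple of
    [|1 - Y|^(- min 1 k)]. *)
Lemma Hfun_small eps : 0 < eps -> exists A, 1 <= A /\ forall Y : C, fst Y < / 2 -> A < Cmod (1 - Y)%C ->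
  Cmod (Hfun k Y) < eps.
Proof.
intros Heps. set (c := Rpower (/ 2) (k - 1)). assert (Hc : 0 < c) by apply exp_pos.
assert (Hm : 0 < Rmin 1 k) by (apply Rmin_pos; lra).
set (e := Rmin 1 k) in *. assert (He1 : e <= 1) by apply Rmin_l. assert (He2 : e <= k) by apply Rmin_r.
set (B := 2 * (c + 1 + Rpower 2 (k - 1))).
assert (HB : 0 < B) by (unfold B; assert (0 < Rpower 2 (k - 1)) by apply exp_pos; lra).
destruct (Rpower_neg_small e (eps / B)) as (A & HA & HAe); trivial. apply Rdiv_lt_0_compat; trivial.
exists (Rmax 1 A). split; [apply Rmax_l|]. intros Y HY Ha.
assert (Ha1 := Rle_lt_trans _ _ _ (Rmax_l _ _) Ha). assert (Ha2 := Rle_lt_trans _ _ _ (Rmax_r _ _) Ha).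
eapply Rle_lt_trans; [apply Cmod_Hfun_le; trivial|]. fold c. set (a := Cmod (1 - Y)) in *.
specialize (HAe a Ha2).
assert (E1 : Rpower a (- k) <= Rpower a (- e)) by (apply Rle_Rpower; lra).
assert (E2 : Rpower (1 + a) (k - 1) * Rpower a (- k) <= (1 + Rpower 2 (k - 1)) * Rpower a (- e)).
{ assert (P0 : 0 < Rpower a (- e)) by apply exp_pos. assert (P1 : 0 < Rpower 2 (k - 1)) by apply exp_pos.
  assert (P2 : 0 < Rpower a (- k)) by apply exp_pos.
  destruct (Rle_lt_dec 1 k) as [h|h].
  - assert (H1 : Rpower (1 + a) (k - 1) <= Rpower (2 * a) (k - 1)) by (apply Rle_Rpower_l; lra).
    rewrite <- Rpower_mult_distr in H1 by lra.
    apply Rle_trans with (Rpower 2 (k - 1) * (Rpower a (k - 1) * Rpower a (- k))).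
    + rewrite <- Rmult_assoc. apply Rmult_le_compat_r; lra.
    + rewrite <- Rpower_plus. replace (k - 1 + - k) with (- (1)) by ring.
      assert (Rpower a (- (1)) <= Rpower a (- e)) by (apply Rle_Rpower; lra). 
      apply Rle_trans with (Rpower 2 (k - 1) * Rpower a (- e)). apply Rmult_le_compat_l; lra. nra.
  - assert (H1 : Rpower (1 + a) (k - 1) <= 1).
    { replace (k - 1) with (- (1 - k)) by ring. rewrite Rpower_Ropp. apply Rle_trans with (/ 1); [|rewrite Rinv_1; lra].
      apply Rinv_le_contravar. lra. assert (H0 : Rpower (1 + a) 0 <= Rpower (1 + a) (1 - k)) by (apply Rle_Rpower; lra).
      rewrite Rpower_O in H0; lra. }
    nra. }
apply Rle_lt_trans with (B * Rpower a (- e)).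
- unfold B. assert (c * Rpower a (- k) <= c * Rpower a (- e)) by (apply Rmult_le_compat_l; lra). lra.
- apply Rmult_lt_compat_l with (r := B) in HAe; trivial.
  replace (B * (eps / B)) with eps in HAe by (field; lra). trivial.
Qed.

(** The map is bounded below near infinity, uniformly for bounded times. *)
Lemma Ffun_bounded x0 M : 0 < x0 -> exists A, forall x (Y : C), 0 < x <= x0 -> fst Y < / 2 ->
  slit (Dfun k x Y) -> Cmod (Ffun k T x Y) <= M -> Cmod Y <= A.
Proof.
intros Hx0.
assert (Hi : 0 < / x0) by (apply Rinv_0_lt_compat; trivial).
destruct (Hfun_small (/ x0 / 2)) as (A & HA & HAH); [lra|].
set (c := exp (- T) * Rpower (/ x0 / 2) (/ k)).
assert (Hc : 0 < c) by (unfold c; apply Rmult_lt_0_compat; apply exp_pos).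
exists (Rmax (A + 1) (2 * Rabs M / c + 1)). intros x Y Hx HY Hs HM.
apply Rnot_lt_le. intros HYA.
assert (H1 := Rle_lt_trans _ _ _ (Rmax_l _ _) HYA). assert (H2 := Rle_lt_trans _ _ _ (Rmax_r _ _) HYA).
assert (HT := Cmod_triangle (Y - 1) 1). replace (Y - 1 + 1)%C with Y in HT by ring. rewrite Cmod_1 in HT.
replace (Y - 1)%C with (- (1 - Y))%C in HT by ring. rewrite Cmod_opp in HT.
specialize (HAH Y HY ltac:(lra)).
assert (HD : / x0 / 2 <= Cmod (Dfun k x Y)).
{ unfold Dfun. set (h := Hfun k Y) in *.
  assert (HT2 := Cmod_triangle (RtoC (/ x) + Ci * h) (- (Ci * h))).
  replace (RtoC (/ x) + Ci * h + - (Ci * h))%C with (RtoC (/ x)) in HT2 by ring.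
  rewrite Cmod_opp, Cmod_mult, Cmod_Ci, Cmod_R, Rabs_pos_eq in HT2 by (left; apply Rinv_0_lt_compat; lra).
  assert (/ x0 <= / x) by (apply Rinv_le_contravar; lra). lra. }
assert (HF : c * (Cmod Y * Cmod (1 - Y)) <= Cmod (Ffun k T x Y)).
{ unfold Ffun. rewrite !Cmod_mult, Cmod_R, Rabs_pos_eq, Cmod_Crpow by (left; apply exp_pos).
  fold (Rpower (Cmod (Dfun k x Y)) (/ k)). unfold c.
  assert (Rpower (/ x0 / 2) (/ k) <= Rpower (Cmod (Dfun k x Y)) (/ k)).
  { apply Rle_Rpower_l. left; apply Rinv_0_lt_compat; trivial. lra. }
  assert (0 <= exp (- T) * (Cmod Y * Cmod (1 - Y))).
  { repeat apply Rmult_le_pos; try apply Cmod_ge_0. left; apply exp_pos. }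
  nra. }
assert (HM2 := Rle_abs M). assert (HM3 := Rabs_pos M).
assert (H3 : 2 * Rabs M < c * Cmod Y).
{ assert (2 * Rabs M / c < Cmod Y) by lra. apply Rmult_lt_compat_l with (r := c) in H; trivial.
  replace (c * (2 * Rabs M / c)) with (2 * Rabs M) in H by (field; lra). trivial. }
assert (1 <= Cmod (1 - Y)) by lra.
assert (0 <= c * Cmod Y) by lra. nra.
Qed.

Lemma Clim_Ffun {S} (F : (S -> Prop) -> Prop) {FF : Filter F} x f x0 (Y0 : C) :
  0 < x0 -> fst Y0 < 1 -> slit (Dfun k x0 Y0) -> filterlim x F (locally x0) -> Clim F f Y0 ->
  Clim F (fun s => Ffun k T (x s) (f s)) (Ffun k T x0 Y0).
Proof.
intros Hx0 HY0 Hs Hx Hf. 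
assert (H1Y : Clim F (fun s => 1 - f s)%C (1 - Y0)%C) by (apply Clim_minus; [apply Clim_const | trivial]).
assert (HD : Clim F (fun s => Dfun k (x s) (f s)) (Dfun k x0 Y0)).
{ unfold Dfun, Hfun. apply Clim_plus. apply Clim_RtoC, Rlim_inv; trivial; lra.
  apply Clim_mult. apply Clim_const. apply Clim_div. apply Crpow_neq_0.
  apply Clim_Jint; trivial. apply Clim_Crpow; trivial. apply slit_1mY; trivial. }
unfold Ffun. apply Clim_mult. apply Clim_mult. apply Clim_const. apply Clim_mult; trivial.
apply Clim_Crpow; trivial.
Qed.

End Growth.

(** * The chain *)

Section Chain.

Context (k T : R) (Hk : 0 < k) (w : R -> R) (K : R -> C -> Prop) (g : R -> C -> C) (gamma : R -> C).
Hypothesis Hw : forall t, t < T -> w t = (2 + / k) * atan (tau k T t).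
Hypothesis HC : whole_plane_Loewner_chain T w K g.
Hypothesis HG : generated_by_curve T K gamma.

(* The predicted position of the curve at time [t]: [y = x] in the boundary formula. *)
Let tip t := Ffun k T (tau k T t) (Ybd (tau k T t)).

Lemma chain_lim z : (exists t1, forall t, t < t1 -> t < T -> ~ K t z) /\
  Clim (Rbar_locally' m_infty) (fun s => g s z * RtoC (exp (- s)))%C z.
Proof.
assert (Hn := chain_normalization _ _ _ _ HC _ (compact_C_singleton z)).
split.
- destruct (Hn 1 Rlt_0_1) as [t1 H]. exists t1. intros t H1 H2. apply (H t H1 H2 z eq_refl).
- apply Clim_eps. intros eps Heps. destruct (Hn eps Heps) as [t1 H]. exists (Rmin t1 T). intros t Ht.
  apply H; trivial. eapply Rlt_le_trans; [exact Ht | apply Rmin_l]. eapply Rlt_le_trans; [exact Ht | apply Rmin_r].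
Qed.

Lemma chain_notK s t z : s <= t -> t < T -> ~ K t z -> ~ K s z.
Proof. intros H1 H2 H3 H4. apply H3. apply (chain_growing _ _ _ _ HC s t); trivial. Qed.

Lemma chain_g_lt_1 t z : t < T -> ~ K t z -> Cmod (g t z) < 1.
Proof. intros H1 H2. destruct (chain_conformal _ _ _ _ HC t H1) as (_ & H & _). apply H; trivial. Qed.

Lemma chain_g_neq_0 t z : t < T -> ~ K t z -> z <> 0%C -> g t z <> 0%C.
Proof.
intros H1 H2 H3 H4. destruct (chain_conformal _ _ _ _ HC t H1) as (_ & _ & H & _).
apply H3. apply H; trivial. apply (chain_interior_point _ _ _ _ HC); trivial.
rewrite H4. symmetry. apply (chain_fix0 _ _ _ _ HC); trivial.
Qed.

(** Every point of the half-plane is the coordinate of a point outside the hull. *)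
Lemma chain_onto t (Y : C) : t < T -> fst Y < / 2 -> exists z, ~ K t z /\ Ycoord k T t (g t z) = Y /\
  g t z = (Nroot k T t * Y / (1 - Y))%C /\ (Y <> 0%C -> z <> 0%C).
Proof.
intros Ht HY. destruct (chain_conformal _ _ _ _ HC t Ht) as (_ & _ & _ & H).
destruct (H (Nroot k T t * Y / (1 - Y))%C) as [z [Hz Ez]].
{ apply half_to_disc; trivial. apply Cmod_Nroot. }
exists z. repeat split; trivial.
- rewrite Ez. apply half_to_disc_inv; trivial. apply Cmod_Nroot.
- intros HY0 Hz0. rewrite Hz0, (chain_fix0 _ _ _ _ HC) in Ez by trivial.
  apply HY0. rewrite <- (half_to_disc_inv (Nroot k T t) Y (Cmod_Nroot k T t) HY), <- Ez.
  unfold Cdiv. ring.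
Qed.

Lemma chain_CDer t z : t < T -> ~ K t z ->
  CDer (fun s => g s z) t (g t z * ((Udrive k T t + g t z) / (Udrive k T t - g t z)))%C.
Proof.
intros Ht Hz. apply CDer_is_derive. unfold Udrive. rewrite <- Hw by trivial.
apply (chain_equation _ _ _ _ HC); trivial.
Qed.

Lemma chain_D_neq_0 t z : t < T -> ~ K t z -> z <> 0%C ->
  Dfun k (tau k T t) (Ycoord k T t (g t z)) <> 0%C.
Proof.
intros Ht Hz Hz0.
apply (traj_D_neq_0 k T Hk t Ht (fun s => g s z) z).
- intros s Hs. apply chain_CDer. lra. apply chain_notK with t; trivial.
- intros s Hs. apply chain_g_lt_1. lra. apply chain_notK with t; trivial.
- intros s Hs. apply chain_g_neq_0; trivial. lra. apply chain_notK with t; trivial.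
- apply chain_lim.
Qed.

(** Since [D] vanishes at no time and [1 / tau] takes all positive values, [D] avoids the
    negative half-line. *)
Lemma chain_slit x (Y : C) : 0 < x -> fst Y < / 2 -> slit (Dfun k x Y).
Proof.
intros Hx HY.
destruct (excluded_middle_informative (Y = 0%C)) as [HY0|HY0].
{ subst Y. apply slit_im. unfold Dfun, Hfun. rewrite Jint_0 by trivial.
  replace (1 - 0)%C with (RtoC 1) by ring. rewrite Crpow_RtoC by lra.
  unfold Rpower. rewrite ln_1, Rmult_0_r, exp_0. simpl. lra. }
apply NNPP. intros Hs. apply not_slit in Hs. destruct Hs as [H1 H2].
(* If [D = - d] with [d >= 0], then [D] vanishes at the time where [1 / tau] is
   [1 / x + d]. *)
set (D := Dfun k x Y) in *.
assert (Hix : 0 < / x) by (apply Rinv_0_lt_compat; trivial).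
assert (Hpos : 0 < / x - fst D) by lra.
destruct (tau_surj k T Hk (/ (/ x - fst D))) as (t & Ht & Et). apply Rinv_0_lt_compat; trivial.
destruct (chain_onto t Y Ht HY) as (z & Hz & Ez & _ & Hz0).
apply (chain_D_neq_0 t z Ht Hz (Hz0 HY0)). rewrite Ez, Et. unfold Dfun at 1. rewrite Rinv_inv.
assert (E : forall d : C, snd d = 0 -> RtoC (/ x - fst d) = (RtoC (/ x) - d)%C).
{ intros d Hd. apply Ceq; simpl; [ring | rewrite Hd; ring]. }
rewrite (E D H2). unfold D, Dfun. ring.
Qed.

Lemma chain_formula t z : t < T -> ~ K t z -> z <> 0%C ->
  z = Ffun k T (tau k T t) (Ycoord k T t (g t z)).
Proof.
intros Ht Hz Hz0.
apply (traj_conserved k T Hk t Ht (fun s => g s z) z).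
- intros s Hs. apply chain_CDer. lra. apply chain_notK with t; trivial.
- intros s Hs. apply chain_g_lt_1. lra. apply chain_notK with t; trivial.
- intros s Hs. apply chain_g_neq_0; trivial. lra. apply chain_notK with t; trivial.
- apply chain_lim.
- intros s Hs. apply chain_slit. apply tau_pos; trivial; lra.
  apply disc_to_half. apply Cmod_Nroot. apply chain_g_lt_1. lra. apply chain_notK with t; trivial.
Qed.

Lemma Udrive_coord t : (Udrive k T t + Nroot k T t <> 0)%C /\
  (Udrive k T t / (Udrive k T t + Nroot k T t))%C = Ybd (tau k T t).
Proof.
assert (E := Udrive_eq k T t Hk). set (U := Udrive k T t) in *. set (N := Nroot k T t) in *.
set (p := px (tau k T t)) in *.
assert (Hp : p <> 0%C) by apply px_neq_0. assert (Hp2 : (2 - p)%C <> 0%C) by apply px2_neq_0.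
assert (EU : (N * p / (2 - p))%C = U) by (rewrite <- E; field; trivial).
assert (HN : N <> 0%C).
{ intros H. assert (H1 := Cmod_Nroot k T t). fold N in H1. rewrite H, Cmod_0 in H1. lra. }
assert (H2 : RtoC 2 <> 0%C) by (apply RtoC_neq_0; lra).
assert (E2 : (U + N)%C = (2 * N / (2 - p))%C) by (rewrite <- EU; field; trivial).
split.
- rewrite E2. intros H. apply HN. replace N with (2 * N / (2 - p) * (2 - p) / 2)%C by (field; repeat split; trivial).
  rewrite H. unfold Cdiv. ring.
- rewrite E2, <- EU. replace (Ybd (tau k T t)) with (p / 2)%C.
  field. repeat split; trivial.
  apply Ceq; unfold p; simpl; field.
Qed.

(** The predicted tip belongs to the hull: it is the limit of the preimages of [r U], as [r]
    increases to 1. *)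
Lemma tip_in_hull t : t < T -> K t (tip t).
Proof.
intros Ht. apply NNPP. intros Hn.
destruct (chain_conformal _ _ _ _ HC t Ht) as (Hd & Hl & _ & Ho).
destruct (Hd _ Hn) as [l Hd']. specialize (Hl _ Hn). set (q := Cmod (g t (tip t))) in *.
destruct (holomorphic_bounded _ _ _ ((1 - q) / 2) Hd') as (d & Hd0 & Hdd). lra.
destruct (Udrive_coord t) as [HU EU].
assert (HL : Clim (at_left 1) (fun r => Ffun k T (tau k T t) (Ycoord k T t (RtoC r * Udrive k T t)%C)) (tip t)).
{ assert (FF : Filter (at_left 1)) by apply at_left_proper_filter.
  apply Clim_Ffun; trivial.
  - apply tau_pos; trivial.
  - simpl; lra.
  - apply slit_Dfun_bd; trivial. apply tau_pos; trivial.
  - apply filterlim_const.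
  - rewrite <- EU. unfold Ycoord.
    assert (Hr : Clim (at_left 1) (fun r => RtoC r * Udrive k T t)%C (Udrive k T t)).
    { eapply Clim_eq. apply Clim_mult; [|apply Clim_const]. apply Clim_RtoC.
      instantiate (1 := 1). intros P [e He]. exists e. intros y Hy _. apply He, Hy.
      ring. }
    apply Clim_div; trivial. apply Clim_plus; trivial. apply Clim_const. }
assert (He := proj1 (Clim_eps _ _) HL d Hd0).
assert (Hq : at_left 1 (fun r => (1 + q) / 2 < r)).
{ assert (H : 0 < (1 - q) / 2) by lra. exists (mkposreal _ H). intros y Hy Hy1.
  apply Rabs_def2 in Hy. simpl in Hy. unfold minus, plus, opp in Hy; simpl in Hy. lra. }
assert (H1 : at_left 1 (fun r => r < 1)).
{ exists (mkposreal _ Rlt_0_1). intros y _ Hy; exact Hy. }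
destruct (filter_ex _ (filter_and _ _ He (filter_and _ _ Hq H1))) as (r & Hr1 & Hr2 & Hr3).
assert (Hq0 : 0 <= q) by apply Cmod_ge_0.
assert (Hm : Cmod (RtoC r * Udrive k T t)%C = r).
{ rewrite Cmod_mult, Cmod_R, Rabs_pos_eq by lra. unfold Udrive. rewrite Cmod_cis. ring. }
destruct (Ho (RtoC r * Udrive k T t)%C) as (z & Hz & Ez). lra.
assert (Hz0 : z <> 0%C).
{ intros ->. rewrite (chain_fix0 _ _ _ _ HC) in Ez by trivial. rewrite <- Ez, Cmod_0 in Hm. lra. }
rewrite <- Ez, <- (chain_formula t z Ht Hz Hz0) in Hr1.
specialize (Hdd z Hr1). rewrite Ez in Hdd.
assert (HT := Cmod_triangle (RtoC r * Udrive k T t - g t (tip t)) (g t (tip t))).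
replace (RtoC r * Udrive k T t - g t (tip t) + g t (tip t))%C with (RtoC r * Udrive k T t)%C in HT by ring.
fold q in HT. lra.
Qed.

Lemma curve_in_hull t : t < T -> K t (gamma t).
Proof. intros Ht. apply (proj2 HG); trivial. exists t. split; [lra | trivial]. Qed.

(** At the first visit of a point, the curve is at the predicted tip. *)
Lemma first_visit_tip t : t < T -> (forall s, s < t -> ~ K s (gamma t)) -> gamma t = tip t.
Proof.
intros Ht Hf. set (z := gamma t) in *. assert (HK : K t z) by (apply curve_in_hull; trivial).
assert (Hz0 : z <> 0%C).
{ intros E. apply (chain_interior_point _ _ _ _ HC t Ht). rewrite <- E. exact HK. }
(* A sequence of times increasing to [t], and the coordinates of [z] at these times. *)
set (s n := t - / (INR n + 1)).
assert (Hs : forall n, s n < t).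
{ intros n. unfold s. assert (0 < / (INR n + 1)) by (apply Rinv_0_lt_compat; generalize (pos_INR n); lra). lra. }
set (Y n := Ycoord k T (s n) (g (s n) z)).
assert (HY : forall n, fst (Y n) < / 2).
{ intros n. apply disc_to_half. apply Cmod_Nroot. apply chain_g_lt_1. specialize (Hs n); lra. apply Hf, Hs. }
assert (HF : forall n, Ffun k T (tau k T (s n)) (Y n) = z).
{ intros n. symmetry. apply chain_formula; trivial. specialize (Hs n); lra. apply Hf, Hs. }
assert (Hx := tau_pos k T Hk t Ht).
destruct (Ffun_bounded k T Hk (tau k T t) (Cmod z) Hx) as [A HA].
destruct (bounded_subseq_C Y A) as (phi & Y0 & Hphi & HL).
{ intros n. specialize (Hs n).
  assert (Hxn := tau_pos k T Hk (s n) (Rlt_trans _ _ _ Hs Ht)).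
  apply (HA (tau k T (s n))). 2: apply HY.
  - split; trivial. left. apply tau_increasing; trivial.
  - apply chain_slit; trivial.
  - rewrite HF. lra. }
assert (Hslim : filterlim (fun n => s (phi n)) eventually (locally t)).
{ eapply (filterlim_comp _ _ _ phi s). apply filterlim_phi; exact Hphi.
  apply filterlim_locally. intros eps.
  destruct (archimed_cor1 eps (cond_pos eps)) as [N [HN1 HN2]]. exists N. intros n Hn.
  unfold ball; simpl; unfold AbsRing_ball, abs, minus, plus, opp; simpl. unfold s.
  replace (t - / (INR n + 1) + - t) with (- / (INR n + 1)) by ring.
  assert (0 < / (INR n + 1)) by (apply Rinv_0_lt_compat; generalize (pos_INR n); lra).
  rewrite Rabs_Ropp, Rabs_pos_eq by lra.
  eapply Rlt_trans; [|exact HN1]. apply Rinv_lt_contravar.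
  - apply Rmult_lt_0_compat; [apply lt_0_INR; trivial | generalize (pos_INR n); lra].
  - apply le_INR in Hn. lra. }
assert (Hxlim : filterlim (fun n => tau k T (s (phi n))) eventually (locally (tau k T t))).
{ apply (Rlim_comp (tau k T)); trivial.
  refine (ex_derive_continuous (V:=R_NormedModule) (tau k T) t _). eexists. apply is_derive_tau; trivial. }
assert (HY0 : fst Y0 <= / 2).
{ apply (filterlim_le (F:=eventually) (fun n => fst (Y (phi n))) (fun _ => / 2) (fst Y0) (/ 2)).
  - exists 0%nat. intros n _. left; apply HY.
  - exact (proj1 HL).
  - apply filterlim_const. }
assert (Hbd : fst Y0 = / 2 -> Y0 = Ybd (2 * snd Y0)).
{ intros E. apply Ceq; simpl; trivial. field. }
assert (Hsl : slit (Dfun k (tau k T t) Y0)).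
{ destruct HY0 as [h|h]. apply chain_slit; trivial. rewrite Hbd by trivial. apply slit_Dfun_bd; trivial. }
assert (HF0 : z = Ffun k T (tau k T t) Y0).
{ apply (Clim_unique eventually (fun n => Ffun k T (tau k T (s (phi n))) (Y (phi n)))).
  - eapply Clim_ext. 2: apply (Clim_const z). intros n; cbv beta. symmetry; apply HF.
  - apply Clim_Ffun; trivial. apply eventually_filter. lra. }
(* Inside the half-plane the limit is the coordinate of a point outside [K t], which must
   be [z]; on the boundary, [z] is the tip at a time which is at most [t]. *)
destruct HY0 as [h|h].
- exfalso. destruct (chain_onto t Y0 Ht h) as (z' & Hz' & E1 & _ & H0).
  assert (HY00 : Y0 <> 0%C).
  { intros E. apply Hz0. rewrite HF0, E. unfold Ffun. ring. }
  apply Hz'. rewrite (chain_formula t z' Ht Hz' (H0 HY00)), E1, <- HF0. exact HK.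
- assert (E := Hbd h). rewrite E, Ffun_bd in HF0 by trivial.
  destruct (Xtip_ivt k Hk (tau k T t) (Xbd k (tau k T t) (2 * snd Y0)) Hx) as (x' & Hx' & Ex').
  { apply Xbd_min; trivial. }
  destruct (tau_surj k T Hk x') as (t' & Ht' & Et'). lra.
  assert (Ez : z = tip t').
  { unfold tip. rewrite Et', Ffun_bd by lra. unfold Xtip in Ex'. rewrite Ex'. exact HF0. }
  destruct (Rtotal_order t' t) as [H|[H|H]].
  + exfalso. apply (Hf t' H). rewrite Ez. apply tip_in_hull; trivial.
  + rewrite Ez, H. trivial.
  + exfalso. generalize (tau_increasing k T Hk t t' H Ht'). lra.
Qed.

(** The set of the visits of a point is closed, and bounded below by the normalization. *)
Lemma first_visit_exists t z : t < T -> K t z ->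
  exists u, u <= t /\ gamma u = z /\ forall s, s < u -> ~ K s z.
Proof.
intros Ht HK. destruct (proj1 (chain_lim z)) as [t1 Ht1].
apply (proj2 HG) in HK; trivial.
set (E x := - x <= t /\ gamma (- x) = z).
assert (Hb : forall x, E x -> x <= - Rmin t1 t).
{ intros x [H1 H2]. apply Rnot_lt_le. intros H.
  assert (H3 : - x < Rmin t1 t) by lra. assert (H4 := Rlt_le_trans _ _ _ H3 (Rmin_l _ _)).
  apply (Ht1 (- x) H4). lra. rewrite <- H2. apply curve_in_hull. lra. }
destruct (completeness E) as [m [Hm1 Hm2]].
- exists (- Rmin t1 t). exact Hb.
- destruct HK as (s & Hs & Es). exists (- s). split; rewrite Ropp_involutive; trivial.
- exists (- m).
  assert (Hmt : - m <= t).
  { destruct HK as (s & Hs & Es). assert (- s <= m); [|lra]. apply Hm1. split; rewrite Ropp_involutive; trivial. }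
  split; [exact Hmt | split].
  + assert (Hc := continuous_Clim _ _ (proj1 HG (- m) ltac:(lra))).
    destruct (excluded_middle_informative (gamma (- m) = z)) as [H|H]; trivial. exfalso.
    assert (Hp : 0 < Cmod (gamma (- m) - z)).
    { apply Cmod_gt_0. intros K0. apply H. replace (gamma (- m)) with (gamma (- m) - z + z)%C by ring. rewrite K0. ring. }
    destruct (proj1 (Clim_eps _ _) Hc _ Hp) as [d Hd].
    assert (Hub : m <= m - d / 2).
    { apply Hm2. intros x Hx. apply Rnot_lt_le. intros Hlt.
      assert (x <= m) by (apply Hm1; trivial). destruct Hx as [Hx1 Hx2].
      specialize (Hd (- x)). rewrite Hx2 in Hd.
      apply (Rlt_irrefl (Cmod (z - gamma (- m)))).
      replace (Cmod (gamma (- m) - z)) with (Cmod (z - gamma (- m))) in Hd.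
      - apply Hd. unfold ball; simpl; unfold AbsRing_ball, abs, minus, plus, opp; simpl.
        generalize (cond_pos d); intros. apply Rabs_def1; lra.
      - rewrite <- Cmod_opp. f_equal. ring. }
    generalize (cond_pos d); lra.
  + intros s Hs HKs. apply (proj2 HG) in HKs; [|lra]. destruct HKs as (s' & Hs' & Es').
    assert (- s' <= m); [|lra]. apply Hm1. split; rewrite Ropp_involutive; trivial. lra.
Qed.

End Chain.

(** * The image of a horizontal line under a power *)

(** The argument of [v + i y]. *)
Definition theta (y v : R) : R := snd (Clog (v, y)).
(** The curve [v |-> (v + i y)^(1/k)]. *)
Definition pcurve (k y v : R) : C := Crpow (v, y) (/ k).

Section PowerCurve.

Context (k y : R) (Hk : 0 < k) (Hy : 0 < y).

Lemma slit_line v : slit (v, y).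
Proof. apply slit_im. simpl. lra. Qed.

Lemma CDer_line v : CDer (fun v => (v, y)) v 1.
Proof. split; simpl. apply @is_derive_id. apply @is_derive_const. Qed.

Lemma CDer_pcurve v : CDer (pcurve k y) v (RtoC (/ k) * (1 / (v, y)) * pcurve k y v)%C.
Proof. unfold pcurve. apply (CDer_Crpow (fun v => (v, y))). apply slit_line. apply CDer_line. Qed.

Lemma is_derive_theta v : is_derive (theta y) v (- y / (v * v + y * y)).
Proof.
unfold theta. eapply is_derive_eq.
apply (proj2 (CDer_Clog (fun v => (v, y)) v 1%C (slit_line v) (CDer_line v))).
simpl. field. repeat split; nra.
Qed.

Lemma continuous_theta v : continuous (theta y) v.
Proof. refine (ex_derive_continuous (V:=R_NormedModule) (theta y) v _). eexists; apply is_derive_theta. Qed.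

Lemma theta_decr u v : u < v -> theta y v < theta y u.
Proof.
intros H. apply Ropp_lt_cancel.
apply (incr_function_le (fun v => - theta y v) u v (fun v => y / (v * v + y * y))); simpl; try lra.
- intros t _ _. eapply is_derive_eq. apply (is_derive_opp (V:=R_NormedModule)). apply is_derive_theta.
  unfold opp; simpl. field. nra.
- intros t _ _. apply Rdiv_lt_0_compat; nra.
Qed.

Lemma Cmod_line_gt v : Rabs v < Cmod (v, y).
Proof.
apply Rsqr_incrst_0; [|apply Rabs_pos | apply Cmod_ge_0].
unfold Rsqr. rewrite Cmod_sqr. simpl. generalize (Rsqr_abs v); unfold Rsqr; nra.
Qed.

Lemma theta_opp v : theta y (- v) = PI - theta y v.
Proof.
unfold theta, Clog. simpl.
replace (Cmod (- v, y)) with (Cmod (v, y)) by (unfold Cmod; simpl; f_equal; ring).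
assert (H1 := Cmod_line_gt v). assert (H2 := Cmod_sqr (v, y)). set (n := Cmod (v, y)) in *. simpl in H2.
apply Rabs_def2 in H1.
replace (y / (n + - v)) with (/ (y / (n + v))).
- rewrite atan_inv. field. apply Rdiv_lt_0_compat; lra.
- field_simplify_eq. nra. split; lra.
Qed.

Lemma Cmod_pcurve v : Cmod (pcurve k y v) = Rpower (Cmod (v, y)) (/ k).
Proof. unfold pcurve. rewrite Cmod_Crpow. reflexivity. Qed.

Lemma pcurve_polar v : pcurve k y v = (RtoC (Rpower (Cmod (v, y)) (/ k)) * cis (/ k * theta y v))%C.
Proof.
unfold pcurve, Crpow, Cexp, theta, Rpower. apply (f_equal2 Cmult).
- apply (f_equal RtoC), (f_equal exp). simpl. ring.
- apply (f_equal cis). simpl. ring.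
Qed.

(** At a double point the two abscissas are opposite, hence the arguments are
    supplementary. *)
Lemma pcurve_double u v : u < v -> pcurve k y u = pcurve k y v ->
  cis (/ k * (2 * theta y u - PI)) = 1%C.
Proof.
intros Huv E.
assert (E1 : Cmod (u, y) = Cmod (v, y)).
{ assert (E2 := f_equal Cmod E). rewrite !Cmod_pcurve in E2. unfold Rpower in E2.
  apply exp_inv in E2. apply Rmult_eq_reg_l in E2. 2: apply Rinv_neq_0_compat; lra.
  apply ln_inv; trivial; apply slit_Cmod, slit_line. }
assert (Ev : v = - u).
{ assert (E2 := Cmod_sqr (u, y)). rewrite E1, Cmod_sqr in E2. simpl in E2. nra. }
rewrite !pcurve_polar, E1 in E.
assert (Hr : RtoC (Rpower (Cmod (v, y)) (/ k)) <> 0%C) by (apply RtoC_neq_0, Rgt_not_eq, exp_pos).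
assert (E3 : cis (/ k * theta y u) = cis (/ k * theta y v)).
{ replace (cis (/ k * theta y u)) with
   (RtoC (Rpower (Cmod (v, y)) (/ k)) * cis (/ k * theta y u) / RtoC (Rpower (Cmod (v, y)) (/ k)))%C by (field; trivial).
  rewrite E. field; trivial. }
rewrite Ev, theta_opp in E3.
replace (/ k * (2 * theta y u - PI)) with (/ k * theta y u + - (/ k * (PI - theta y u))) by (field; lra).
rewrite cis_plus, E3, <- cis_plus, Rplus_opp_r. unfold cis. rewrite cos_0, sin_0. trivial.
Qed.

Lemma cis_eq_1_small a : Rabs a < 1 -> cis a = 1%C -> a = 0.
Proof.
intros Ha E. apply (f_equal snd) in E. simpl in E.
assert (HPI := PI2_1). apply Rabs_def2 in Ha.
destruct (Rtotal_order a 0) as [H|[H|H]]; trivial; exfalso.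
- assert (0 < sin (- a)) by (apply sin_gt_0; lra). rewrite sin_neg in H0. lra.
- assert (0 < sin a) by (apply sin_gt_0; lra). lra.
Qed.

(** Double points of the curve are isolated. *)
Lemma no_interval_of_double_points (X : R -> R) s t : s < t ->
  (forall u v, s < u -> u < v -> v <= t -> X v < X u) -> continuous X t ->
  (forall u, s < u <= t -> exists v, X u < v /\ pcurve k y (X u) = pcurve k y v) -> False.
Proof.
intros Hst HX Hc H.
set (f u := / k * (2 * theta y (X u) - PI)).
assert (Hf : forall u, s < u <= t -> cis (f u) = 1%C).
{ intros u Hu. destruct (H u Hu) as (v & Hv & E). apply (pcurve_double _ v); trivial. }
assert (Hfc : continuous f t).
{ unfold f. apply Rlim_mult. apply filterlim_const. apply Rlim_plus; [|apply filterlim_const].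
  apply Rlim_mult. apply filterlim_const. apply (Rlim_comp (theta y)); [exact Hc | apply continuous_theta]. }
destruct (proj1 (filterlim_locally _ _) Hfc (mkposreal _ Rlt_0_1)) as [d Hd].
set (u := Rmax ((s + t) / 2) (t - d / 2)).
assert (Hd0 := cond_pos d).
assert (Hu1 : (s + t) / 2 <= u) by apply Rmax_l. assert (Hu2 : t - d / 2 <= u) by apply Rmax_r.
assert (Hu3 : u < t) by (apply Rmax_lub_lt; lra).
assert (Hball : Rabs (f u - f t) < 1).
{ apply (Hd u). unfold ball; simpl; unfold AbsRing_ball, abs, minus, plus, opp; simpl. apply Rabs_def1; lra. }
assert (E : f u - f t = 0).
{ apply cis_eq_1_small; trivial. unfold Rminus. rewrite cis_plus, Hf by lra.
  replace (cis (- f t)) with (Cconj (cis (f t))).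
  - rewrite Hf by lra. apply Ceq; simpl; ring.
  - unfold cis. rewrite cos_neg, sin_neg. reflexivity. }
assert (H1 := HX u t ltac:(lra) Hu3 ltac:(lra)). apply theta_decr in H1.
unfold f in E. assert (0 < / k) by (apply Rinv_0_lt_compat; trivial). nra.
Qed.

Lemma theta_lim : filterlim (theta y) (Rbar_locally' p_infty) (locally 0).
Proof.
apply (filterlim_ext (fun v => 2 * atan (y / (Cmod (v, y) + v)))); [reflexivity|].
apply (Rlim_eq _ (2 * atan 0)); [|rewrite atan_0; ring].
apply Rlim_mult; [apply filterlim_const|].
apply (Rlim_comp atan); [|apply continuous_atan].
apply filterlim_locally. intros eps. exists (Rmax 0 (y / eps)). intros v Hv.
assert (H1 := Rle_lt_trans _ _ _ (Rmax_l _ _) Hv). assert (H2 := Rle_lt_trans _ _ _ (Rmax_r _ _) Hv).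
unfold ball; simpl; unfold AbsRing_ball, abs, minus, plus, opp; simpl.
assert (H3 := Cmod_ge_0 (v, y)). assert (He := cond_pos eps).
rewrite Ropp_0, Rplus_0_r, Rabs_pos_eq.
2:{ left; apply Rdiv_lt_0_compat; lra. }
apply Rle_lt_trans with (y / v).
- unfold Rdiv. apply Rmult_le_compat_l; [lra|]. apply Rinv_le_contravar; lra.
- apply Rmult_lt_reg_r with v; trivial. unfold Rdiv. rewrite Rmult_assoc, Rinv_l, Rmult_1_r by lra.
  apply Rmult_lt_compat_r with (r := eps) in H2; trivial. unfold Rdiv in H2. rewrite Rmult_assoc, Rinv_l in H2 by lra. lra.
Qed.

End PowerCurve.

Section Chain.

Context (k T : R) (Hk : 0 < k).

(** * Identification of the curve *)

(** The predicted tip at time [t] is [(abscissa t + i height)^(1/k)]. *)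
Definition height : R := exp (- (k * T)) * fst (psi k 0).
Definition abscissa (t : R) : R := exp (- (k * T)) * Xtip k (tau k T t).

Lemma height_pos : 0 < height.
Proof. apply Rmult_lt_0_compat. apply exp_pos. apply fst_psi_pos; trivial. Qed.

Lemma abscissa_decr s t : s < t -> t < T -> abscissa t < abscissa s.
Proof.
intros H1 H2. apply Rmult_lt_compat_l. apply exp_pos. apply Xtip_decr; trivial.
apply tau_pos; trivial; lra. apply tau_increasing; trivial.
Qed.

Lemma abscissa_continuous t : t < T -> continuous abscissa t.
Proof.
intros Ht. unfold abscissa. apply Rlim_mult. apply filterlim_const.
apply (Rlim_comp (Xtip k)). 2: apply Xtip_continuous; trivial; apply tau_pos; trivial.
refine (ex_derive_continuous (V:=R_NormedModule) (tau k T) t _). eexists. apply is_derive_tau; trivial.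
Qed.

Lemma abscissa_infty M : exists t, t < T /\ M < abscissa t.
Proof.
destruct (Xtip_infty k Hk (exp (k * T) * M)) as (x & Hx & HM).
destruct (tau_surj k T Hk x Hx) as (t & Ht & E). exists t. split; trivial.
unfold abscissa. rewrite E. apply Rmult_lt_compat_l with (r := exp (- (k * T))) in HM; [|apply exp_pos].
rewrite <- Rmult_assoc, <- exp_plus in HM. replace (- (k * T) + k * T) with 0 in HM by ring.
rewrite exp_0 in HM. lra.
Qed.

Context (w : R -> R) (K : R -> C -> Prop) (g : R -> C -> C) (gamma : R -> C).
Hypothesis Hw : forall t, t < T -> w t = (2 + / k) * atan (tau k T t).
Hypothesis HC : whole_plane_Loewner_chain T w K g.
Hypothesis HG : generated_by_curve T K gamma.

Lemma tip_eq t : t < T -> Ffun k T (tau k T t) (Ybd (tau k T t)) = pcurve k height (abscissa t).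
Proof. intros Ht. apply Ffun_bd; trivial. apply tau_pos; trivial. Qed.

(** First visits are dense: otherwise the tip would run along its own past. *)
Lemma first_visits_dense s t : s < t -> t < T ->
  exists u, s < u <= t /\ gamma u = pcurve k height (abscissa u).
Proof.
intros Hst Ht. apply NNPP. intros Hn.
apply (no_interval_of_double_points k height Hk height_pos abscissa s t Hst).
- intros u v _ Huv Hv. apply abscissa_decr; trivial; lra.
- apply abscissa_continuous; trivial.
- intros u Hu. assert (Hu' : u < T) by lra.
  assert (HK := tip_in_hull k T Hk w K g Hw HC u Hu').
  cbv beta zeta in HK. rewrite tip_eq in HK by trivial.
  destruct (first_visit_exists T w K g gamma HC HG u _ Hu' HK) as (a & Ha & Ea & Hf).
  rewrite <- Ea in Hf.
  assert (Et : gamma a = pcurve k height (abscissa a)).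
  { rewrite <- tip_eq by lra. apply (first_visit_tip k T Hk w K g gamma Hw HC HG); trivial. lra. }
  assert (Has : a <= s).
  { apply Rnot_lt_le. intros H. apply Hn. exists a. split; [lra | exact Et]. }
  exists (abscissa a). split. apply abscissa_decr; lra. rewrite <- Ea, Et. reflexivity.
Qed.

Lemma curve_eq t : t < T -> gamma t = pcurve k height (abscissa t).
Proof.
intros Ht.
destruct (excluded_middle_informative (gamma t = pcurve k height (abscissa t))) as [H|H]; trivial. exfalso.
set (h u := (gamma u - pcurve k height (abscissa u))%C).
assert (Hc : Clim (locally t) h (h t)).
{ unfold h. apply Clim_minus. apply continuous_Clim, HG; trivial.
  unfold pcurve. apply Clim_Crpow. apply slit_line, height_pos.
  split; simpl. apply abscissa_continuous; trivial. apply filterlim_const. }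
assert (Hp : 0 < Cmod (h t)).
{ apply Cmod_gt_0. intros E. apply H. unfold h in E.
  replace (gamma t) with (gamma t - pcurve k height (abscissa t) + pcurve k height (abscissa t))%C by ring. 
  rewrite E. ring. }
destruct (proj1 (Clim_eps _ _) Hc _ Hp) as [d Hd]. assert (Hd0 := cond_pos d).
destruct (first_visits_dense (t - d) t ltac:(lra) Ht) as (u & Hu & Eu).
apply (Rlt_irrefl (Cmod (h t))).
replace (Cmod (h t)) with (Cmod (h u - h t)) at 1.
- apply Hd. unfold ball; simpl; unfold AbsRing_ball, abs, minus, plus, opp; simpl. apply Rabs_def1; lra.
- rewrite <- Cmod_opp. f_equal. unfold h at 1. rewrite Eu. ring.
Qed.

End Chain.

(** * Arc-length parametrizations of a regular curve *)

Section ArcLength.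

Context (c dc : R -> C) (b : Rbar) (eta : R -> C) (V : R -> R).
Hypothesis Hc : forall v, CDer c v (dc v).
Hypothesis Hdc : forall v, Clim (locally v) dc (dc v).
Hypothesis Hdc0 : forall v, dc v <> 0%C.
Hypothesis HV : forall s : R, Rbar_lt s b -> eta s = c (V s).
Hypothesis HVdecr : forall s t : R, s < t -> Rbar_lt t b -> V t < V s.
Hypothesis HVivt : forall (s t : R) v, s < t -> Rbar_lt t b -> V t <= v <= V s ->
  exists u, s <= u <= t /\ V u = v.
Hypothesis HL : forall s t : R, s <= t -> Rbar_lt t b -> is_curve_length eta s t (t - s).

Lemma Rbar_lt_le_trans_R (s t : R) : s <= t -> Rbar_lt t b -> Rbar_lt s b.
Proof. intros H1 H2. eapply Rbar_le_lt_trans; [|exact H2]. exact H1. Qed.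

Lemma Rbar_lt_succ (s : R) : Rbar_lt s b -> exists t : R, s < t /\ Rbar_lt t b.
Proof.
destruct b as [b'| |]; simpl; intros H.
- exists ((s + b') / 2). split; lra.
- exists (s + 1). split; [lra | trivial].
- destruct H.
Qed.

(** A single chord is a polygonal length. *)
Lemma chord_le (s t : R) : s <= t -> Rbar_lt t b -> Cmod (eta t - eta s)%C <= t - s.
Proof.
intros H1 H2. apply (HL s t H1 H2).
exists 0%nat, (fun i => match i with 0%nat => s | _ => t end).
repeat split; trivial. intros i Hi. assert (i = 0%nat) by lia. subst; simpl; trivial.
Qed.

Lemma V_noninc (s t : R) : s <= t -> Rbar_lt t b -> V t <= V s.
Proof. intros [H|H] Hb; [left; apply HVdecr; trivial | subst; lra]. Qed.

Lemma length_le (s t M : R) : s <= t -> Rbar_lt t b ->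
  (forall v, V t <= v <= V s -> Cmod (dc v) <= M) -> t - s <= M * (V s - V t).
Proof.
intros H1 H2 HM. apply (HL s t H1 H2). intros l (n & p & Hp0 & Hpn & Hp & ->).
assert (Hps : forall i, (i <= S n)%nat -> s <= p i).
{ induction i; intros Hi. lra. eapply Rle_trans; [apply IHi; lia | apply Hp; lia]. }
assert (Hpt : forall j i, (i + j = S n)%nat -> p i <= t).
{ induction j; intros i Hi. replace i with (S n) by lia. lra.
  eapply Rle_trans; [apply (Hp i); lia | apply IHj; lia]. }
assert (Hpt' : forall i, (i <= S n)%nat -> p i <= t).
{ intros i Hi. apply (Hpt (S n - i)%nat). lia. }
assert (Hb : forall i, (i <= S n)%nat -> Rbar_lt (p i) b).
{ intros i Hi. apply Rbar_lt_le_trans_R with t; auto. }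
assert (E : forall m, (m <= n)%nat ->
  sum_f_R0 (fun i => Cmod (eta (p (S i)) - eta (p i))%C) m <= M * (V (p 0%nat) - V (p (S m)))).
{ assert (E1 : forall i, (i <= n)%nat -> Cmod (eta (p (S i)) - eta (p i))%C <= M * (V (p i) - V (p (S i)))).
  { intros i Hi. rewrite !HV by (apply Hb; lia).
    assert (Hv : V (p (S i)) <= V (p i)) by (apply V_noninc; [apply Hp | apply Hb]; lia).
    assert (V t <= V (p (S i))) by (apply V_noninc; trivial; apply Hpt'; lia).
    assert (V (p i) <= V s) by (apply V_noninc; [apply Hps | apply Hb]; lia).
    rewrite <- (Rabs_pos_eq (V (p i) - V (p (S i)))) by lra.
    replace (Rabs (V (p i) - V (p (S i)))) with (Rabs (V (p (S i)) - V (p i))) by apply Rabs_minus_sym.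
    apply (CDer_bounded c dc).
    - intros; apply Hc.
    - intros v Hv'. rewrite Rmin_right, Rmax_left in Hv' by lra. apply HM. lra. }
  induction m; intros Hm; simpl.
  - apply E1; lia.
  - specialize (IHm ltac:(lia)). specialize (E1 (S m) Hm). simpl in E1. lra. }
specialize (E n ltac:(lia)). rewrite Hp0, Hpn in E. exact E.
Qed.

Lemma V_continuous (s : R) : Rbar_lt s b -> continuous V s.
Proof.
intros Hs. apply filterlim_locally. intros eps. assert (He := cond_pos eps).
destruct (Rbar_lt_succ s Hs) as (t & Hst & Ht).
assert (HR : exists s2, s < s2 /\ Rbar_lt s2 b /\ V s - eps < V s2).
{ destruct (Rlt_le_dec (V s - eps) (V t)) as [h|h]; [exists t; repeat split; trivial|].
  destruct (HVivt s t (V s - eps / 2) Hst Ht) as (u & Hu & Eu); [lra|].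
  exists u. assert (s <> u) by (intros ->; lra). repeat split; try lra.
  apply Rbar_lt_le_trans_R with t; trivial; lra. }
assert (HLt : exists s1, s1 < s /\ V s1 < V s + eps).
{ destruct (Rlt_le_dec (V (s - 1)) (V s + eps)) as [h|h]; [exists (s - 1); split; lra|].
  destruct (HVivt (s - 1) s (V s + eps / 2)) as (u & Hu & Eu); try lra; trivial.
  exists u. assert (s <> u) by (intros ->; lra). split; lra. }
destruct HR as (s2 & H1 & H2 & H3). destruct HLt as (s1 & H4 & H5).
assert (Hd : 0 < Rmin (s2 - s) (s - s1)) by (apply Rmin_pos; lra).
exists (mkposreal _ Hd). intros u Hu. unfold ball in Hu; simpl in Hu; unfold AbsRing_ball, abs, minus, plus, opp in Hu; simpl in Hu.
apply Rabs_def2 in Hu. assert (Ha := Rmin_l (s2 - s) (s - s1)). assert (Hb := Rmin_r (s2 - s) (s - s1)).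
unfold ball; simpl; unfold AbsRing_ball, abs, minus, plus, opp; simpl.
assert (V u <= V s1) by (apply V_noninc; [lra | apply Rbar_lt_le_trans_R with s2; trivial; lra]).
assert (V s2 <= V u) by (apply V_noninc; [lra | trivial]).
apply Rabs_def1; lra.
Qed.

(** The position [V] on the curve, as a function of arc length, has derivative
    [- 1 / |c'|]: near [V s0], the elapsed time is between [(v - e) |V s - V s0|] by
    [chord_le] and [(v + e) |V s - V s0|] by [length_le], with [v = |c'(V s0)|]. *)
Lemma is_derive_V (s0 : R) : Rbar_lt s0 b -> is_derive V s0 (- / Cmod (dc (V s0))).
Proof.
intros Hs0. set (v := Cmod (dc (V s0))). assert (Hv : 0 < v) by (apply Cmod_gt_0, Hdc0).
apply is_derive_eps. intros eps Heps.
set (e := Rmin (v / 2) (eps * v * v / 2)).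
assert (He : 0 < e).
{ apply Rmin_pos. lra. assert (0 < eps * v * v) by (repeat apply Rmult_lt_0_compat; trivial). lra. }
assert (He1 : e <= v / 2) by apply Rmin_l. assert (He2 : e <= eps * v * v / 2) by apply Rmin_r.
assert (Hl1 := proj1 (CDer_eps c (V s0) _) (Hc (V s0)) e He).
assert (Hl2 := proj1 (Clim_eps _ _) (Hdc (V s0)) e He).
destruct (filter_and _ _ Hl1 Hl2) as [d Hd]. clear Hl1 Hl2.
assert (Hcv := proj1 (filterlim_locally _ _) (V_continuous s0 Hs0) d).
destruct (Rbar_lt_succ s0 Hs0) as (t & Ht1 & Ht2).
assert (Hlt : locally s0 (fun s => s < t)).
{ assert (Hp : 0 < t - s0) by lra. exists (mkposreal _ Hp). intros y Hy. 
  unfold ball in Hy; simpl in Hy; unfold AbsRing_ball, abs, minus, plus, opp in Hy; simpl in Hy. apply Rabs_def2 in Hy. lra. }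
generalize (filter_and _ _ Hcv Hlt). apply filter_imp. intros s [Hs Hst].
assert (Hsb : Rbar_lt s b) by (apply Rbar_lt_le_trans_R with t; trivial; lra).
assert (Hspeed : forall x, Rmin (V s0) (V s) <= x <= Rmax (V s0) (V s) -> Cmod (dc x) <= v + e).
{ intros x Hx. assert (Hx' : ball (V s0) d x).
  { unfold ball in *; simpl in *; unfold AbsRing_ball, abs, minus, plus, opp in *; simpl in *.
    apply Rabs_def2 in Hs. assert (Hd0 := cond_pos d).
    destruct (Rle_lt_dec (V s0) (V s)); [rewrite Rmin_left, Rmax_right in Hx by lra | rewrite Rmin_right, Rmax_left in Hx by lra];
     apply Rabs_def1; lra. }
  destruct (Hd x Hx') as [_ H]. 
  replace (dc x) with ((dc x - dc (V s0)) + dc (V s0))%C by ring.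
  eapply Rle_trans; [apply Cmod_triangle|]. fold v. lra. }
destruct (Hd (V s) Hs) as [Hlow _].
assert (HD0 := Rabs_pos (V s - V s0)).
assert (HD1 : (v - e) * Rabs (V s - V s0) <= Cmod (c (V s) - c (V s0))%C).
{ assert (HT := Cmod_triangle (c (V s) - c (V s0)) (- (c (V s) - c (V s0) - RtoC (V s - V s0) * dc (V s0)))).
  rewrite Cmod_opp in HT.
  replace (c (V s) - c (V s0) + - (c (V s) - c (V s0) - RtoC (V s - V s0) * dc (V s0)))%C with
   (RtoC (V s - V s0) * dc (V s0))%C in HT by ring.
  rewrite Cmod_mult, Cmod_R in HT. fold v in HT. lra. }
rewrite <- (HV s Hsb), <- (HV s0 Hs0) in HD1.
assert (Key : forall D h, 0 <= D -> (v - e) * D <= h -> h <= (v + e) * D -> Rabs (D - h / v) <= eps * h).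
{ intros D h HD Hh1 Hh2.
  assert (K1 : v * D <= 2 * h).
  { nra. }
  assert (K2 : Rabs (D * v - h) <= e * D) by (apply Rabs_le; lra).
  replace (D - h / v) with ((D * v - h) * / v) by (field; lra).
  rewrite Rabs_mult, (Rabs_pos_eq (/ v)) by (left; apply Rinv_0_lt_compat; trivial).
  apply Rmult_le_reg_r with v; trivial. rewrite Rmult_assoc, Rinv_l, Rmult_1_r by lra.
  eapply Rle_trans; [exact K2|].
  apply Rle_trans with (eps * v * v / 2 * D); [apply Rmult_le_compat_r; trivial|].
  assert (0 <= eps * v) by nra. nra. }
destruct (Rle_lt_dec s0 s) as [h|h].
- assert (Hn := V_noninc s0 s h Hsb).
  rewrite (Rabs_pos_eq (s - s0)) by lra. rewrite Rabs_left1 in HD1, HD0 by lra.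
  replace (V s - V s0 - (s - s0) * - / v) with (- ((V s0 - V s) - (s - s0) / v)) by (field; lra).
  rewrite Rabs_Ropp. apply Key. lra.
  + assert (Hch := chord_le s0 s h Hsb). lra.
  + apply length_le; trivial. intros x Hx. apply Hspeed. rewrite Rmin_right, Rmax_left; lra.
- assert (Hn : V s0 <= V s) by (apply V_noninc; trivial; lra).
  rewrite (Rabs_left1 (s - s0)) by lra. rewrite Rabs_pos_eq in HD1, HD0 by lra.
  replace (V s - V s0 - (s - s0) * - / v) with ((V s - V s0) - (- (s - s0)) / v) by (field; lra).
  apply Key. lra.
  + assert (Hch := chord_le s s0 ltac:(lra) Hs0). 
    rewrite <- Cmod_opp in Hch. replace (- (eta s0 - eta s))%C with (eta s - eta s0)%C in Hch by ring. lra.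
  + replace (- (s - s0)) with (s0 - s) by ring. apply length_le; trivial. lra.
    intros x Hx. apply Hspeed. rewrite Rmin_left, Rmax_right; lra.
Qed.

(** An arc-length parametrization has unit speed; the sign is that of decreasing [V]. *)
Lemma CDer_arc_length (s : R) : Rbar_lt s b ->
  CDer (fun s => c (V s)) s (- (dc (V s) / RtoC (Cmod (dc (V s)))))%C.
Proof.
intros Hs. assert (HdV := is_derive_V s Hs). assert (Hv : 0 < Cmod (dc (V s))) by (apply Cmod_gt_0, Hdc0).
eapply CDer_eq with (RtoC (- / Cmod (dc (V s))) * dc (V s))%C.
- destruct (Hc (V s)) as [h1 h2]. split; simpl.
  + eapply is_derive_eq. apply (is_derive_comp (V:=R_NormedModule) (fun v => fst (c v)) V s); eassumption.
    unfold scal; simpl; unfold mult; simpl. ring.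
  + eapply is_derive_eq. apply (is_derive_comp (V:=R_NormedModule) (fun v => snd (c v)) V s); eassumption.
    unfold scal; simpl; unfold mult; simpl. ring.
- rewrite RtoC_opp, RtoC_inv by lra. field. apply RtoC_neq_0; lra.
Qed.

End ArcLength.

(** * The flow line *)

(** The lift of the horizontal line at height [y] whose argument is between 0 and [PI]. *)
Definition line (y : R) (Hy : 0 < y) (v : R) : M0 :=
  mkM0 (Cmod (v, y)) (theta y v) (slit_Cmod _ (slit_line y Hy v)).

Section FlowLine.

Context (k y : R) (Hk : 0 < k) (Hy : 0 < y).

Lemma line_proj v : M0_proj (line y Hy v) = (v, y).
Proof.
unfold M0_proj; simpl. rewrite <- (Cexp_Clog (v, y)) at 2 by (apply slit_line; trivial).
unfold Cexp, theta. simpl. rewrite exp_ln; trivial. apply slit_Cmod, slit_line; trivial.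
Qed.

Lemma line_pow_proj v : M0_proj (M0_pow (line y Hy v) (/ k)) = pcurve k y v.
Proof. rewrite pcurve_polar. reflexivity. Qed.

Lemma Clim_line v : Clim (locally v) (fun v => (v, y)) (v, y).
Proof. split; simpl. apply filterlim_id. apply filterlim_const. Qed.

Lemma continuous_line v : continuous_M0 (line y Hy) v.
Proof.
split; simpl.
- apply (Rlim_Cmod (fun v => (v, y)) (v, y)), Clim_line.
- apply continuous_theta; trivial.
Qed.

(** The derivative of [pcurve]. *)
Definition dpcurve (v : R) : C := (RtoC (/ k) * (1 / (v, y)) * pcurve k y v)%C.

Lemma line_neq_0 v : (v, y) <> RtoC 0.
Proof. apply slit_neq_0, slit_line; trivial. Qed.

Lemma dpcurve_continuous v : Clim (locally v) dpcurve (dpcurve v).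
Proof.
unfold dpcurve. apply Clim_mult.
- apply Clim_mult. apply Clim_const. apply Clim_div. apply line_neq_0. apply Clim_const. apply Clim_line.
- apply CDer_Clim with (1 := CDer_pcurve k y Hy v).
Qed.

Lemma dpcurve_neq_0 v : dpcurve v <> 0%C.
Proof.
unfold dpcurve. apply Cmult_neq_0; [apply Cmult_neq_0; [|apply Cmult_neq_0]|].
- apply RtoC_neq_0. apply Rinv_neq_0_compat. lra.
- apply RtoC_neq_0. lra.
- intros H. apply (RtoC_neq_0 1); [lra|].
  rewrite <- (Cinv_r (v, y)) by apply line_neq_0. rewrite H. apply Cmult_0_r.
- apply Crpow_neq_0.
Qed.

Lemma dpcurve_direction v : (dpcurve v / RtoC (Cmod (dpcurve v)))%C = cis ((/ k - 1) * theta y v).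
Proof.
assert (H1 := line_proj v). unfold M0_proj in H1. simpl in H1.
set (n := Cmod (v, y)) in *.
assert (Hn : 0 < n) by (apply slit_Cmod, slit_line; trivial).
assert (Hn0 : RtoC n <> 0%C) by (apply RtoC_neq_0; lra).
assert (Hcis : cis (theta y v) <> 0%C).
{ intros H. assert (H2 := Cmod_cis (theta y v)). rewrite H, Cmod_0 in H2. lra. }
assert (Hik : 0 < / k) by (apply Rinv_0_lt_compat; trivial).
assert (Hr : 0 < / k * / n * Rpower n (/ k)).
{ repeat apply Rmult_lt_0_compat; trivial. apply Rinv_0_lt_compat; trivial. apply exp_pos. }
assert (E : dpcurve v = (RtoC (/ k * / n * Rpower n (/ k)) * cis ((/ k - 1) * theta y v))%C).
{ unfold dpcurve. rewrite pcurve_polar. fold n. rewrite <- H1, !RtoC_mult, (RtoC_inv n) by lra.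
  replace (/ k * theta y v) with ((/ k - 1) * theta y v + theta y v) by ring.
  rewrite cis_plus. field. split; trivial. }
rewrite E, Cmod_mult, Cmod_cis, Cmod_R, Rabs_pos_eq, Rmult_1_r by lra.
field. apply RtoC_neq_0; lra.
Qed.

End FlowLine.

Lemma cis_add_PI x : cis (x + PI) = (- cis x)%C.
Proof. unfold cis. rewrite neg_cos, neg_sin. reflexivity. Qed.

Lemma driving_eq rho T t : rho < -2 -> t < T ->
  SLE0_driving rho T 0 t = (2 + / (- (rho + 2) / 4)) * atan (tau (- (rho + 2) / 4) T t).
Proof.
intros Hr Ht. unfold SLE0_driving. 
replace ((rho + 2) / 4 * (T - t)) with (- (rho + 2) / 4 * (t - T)) by field.
rewrite asin_ee by (trivial; lra). field. lra.
Qed.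

Theorem proposition12 :
  forall (rho T : R) (gamma : R -> C) (b : Rbar) (eta : R -> C),
    rho < -2 ->
    whole_plane_SLE0 rho T 0 gamma ->
    arc_length_parametrization T gamma b eta ->
    (exists eta' : R -> M0,
       is_lift (fun t => Rbar_lt t b) eta eta' /\
       is_lim (fun t => arg (eta' t)) m_infty 0 /\
       is_flow_line (fun z => (6 + rho) / 4 * arg z + PI)
         (fun t => Rbar_lt t b) eta') /\
    (exists (y0 : R) (x0 : Rbar) (line : R -> M0),
       0 < y0 /\ x0 <> p_infty /\
       (* [line] selects the branch of the power function *)
       is_lift (fun _ => True) (fun x => (x, y0)) line /\
       is_lim (fun x => arg (M0_pow (line x) (- 4 / (2 + rho)))) p_infty 0 /\
       forall z : C,
         (exists t : R, Rbar_lt t b /\ eta t = z) <->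
         (exists x : R, Rbar_lt x0 x /\
            M0_proj (M0_pow (line x) (- 4 / (2 + rho))) = z)).
Proof.
intros rho T gamma b eta Hrho (K & g & HC & HG) ((sigma & Hsb & Hsm & Hso & Hse) & HL).
set (k := - (rho + 2) / 4). assert (Hk : 0 < k) by (unfold k; lra).
assert (Hik : 0 < / k) by (apply Rinv_0_lt_compat; trivial).
replace (- 4 / (2 + rho)) with (/ k) by (unfold k; field; lra).
set (X := abscissa k T). set (y := height k T). assert (Hy : 0 < y) by (apply height_pos; trivial).
assert (Hgam : forall t, t < T -> gamma t = pcurve k y (X t)).
{ intros t Ht. apply (curve_eq k T Hk (SLE0_driving rho T 0) K g); trivial.
  intros s Hs. apply driving_eq; trivial. }
assert (HX : forall s t, s < t -> t < T -> X t < X s) by (intros; apply abscissa_decr; trivial).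
assert (HXc : forall t, t < T -> continuous X t) by (intros; apply abscissa_continuous; trivial).
assert (HXivt : forall s t v, s < t -> t < T -> X t <= v <= X s -> exists u, s <= u <= t /\ X u = v).
{ intros s t v Hst Ht [Hv1 Hv2].
  destruct Hv1 as [Hv1|Hv1]; [|exists t; split; [lra | trivial]].
  destruct Hv2 as [Hv2|Hv2]; [|exists s; split; [lra | auto]].
  destruct (Ranalysis5.IVT_interv (fun t => v - X t) s t) as (u & Hu & Eu); try lra.
  - intros a Ha. apply continuity_pt_minus. apply continuity_pt_const; intros ? ?; trivial.
    apply continuity_pt_filterlim, HXc. lra.
  - exists u. split; [lra|]. lra. }
(* [V] is the abscissa as a function of arc length. *)
assert (HVex : exists V : R -> R, forall t, t < T -> V (sigma t) = X t).
{ exists (fun s => match excluded_middle_informative (exists t, t < T /\ sigma t = s) with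
    | left H => X (proj1_sig (constructive_indefinite_description _ H)) | right _ => 0 end).
  intros t Ht. destruct (excluded_middle_informative _) as [H|H].
  - destruct (constructive_indefinite_description _ H) as (u & Hu & Eu). simpl.
    destruct (Rtotal_order u t) as [h|[h|h]].
    + generalize (Hsm u t h Ht). lra.
    + subst; trivial.
    + generalize (Hsm t u h Hu). lra.
  - exfalso. apply H. exists t. split; trivial. }
destruct HVex as [V HV].
assert (Hsinv : forall s t, s < T -> t < T -> sigma s < sigma t -> s < t).
{ intros s t Hs Ht H. apply Rnot_le_lt. intros [h|h]. generalize (Hsm t s h Hs); lra. subst; lra. }
assert (HVeta : forall s : R, Rbar_lt s b -> eta s = pcurve k y (V s)).
{ intros s Hs. destruct (Hso s Hs) as (t & Ht & <-). rewrite HV, Hse, Hgam; trivial. }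
assert (HVdecr : forall s t : R, s < t -> Rbar_lt t b -> V t < V s).
{ intros s t Hst Ht. assert (Hs : Rbar_lt s b) by (apply Rbar_lt_le_trans_R with t; trivial; lra).
  destruct (Hso s Hs) as (s' & Hs' & <-). destruct (Hso t Ht) as (t' & Ht' & <-).
  rewrite !HV by trivial. apply HX; trivial. apply Hsinv; trivial. }
assert (HVivt : forall (s t : R) v, s < t -> Rbar_lt t b -> V t <= v <= V s ->
  exists u, s <= u <= t /\ V u = v).
{ intros s t v Hst Ht Hv. assert (Hs : Rbar_lt s b) by (apply Rbar_lt_le_trans_R with t; trivial; lra).
  destruct (Hso s Hs) as (s' & Hs' & <-). destruct (Hso t Ht) as (t' & Ht' & <-).
  rewrite !HV in Hv by trivial. assert (Hlt := Hsinv s' t' Hs' Ht' Hst).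
  destruct (HXivt s' t' v Hlt Ht' Hv) as (u & Hu & Eu). exists (sigma u). rewrite HV by lra.
  split; trivial. split.
  - destruct (proj1 Hu) as [h|h]; [left; apply Hsm; lra | subst; lra].
  - destruct (proj2 Hu) as [h|h]; [left; apply Hsm; lra | subst; lra]. }
assert (HVc : forall s : R, Rbar_lt s b -> continuous V s).
{ intros s Hs. eapply V_continuous; eassumption. }
assert (Hlift : forall s : R, Rbar_lt s b -> continuous_M0 (fun s => M0_pow (line y Hy (V s)) (/ k)) s).
{ intros s Hs. split; simpl.
  - unfold Rpower. apply (Rlim_comp exp); [|apply continuous_exp].
    apply Rlim_mult; [apply filterlim_const|]. apply (Rlim_comp ln).
    + apply (Rlim_comp (fun v => Cmod (v, y)) V (V s)). apply HVc; trivial. apply (continuous_line y Hy).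
    + apply continuous_ln. apply slit_Cmod, slit_line; trivial.
  - apply Rlim_mult; [apply filterlim_const|]. apply (Rlim_comp (theta y)). apply HVc; trivial.
    apply continuous_theta; trivial. }
split.
- exists (fun s => M0_pow (line y Hy (V s)) (/ k)). split; [|split].
  + intros s Hs. split. apply Hlift; trivial. rewrite line_pow_proj, HVeta; trivial.
  + assert (HVlim : filterlim V (Rbar_locally' m_infty) (Rbar_locally' p_infty)).
    { intros P [M HM]. destruct (abscissa_infty k T Hk M) as (t & Ht & HMt).
      exists (sigma t). intros s Hs. apply HM. eapply Rlt_trans; [exact HMt|].
      fold X. rewrite <- HV by trivial. apply HVdecr; auto. }
    apply (Rlim_eq (F:=Rbar_locally' m_infty) (fun s => / k * theta y (V s)) (/ k * 0)); [|ring].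
    apply Rlim_mult; [apply filterlim_const|].
    eapply filterlim_comp. exact HVlim. apply theta_lim; trivial.
  + intros s Hs. split; [apply Hlift; trivial | split].
    * apply CDer_is_derive. apply CDer_ext with (fun s => pcurve k y (V s)).
      { intros; symmetry; apply line_pow_proj. }
      eapply CDer_eq. apply (CDer_arc_length (pcurve k y) (dpcurve k y) b eta V); trivial.
      { intros v. apply CDer_pcurve; trivial. }
      { intros v. apply dpcurve_continuous; trivial. }
      { intros v. apply dpcurve_neq_0; trivial. }
      rewrite dpcurve_direction by trivial. simpl. rewrite cis_add_PI. f_equal. f_equal.
      unfold k. field. lra.
    * simpl.
      apply (continuous_comp (fun s => (6 + rho) / 4 * (/ k * theta y (V s)) + PI) cis).
      -- apply Rlim_plus; [|apply filterlim_const]. apply Rlim_mult; [apply filterlim_const|].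
         apply (Hlift s Hs).
      -- apply (ex_derive_continuous (V:=C_R_NormedModule) cis). eexists.
         apply CDer_is_derive. apply (CDer_cis (fun x => x)). apply @is_derive_id.
(* The abscissas attained are those above their infimum, which is not attained. *)
- exists y, (Glb_Rbar (fun x => exists t, t < T /\ X t = x)), (line y Hy).
  assert (Hglb := Glb_Rbar_correct (fun x => exists t, t < T /\ X t = x)).
  set (x0 := Glb_Rbar _) in *. destruct Hglb as [Hg1 Hg2].
  split; [exact Hy|]. split; [|split; [|split]].
  + intros E. assert (Ht : T - 1 < T) by lra. specialize (Hg1 (X (T - 1)) (ex_intro _ _ (conj Ht eq_refl))).
    rewrite E in Hg1. exact Hg1.
  + intros v _. split. apply continuous_line. apply line_proj.
  + apply (Rlim_eq (F:=Rbar_locally' p_infty) (fun v => / k * theta y v) (/ k * 0)); [|ring].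
    apply Rlim_mult; [apply filterlim_const|]. apply theta_lim; trivial.
  + intros z. split.
    * intros (s & Hs & Ez). destruct (Hso s Hs) as (t & Ht & <-). exists (X t). split.
      -- assert (Ht' : (t + T) / 2 < T) by lra.
         apply Rbar_le_lt_trans with (X ((t + T) / 2)).
         apply Hg1. exists ((t + T) / 2). split; trivial. apply HX; lra.
      -- rewrite line_pow_proj. rewrite <- Hgam, <- Hse; trivial.
    * intros (x & Hx & Ez). rewrite line_pow_proj in Ez.
      assert (H1 : exists t, t < T /\ X t < x).
      { apply NNPP. intros Hn. apply (Rbar_lt_not_le _ _ Hx). apply Hg2.
        intros x' (t & Ht & <-). apply Rnot_lt_le. intros H. apply Hn. exists t. split; trivial. }
      destruct H1 as (t & Ht & Htx). destruct (abscissa_infty k T Hk x) as (t' & Ht' & Htx').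
      fold X in Htx'.
      assert (Hlt : t' < t).
      { apply Rnot_le_lt. intros [h|h]. generalize (HX t t' h Ht'); lra. subst; lra. }
      destruct (HXivt t' t x Hlt Ht) as (u & Hu & Eu). lra.
      exists (sigma u). assert (Hu' : u < T) by lra. split. apply Hsb; trivial.
      rewrite Hse, Hgam, Eu; trivial.
Qed.
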